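(* There is a universal constant $C\geq 1$ such that the following holds. Let $r>0$ and let $\mu$ be a symmetric probability measure on $\mathbb{R}^{d}$ supported on $\{x\in\mathbb{R}^{d}:\|x\|_{2}\leq r\}$, and let $\Sigma=\int_{\mathbb{R}^{d}}xx^{T}\,d\mu(x)$. Let $n\geq 2$ be an integer and let $X_{1},\ldots,X_{n}$ be i.i.d. random vectors with distribution $\mu$. Then \[\mathbb{E}\left[W_{2,1}\Big(\mu,\frac{1}{2n}\sum_{i=1}^{n}(\delta_{X_{i}}+\delta_{-X_{i}})\Big)^{2}\right]\leq C\|\Sigma\|_{\mathrm{op}}\left(\frac{r^{2}\ln n}{n\|\Sigma\|_{\mathrm{op}}}+\sqrt{\frac{r^{2}\ln n}{n\|\Sigma\|_{\mathrm{op}}}}\right).\]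
   Context: A probability measure $\mu$ on $\mathbb{R}^{d}$ is symmetric if $\mu(A)=\mu(-A)$ for all measurable $A$. $\|\cdot\|_{\mathrm{op}}$ is the operator norm. For probability measures $\nu_{1},\nu_{2}$ on $\mathbb{R}$, $W_{2}(\nu_{1},\nu_{2})=\inf_{\gamma}\left(\int|x-y|^{2}\,d\gamma(x,y)\right)^{1/2}$ over couplings $\gamma$. For probability measures $\mu_{1},\mu_{2}$ on $\mathbb{R}^{d}$, $W_{2,1}(\mu_{1},\mu_{2})=\sup_{v\in\mathbb{R}^{d},\|v\|_{2}=1}W_{2}(v_{\#}\mu_{1},v_{\#}\mu_{2})$, where $v_{\#}\mu_{i}$ is the pushforward of $\mu_{i}$ under $x\mapsto\langle x,v\rangle$. $\delta_{x}$ is the Dirac mass at $x$. *)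

(* Defs.v *)
From HB Require Import structures.
From mathcomp Require Import all_boot all_order all_algebra.
From mathcomp Require Import all_classical all_reals all_analysis.
From mathcomp Require Import Rstruct Rstruct_topology.
Set Implicit Arguments. Unset Strict Implicit. Unset Printing Implicit Defensive.
Import Order.TTheory GRing.Theory Num.Theory.
Import numFieldNormedType.Exports.
Local Open Scope classical_set_scope.
Local Open Scope ring_scope.

(* Stdlib reals, carrying the Borel sigma-algebra (measurableTypeR is the identity on the carrier) *)
Notation RR := (measurableTypeR Rdefinitions.R).

(* R^d is modelled as d.-tuple RR, with the library's product (= Borel) sigma-algebra *)
Definition dotv (d : nat) (x v : d.-tuple RR) : RR := \sum_(i < d) tnth x i * tnth v i.
Definition norm2 (d : nat) (x : d.-tuple RR) : RR := Num.sqrt (dotv x x).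
Definition negv (d : nat) (x : d.-tuple RR) : d.-tuple RR := map_tuple (fun a => - a) x.

Definition symmetric_measure (d : nat) (mu : set (d.-tuple RR) -> \bar RR) :=
  forall A : set (d.-tuple RR), measurable A -> mu A = mu (@negv d @` A).

Definition supported_in_ball (d : nat) (mu : set (d.-tuple RR) -> \bar RR) (r : RR) :=
  mu [set x | r < norm2 x] = 0%E.

Definition second_moment (d : nat) (mu : {measure set (d.-tuple RR) -> \bar RR}) : 'M[RR]_d :=
  \matrix_(i < d, j < d) Rintegral mu setT (fun x => tnth x i * tnth x j).

Definition norm2c (d : nat) (v : 'cV[RR]_d) : RR := Num.sqrt (\sum_(i < d) v i 0 ^+ 2).
Definition opnorm (d : nat) (A : 'M[RR]_d) : RR :=
  sup [set norm2c (A *m v) | v in [set v : 'cV[RR]_d | norm2c v = 1]].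

Definition coupling (nu1 nu2 : set RR -> \bar RR) (g : probability (RR * RR)%type RR) :=
  (forall A : set RR, measurable A -> g (A `*` setT) = nu1 A) /\
  (forall B : set RR, measurable B -> g (setT `*` B) = nu2 B).

Definition W2 (nu1 nu2 : set RR -> \bar RR) : \bar RR :=
  sqrte (ereal_inf [set c | exists g : probability (RR * RR)%type RR,
          coupling nu1 nu2 g /\ c = (\int[g]_z ((z.1 - z.2) ^+ 2)%:E)%E]).

Definition W21 (d : nat) (mu1 mu2 : set (d.-tuple RR) -> \bar RR) : \bar RR :=
  ereal_sup [set W2 (pushforward mu1 (fun x => dotv x v)) (pushforward mu2 (fun x => dotv x v))
            | v in [set v : d.-tuple RR | norm2 v = 1]].

Definition sym_empirical (d n : nat) (x : 'I_n -> d.-tuple RR) : set (d.-tuple RR) -> \bar RR :=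
  fun A => (((2 * n)%:R)^-1%:E * \sum_(i < n) (\d_(x i) A + \d_(negv (x i)) A))%E.

Definition iid_with_law (dT : measure_display) (T : measurableType dT)
  (P : probability T RR) (d n : nat) (X : 'I_n -> T -> d.-tuple RR)
  (mu : set (d.-tuple RR) -> \bar RR) :=
  (forall i, measurable_fun setT (X i)) /\
  forall A : 'I_n -> set (d.-tuple RR), (forall i, measurable (A i)) ->
    P (\bigcap_(i in [set: 'I_n]) (X i @^-1` A i)) = (\prod_(i < n) mu (A i))%E.

(* Main.v *)
(* For symmetric laws on the line the quantile coupling pairs numbers of equal sign, where
   (x - y)^2 <= |x^2 - y^2|; so W_2^2 is at most the L^1 distance between the tails of the
   squares.  By duality this distance is the supremum of the empirical process over the functions
   f_s(<x, v>^2), where v is a unit vector and f_s a 1-Lipschitz function with increments +-delta.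
   Discretizing the sphere and the space leaves a finite process.

   After symmetrization, fix a sample and put M^2 = max_v sum_i <X_i, v>^2.  The functions f_s have
   nets of size exp(O(16^k ln n)) with relative error 16^-k, and comparing two indices at the first
   level that separates them dominates the increments of the process by those of the maximum of a
   family of Rademacher sums, one coordinate per net point.  A contraction principle for such
   vector-valued comparisons therefore bounds the process by maxima of sums
   sum_i eps_i <X_i, v>^2 over few sign systems eps.  For one sign system this is a quadratic form
   of a Rademacher sum of rank one matrices; its trace moments, obtained by flipping single signs
   (noncommutative Khintchine), give r M sqrt(ln n), and the union bound over the net is absorbed
   by a larger moment.  Since M^2 is itself bounded by n |Sigma| plus the process, the resulting
   quadratic inequality yields the theorem. *)

Require Import Defs.
From HB Require Import structures.
From mathcomp Require Import all_boot all_order all_algebra.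
From mathcomp Require Import all_classical all_reals all_analysis.
From mathcomp Require Import measurable_realfun Rstruct Rstruct_topology.
From mathcomp Require Import zify ring lra.
Set Implicit Arguments. Unset Strict Implicit. Unset Printing Implicit Defensive.
Import Order.TTheory GRing.Theory Num.Theory.
Import numFieldNormedType.Exports.
Local Open Scope classical_set_scope.
Local Open Scope ring_scope.

(** * Moments of Rademacher sums of rank one matrices *)

(** The bound must not depend on [d], so a union bound over directions is not affordable. The
    supremum over [v] is taken inside an operator norm and only the patterns [s] are enumerated; the
    net of the sphere serves finiteness alone, and its size enters no estimate.

    A scalar contraction principle does not apply to the summands [f_s(<X_i, v>^2)], because the
    function varies together with its argument. Nets of patterns convert a change of function into a
    change of indicator coordinates weighted by [<X_i, v>^2]. Moments of order [8 * 64 ^ k * L] at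
    level [k], with [L] of order [ln n], give fluctuations [8 ^ k] times a common scale; the weights
    of order [16 ^ -k] leave the summable [2 ^ -k].

    No matrix is diagonalized: Cauchy-Schwarz for the numbers [<x, W^j x>] does all the spectral
    work. It reaches high powers by repeated squaring, which is why [L] and all moment orders are
    powers of two. *)

Section Averages.
Variable R : realFieldType.

Definition avg (T : finType) (h : T -> R) : R := (\sum_w h w) / #|T|%:R.

Lemma avgD (T : finType) (h k : T -> R) : avg (fun w => h w + k w) = avg h + avg k.
Proof. by rewrite /avg big_split /= mulrDl. Qed.

Lemma avgZ (T : finType) c (h : T -> R) : avg (fun w => c * h w) = c * avg h.
Proof. by rewrite /avg -mulr_sumr mulrA. Qed.

Lemma avg_sum (T I : finType) (h : I -> T -> R) :
  avg (fun w => \sum_i h i w) = \sum_i avg (h i).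
Proof. by rewrite /avg exchange_big /= mulr_suml. Qed.

Lemma eq_avg (T : finType) (h k : T -> R) : h =1 k -> avg h = avg k.
Proof. by move=> hk; rewrite /avg (eq_bigr k). Qed.

Lemma le_avg (T : finType) (h k : T -> R) : (forall w, h w <= k w) -> avg h <= avg k.
Proof. by move=> hk; rewrite /avg ler_wpM2r ?invr_ge0 ?ler0n// ler_sum. Qed.

Lemma avg_cst (T : finType) c : (0 < #|T|)%N -> avg (fun _ : T => c) = c.
Proof.
move=> T0; rewrite /avg sumr_const -[X in X / _]mulr_natr mulfK//.
by rewrite pnatr_eq0 -lt0n.
Qed.

Lemma avg_ge0 (T : finType) (h : T -> R) : (forall w, 0 <= h w) -> 0 <= avg h.
Proof. by move=> h0; rewrite /avg divr_ge0 ?ler0n ?sumr_ge0. Qed.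

End Averages.

Section Signs.
Variables (R : realFieldType) (K : finType).
Implicit Types (w : {ffun K -> bool}) (D : pred K).

Definition sgb (b : bool) : R := if b then 1 else -1.

Definition flip D w : {ffun K -> bool} := [ffun k => w k (+) D k].

Lemma sgb_sqr b : sgb b * sgb b = 1.
Proof. by case: b; rewrite /sgb; ring. Qed.

Lemma sgb_flip D w k : sgb (flip D w k) = if D k then - sgb (w k) else sgb (w k).
Proof. by rewrite ffunE; case: (D k); case: (w k); rewrite /sgb /= ?opprK. Qed.

Lemma card_signs : (0 < #|{ffun K -> bool}|)%N.
Proof. by rewrite card_ffun card_bool expn_gt0. Qed.

(* The flipped coordinates may depend on the sign pattern, provided that the flip does not change them. *)
Lemma avg_flip (D : {ffun K -> bool} -> pred K) (h : {ffun K -> bool} -> R) :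
  (forall w, D (flip (D w) w) =1 D w) -> avg (fun w => h (flip (D w) w)) = avg h.
Proof.
move=> hD; congr (_ / _); rewrite [RHS](reindex_inj (h := fun w => flip (D w) w))//.
apply: (can_inj (g := fun w => flip (D w) w)) => w.
by apply/ffunP => k; rewrite !ffunE hD -addbA addbb addbF.
Qed.

End Signs.

(** * Cross moments of two moment sequences *)

Section EvenMoments.
Variable R : rcfType.

(** From the first index where [D] exceeds [D 0], convexity forces strict increase up to [p], which
    contradicts [D p = D 0]. *)
Lemma convex_le_ends (D : nat -> R) p a :
  (forall i, (i.+2 <= p)%N -> 2 * D i.+1 <= D i + D i.+2) -> D p = D 0%N ->
  (a <= p)%N -> D a <= D 0%N.
Proof.
move=> cD Dp ap; rewrite leNgt; apply/negP => Da.
have ex : exists i, D 0%N < D i by exists a.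
have := ex_minnP ex; case; case=> [|i]; first by rewrite ltxx.
move=> Di imin.
have ia : (i < a)%N by apply: imin.
have Di' : D i <= D 0%N by rewrite leNgt; apply/negP => /imin; rewrite ltnn.
have incr : forall j, (i + j.+1 <= p)%N -> D (i + j)%N < D (i + j.+1)%N.
  elim=> [|j IH] hj; first by rewrite addn0 addn1; lra.
  have hj' : (i + j.+1 <= p)%N by apply: leq_trans hj; rewrite leq_add2l.
  have := IH hj'; have := cD (i + j)%N; rewrite -!addnS => /(_ hj); lra.
have mono : forall j, (i + j.+1 <= p)%N -> D 0%N < D (i + j.+1)%N.
  elim=> [|j IH] hj; first by rewrite addn1.
  by apply: lt_trans (incr _ hj); apply: IH; apply: leq_trans hj; rewrite leq_add2l.
have := mono (p - i.+1)%N; rewrite addnS -addSn subnKC; last exact: leq_trans ap.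
by rewrite Dp ltxx => /(_ (leqnn _)).
Qed.

(** Arithmetic-geometric mean for [a * d] and [b * c], whose product dominates [(x * y) ^+ 2]. *)
Lemma mulr_le_mean (a b c d x y : R) : 0 <= a -> 0 <= b -> 0 <= c -> 0 <= d ->
  x ^+ 2 <= a * b -> y ^+ 2 <= c * d -> 2 * (x * y) <= a * d + b * c.
Proof.
move=> a0 b0 c0 d0 hx hy.
have h0 : 0 <= a * d + b * c by rewrite addr_ge0// mulr_ge0.
have [xy0|xy0] := leP (x * y) 0; first lra.
rewrite -(@ler_pXn2r _ 2)// ?nnegrE//; last lra.
have : (x * y) ^+ 2 <= (a * b) * (c * d).
  by rewrite exprMn ler_pM// sqr_ge0.
have := sqr_ge0 (a * d - b * c); nra.
Qed.

Variables u w : nat -> R.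
Hypothesis u0w0 : u 0%N = w 0%N.
Hypothesis u_ge0 : forall a, 0 <= u a.*2.
Hypothesis w_ge0 : forall a, 0 <= w a.*2.
Hypothesis uCS : forall a b, u (a + b)%N ^+ 2 <= u a.*2 * u b.*2.
Hypothesis wCS : forall a b, w (a + b)%N ^+ 2 <= w a.*2 * w b.*2.

(** The model is [u j = <x, W^j x>] and [w j = <x, Y^j x>] with symmetric [W] and [Y]. By
    Cauchy-Schwarz the left side is convex in [a]; it is also symmetric under [a -> p - a], so it is
    largest at the ends. *)
Lemma even_cross_moments p a : (a <= p)%N ->
  u a.*2 * w (p - a).*2 + u (p - a).*2 * w a.*2 <= u 0%N * (u p.*2 + w p.*2).
Proof.
move=> ap; pose D a := u a.*2 * w (p - a).*2 + u (p - a).*2 * w a.*2.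
have D0 : D 0%N = u 0%N * (u p.*2 + w p.*2).
  by rewrite /D subn0 double0 -u0w0; ring.
rewrite -D0; apply: (@convex_le_ends D p a) => //; last first.
  by rewrite /D subnn subn0; ring.
move=> i ip; rewrite /D.
have e2 : (p - i.+1 = (p - i.+2).+1)%N by rewrite subnSK.
have e1 : (p - i = (p - i.+2).+2)%N by rewrite -e2 subnSK // ltnW.
rewrite e1 e2; set j := (p - i.+2)%N.
have H (f g : nat -> R) : (forall a, 0 <= f a.*2) -> (forall a, 0 <= g a.*2) ->
  (forall a b, f (a + b)%N ^+ 2 <= f a.*2 * f b.*2) ->
  (forall a b, g (a + b)%N ^+ 2 <= g a.*2 * g b.*2) ->
  2 * (f i.+1.*2 * g j.+1.*2) <= f i.*2 * g j.+2.*2 + f i.+2.*2 * g j.*2.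
  move=> f0 g0 fCS gCS.
  apply: (mulr_le_mean (f0 _) (f0 _) (g0 _) (g0 _)).
    by have := fCS i i.+2; rewrite addnS -addSn addnn.
  by have := gCS j j.+2; rewrite addnS -addSn addnn mulrC [X in _ <= X]mulrC.
have := H u w u_ge0 w_ge0 uCS wCS; have := H w u w_ge0 u_ge0 wCS uCS.
by lra.
Qed.

(** Odd moments may be negative; the mean inequality bounds the products at [q = a.*2.+1] by those
    at the two neighbouring even positions. *)
Lemma cross_moments p q : (q <= p.*2)%N ->
  u q * w (p.*2 - q) + u (p.*2 - q) * w q <= u 0%N * (u p.*2 + w p.*2).
Proof.
move=> qp; rewrite -[q]odd_double_half; case: (boolP (odd q)) => oq; last first.
  rewrite add0n -doubleB; apply: even_cross_moments.
  by rewrite -leq_double; apply: leq_trans qp; rewrite -[leqRHS]odd_double_half leq_addl.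
set a := q./2; rewrite add1n.
have ap : (a < p)%N.
  rewrite -ltn_double; apply: leq_trans qp.
  by rewrite -[leqRHS]odd_double_half oq add1n.
have [b eb] : exists b, (p - a = b.+1)%N.
  by exists (p - a).-1; rewrite prednK// subn_gt0.
have e1 : (p - a.+1 = b)%N by rewrite subnS eb.
have -> : (p.*2 - a.*2.+1 = b.*2.+1)%N by rewrite subnS -doubleB eb doubleS.
have := even_cross_moments (ltnW ap); have := even_cross_moments ap.
rewrite eb e1.
have H (f g : nat -> R) : (forall a, 0 <= f a.*2) -> (forall a, 0 <= g a.*2) ->
  (forall a b, f (a + b)%N ^+ 2 <= f a.*2 * f b.*2) ->
  (forall a b, g (a + b)%N ^+ 2 <= g a.*2 * g b.*2) ->
  2 * (f a.*2.+1 * g b.*2.+1) <= f a.*2 * g b.+1.*2 + f a.+1.*2 * g b.*2.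
  move=> f0 g0 fCS gCS; apply: (mulr_le_mean (f0 _) (f0 _) (g0 _) (g0 _)).
    by have := fCS a a.+1; rewrite addnS addnn.
  by have := gCS b b.+1; rewrite addnS addnn.
have := H u w u_ge0 w_ge0 uCS wCS; have := H w u w_ge0 u_ge0 wCS uCS.
lra.
Qed.

Lemma sum_cross_moments p :
  2 * (\sum_(q < p.*2.+1) u q * w (p.*2 - q)%N) <=
  p.*2.+1%:R * (u 0%N * (u p.*2 + w p.*2)).
Proof.
have -> : 2 * (\sum_(q < p.*2.+1) u q * w (p.*2 - q)%N) =
  \sum_(q < p.*2.+1) (u q * w (p.*2 - q)%N + u (p.*2 - q)%N * w q).
  rewrite big_split /= mulr_natl mulr2n; congr (_ + _).
  rewrite (reindex_inj rev_ord_inj) /=; apply: eq_bigr => q _.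
  by rewrite subSS subKn // -ltnS.
apply: (le_trans (y := \sum_(q < p.*2.+1) (u 0%N * (u p.*2 + w p.*2)))).
  by apply: ler_sum => q _; apply: cross_moments; rewrite -ltnS.
by rewrite sumr_const card_ord mulr_natl.
Qed.

End EvenMoments.

(** * Inner products, powers and traces of symmetric matrices *)

Section Dot.
Variables (R : rcfType) (d : nat).
Implicit Types (a b x : 'cV[R]_d).

Definition dot a b : R := \sum_i a i 0 * b i 0.

Lemma dotC a b : dot a b = dot b a.
Proof. by apply: eq_bigr => i _; rewrite mulrC. Qed.

Lemma dot_ge0 a : 0 <= dot a a.
Proof. by apply: sumr_ge0 => i _; rewrite -expr2 sqr_ge0. Qed.

Lemma dotDl a b x : dot (a + b) x = dot a x + dot b x.
Proof. by rewrite /dot -big_split; apply: eq_bigr => i _; rewrite mxE mulrDl. Qed.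

Lemma dotBl a b x : dot (a - b) x = dot a x - dot b x.
Proof. by rewrite /dot -sumrB; apply: eq_bigr => i _; rewrite !mxE mulrBl. Qed.

Lemma dotZl c a x : dot (c *: a) x = c * dot a x.
Proof. by rewrite /dot mulr_sumr; apply: eq_bigr => i _; rewrite !mxE mulrA. Qed.

Lemma dotDr a b x : dot x (a + b) = dot x a + dot x b.
Proof. by rewrite ![dot x _]dotC dotDl. Qed.

Lemma dotBr a b x : dot x (a - b) = dot x a - dot x b.
Proof. by rewrite ![dot x _]dotC dotBl. Qed.

Lemma dot_mx a b : dot a b = (a^T *m b) 0 0.
Proof. by rewrite mxE; apply: eq_bigr => i _; rewrite mxE. Qed.

Lemma dot_CS a b : dot a b ^+ 2 <= dot a a * dot b b.
Proof.
have : 0 <= \sum_i \sum_j (a i 0 * b j 0 - a j 0 * b i 0) ^+ 2.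
  by apply: sumr_ge0 => i _; apply: sumr_ge0 => j _; exact: sqr_ge0.
have -> : \sum_i \sum_j (a i 0 * b j 0 - a j 0 * b i 0) ^+ 2 =
  \sum_i \sum_j (a i 0 * a i 0 * (b j 0 * b j 0)) +
  \sum_i \sum_j (b i 0 * b i 0 * (a j 0 * a j 0)) -
  2 * \sum_i \sum_j (a i 0 * b i 0 * (a j 0 * b j 0)).
  rewrite mulr_sumr -!big_split /= -sumrB; apply: eq_bigr => i _.
  by rewrite mulr_sumr -!big_split /= -sumrB; apply: eq_bigr => j _; ring.
by rewrite -!big_distrlr /= -!/(dot _ _) expr2; lra.
Qed.

Lemma dot_sym_mx (W : 'M[R]_d) a b : W^T = W -> dot (W *m a) b = dot a (W *m b).
Proof. by move=> sW; rewrite !dot_mx trmx_mul sW mulmxA. Qed.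

Lemma dot_delta a i : dot (delta_mx i 0) a = a i 0.
Proof.
rewrite /dot (bigD1 i)//= big1 ?addr0 => [|j ji].
  by rewrite !mxE !eqxx /= mul1r.
by rewrite !mxE (negbTE ji) mul0r.
Qed.

Lemma sum_dot_delta a : \sum_(i < d) dot (delta_mx i 0) a ^+ 2 = dot a a.
Proof. by apply: eq_bigr => i _; rewrite dot_delta. Qed.

End Dot.

Section SymPowers.
Variables (R : rcfType) (d : nat).
Implicit Types (W Y : 'M[R]_d) (x v : 'cV[R]_d).

Lemma tr_exp W j : W^T = W -> (W ^+ j)^T = W ^+ j.
Proof.
move=> sW; elim: j => [|j IH]; first by rewrite expr0 trmx1.
by rewrite {1}exprS -mulmxE trmx_mul IH sW mulmxE -exprSr.
Qed.

(** For symmetric [W], the [j]-th moment of its spectral measure at [x]. *)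
Definition qf W j x : R := dot x (W ^+ j *m x).

Lemma qfD W a b x : W^T = W -> qf W (a + b) x = dot (W ^+ a *m x) (W ^+ b *m x).
Proof. by move=> sW; rewrite /qf exprD -mulmxE -mulmxA dot_sym_mx// tr_exp. Qed.

Lemma qf_ge0 W a x : W^T = W -> 0 <= qf W a.*2 x.
Proof. by move=> sW; rewrite -addnn qfD// dot_ge0. Qed.

Lemma qf_CS W a b x : W^T = W -> qf W (a + b) x ^+ 2 <= qf W a.*2 x * qf W b.*2 x.
Proof. by move=> sW; rewrite -!addnn !qfD//; exact: dot_CS. Qed.

Lemma qf0 W x : qf W 0 x = dot x x.
Proof. by rewrite /qf expr0 mul1mx. Qed.

(** In the application [W - Y] has rank one, so that each term, once traced, splits into two
    quadratic forms by [trace_rank1_cross]. *)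
Lemma subXX_telescope W Y m :
  W ^+ m.+1 - Y ^+ m.+1 = \sum_(q < m.+1) W ^+ q * (W - Y) * Y ^+ (m - q).
Proof.
elim: m => [|m IH]; first by rewrite big_ord1 /= !expr0 !expr1 mul1r mulr1.
rewrite big_ord_recr /= subnn expr0 mulr1.
have -> : \sum_(i < m.+1) W ^+ i * (W - Y) * Y ^+ (m.+1 - i) =
   (\sum_(i < m.+1) W ^+ i * (W - Y) * Y ^+ (m - i)) * Y.
  by rewrite mulr_suml; apply: eq_bigr => -[i /= im] _; rewrite subSn// exprSr mulrA.
by rewrite -IH mulrBl mulrBr -!exprSr addrC addrA subrK.
Qed.

Lemma trace_rank1_cross W Y x q k :
  \tr ((x *m x^T) *m (W ^+ q *m (x *m x^T) *m Y ^+ k)) = qf W q x * qf Y k x.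
Proof.
have -> : (x *m x^T) *m (W ^+ q *m (x *m x^T) *m Y ^+ k) =
  x *m ((x^T *m W ^+ q *m x) *m (x^T *m Y ^+ k)) by rewrite !mulmxA.
set a : 'M[R]_1 := _ *m W ^+ q *m x; rewrite mxtrace_mulC -mulmxA trace_mx11.
by rewrite [LHS]mxE big_ord1 /qf !dot_mx !mulmxA.
Qed.

Lemma trace_sqr_ge W v : W^T = W -> dot v v = 1 -> dot v (W *m v) ^+ 2 <= \tr (W *m W).
Proof.
move=> sW v1; apply: le_trans (dot_CS _ _) _; rewrite v1 mul1r.
have -> : \tr (W *m W) = \sum_i dot (row i W)^T (row i W)^T.
  apply: eq_bigr => i _; rewrite mxE; apply: eq_bigr => j _.
  by rewrite !mxE -{2}sW mxE.
rewrite {1}/dot; apply: ler_sum => i _.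
have -> : (W *m v) i 0 = dot (row i W)^T v.
  by rewrite mxE; apply: eq_bigr => j _; rewrite !mxE.
by rewrite -expr2; apply: le_trans (dot_CS _ _) _; rewrite v1 mulr1.
Qed.

(** Each use of Cauchy-Schwarz against the unit vector [v] doubles the power of [W]; the last one is
    spent on the comparison with the trace. *)
Lemma trace_pow2_ge W v h : W^T = W -> dot v v = 1 ->
  dot v (W *m v) ^+ (2 ^ h.+1) <= \tr (W ^+ (2 ^ h.+1)).
Proof.
move=> sW v1.
have step k : dot v (W *m v) ^+ (2 ^ k.+1) <= qf W (2 ^ k) v ^+ 2.
  elim: k => [|k IH]; first by rewrite expn0 expn1 /qf expr1.
  rewrite [(2 ^ k.+2)%N]expnSr exprM ler_pXn2r// ?nnegrE.
  - have := qf_CS (2 ^ k) 0 v sW; rewrite addn0 double0 qf0 v1 mulr1 -mul2n -expnS.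
    exact: le_trans.
  - by rewrite expnSr exprM sqr_ge0.
  - by rewrite expnS mul2n qf_ge0.
apply: le_trans (step h) _; apply: le_trans (trace_sqr_ge _ v1) _.
  exact: tr_exp.
by rewrite mulmxE -exprD addnn -mul2n -expnS.
Qed.

Lemma trace_even W p : W^T = W ->
  \tr (W ^+ p.*2) = \sum_(a < d) dot (W ^+ p *m delta_mx a 0) (W ^+ p *m delta_mx a 0).
Proof.
move=> sW; apply: eq_bigr => a _.
by rewrite dot_sym_mx ?tr_exp// mulmxA mulmxE -exprD addnn dot_delta -colE mxE.
Qed.

Lemma trace_even_ge0 W p : W^T = W -> 0 <= \tr (W ^+ p.*2).
Proof. by move=> sW; rewrite trace_even// sumr_ge0// => a _; exact: dot_ge0. Qed.

End SymPowers.

(** * Noncommutative Khintchine inequality for rank one summands *)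

Section RademacherRankOne.
Variables (R : rcfType) (d : nat) (I K : finType) (y : I -> 'cV[R]_d).
Implicit Types (kap : I -> K) (w : {ffun K -> bool}).

(** [kap i] names the coordinate of [w] that supplies the sign of summand [i]; many sign systems
    thus share one sign space. *)
Definition rank1_sum kap w : 'M[R]_d :=
  \sum_i sgb R (w (kap i)) *: (y i *m (y i)^T).

Lemma tr_rank1_sum kap w : (rank1_sum kap w)^T = rank1_sum kap w.
Proof.
rewrite /rank1_sum linear_sum; apply: eq_bigr => i _ /=.
by rewrite linearZ /= trmx_mul trmxK.
Qed.

Lemma dot_rank1_sum kap w v :
  dot v (rank1_sum kap w *m v) = \sum_i sgb R (w (kap i)) * dot (y i) v ^+ 2.
Proof.
rewrite dot_mx mulmxA mulmx_sumr mulmx_suml summxE; apply: eq_bigr => i _.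
rewrite -scalemxAr -scalemxAl mxE; congr (_ * _).
by rewrite !mulmxA -(mulmxA (v^T *m y i)) [LHS]mxE big_ord1 -!dot_mx dotC expr2.
Qed.

Lemma rank1_sum_flip kap w i : injective kap ->
  rank1_sum kap (flip (pred1 (kap i)) w) =
  rank1_sum kap w - (2 * sgb R (w (kap i))) *: (y i *m (y i)^T).
Proof.
move=> ik; rewrite /rank1_sum (bigD1 i)//= [in RHS](bigD1 i)//= sgb_flip /= eqxx.
rewrite [in LHS](eq_bigr (fun j => sgb R (w (kap j)) *: (y j *m (y j)^T))); last first.
  by move=> j ji; rewrite sgb_flip /= (inj_eq ik) (negbTE ji).
rewrite addrAC -scalerBl; congr (_ *: _ + _); ring.
Qed.

(** Pairing [w] with its flip at [kap i] plays the role of integration by parts: the two signed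
    terms combine into a difference of odd powers of matrices that differ by a rank one term, and
    [sum_cross_moments] bounds the telescoped cross terms. *)
Lemma trace_moment_step kap p : injective kap ->
  avg (fun w => \tr (rank1_sum kap w ^+ p.*2.+2)) <=
  p.*2.+1%:R * \sum_i dot (y i) (y i) * avg (fun w => qf (rank1_sum kap w) p.*2 (y i)).
Proof.
move=> ik; set S := rank1_sum kap.
have -> : avg (fun w => \tr (S w ^+ p.*2.+2)) =
    \sum_i avg (fun w => sgb R (w (kap i)) * \tr ((y i *m (y i)^T) *m S w ^+ p.*2.+1)).
  rewrite -avg_sum; apply: eq_avg => w.
  rewrite exprS -mulmxE {1}/S /rank1_sum mulmx_suml linear_sum /=.
  by apply: eq_bigr => i _; rewrite -scalemxAl linearZ.
rewrite mulr_sumr; apply: ler_sum => i _.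
pose f w := flip (pred1 (kap i)) w.
have sf w : S (f w) = S w - (2 * sgb R (w (kap i))) *: (y i *m (y i)^T).
  exact: rank1_sum_flip.
have avgf (h : {ffun K -> bool} -> R) : avg (fun w => h (f w)) = avg h.
  exact: avg_flip.
have key w : 2 * (sgb R (w (kap i)) * \tr ((y i *m (y i)^T) *m S w ^+ p.*2.+1) +
    sgb R (f w (kap i)) * \tr ((y i *m (y i)^T) *m S (f w) ^+ p.*2.+1)) <=
  2 * (p.*2.+1%:R * (dot (y i) (y i) *
     (qf (S w) p.*2 (y i) + qf (S (f w)) p.*2 (y i)))).
  have sS w' : (S w')^T = S w' by exact: tr_rank1_sum.
  have := @sum_cross_moments R (fun j => qf (S w) j (y i))
    (fun j => qf (S (f w)) j (y i)).
  rewrite !qf0 => /(_ erefl) /(_ (fun a => qf_ge0 a _ (sS _))).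
  move=> /(_ (fun a => qf_ge0 a _ (sS _))) /(_ (fun a b => qf_CS a b _ (sS _))).
  move=> /(_ (fun a b => qf_CS a b _ (sS _))) /(_ p).
  have <- : sgb R (w (kap i)) * \tr ((y i *m (y i)^T) *m S w ^+ p.*2.+1) +
    sgb R (f w (kap i)) * \tr ((y i *m (y i)^T) *m S (f w) ^+ p.*2.+1) =
    2 * (\sum_(q < p.*2.+1) qf (S w) q (y i) * qf (S (f w)) (p.*2 - q) (y i)).
    rewrite sgb_flip /= eqxx mulNr -mulrBr -raddfB -mulmxBr subXX_telescope.
    have -> : S w - S (f w) = (2 * sgb R (w (kap i))) *: (y i *m (y i)^T).
      by rewrite sf opprB addrC subrK.
    rewrite mulmx_sumr raddf_sum /= mulr_sumr mulr_sumr; apply: eq_bigr => q _.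
    rewrite -!mulmxE -scalemxAr -scalemxAl -scalemxAr linearZ /= trace_rank1_cross.
    by rewrite mulrA [_ * (2 * _)]mulrCA sgb_sqr mulr1.
  lra.
have E (h : {ffun K -> bool} -> R) : avg (fun w => h w + h (f w)) = 2 * avg h.
  by rewrite avgD avgf mulr_natl mulr2n.
have := le_avg key; rewrite !avgZ (E (fun w => sgb R (w (kap i)) * _)).
rewrite (E (fun w => qf (S w) _ _)); lra.
Qed.

Variables (r M : R).
Hypothesis y_r : forall i, dot (y i) (y i) <= r ^+ 2.
Hypothesis r_M : r ^+ 2 <= M ^+ 2.
Hypothesis y_M : forall v, \sum_i dot (y i) v ^+ 2 <= M ^+ 2 * dot v v.

(** This is [y_M] at the vectors [W ^+ p *m delta_mx a 0], whose squared lengths add up to the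
    trace. *)
Lemma sum_qf_le_trace W p : W^T = W ->
  \sum_i qf W p.*2 (y i) <= M ^+ 2 * \tr (W ^+ p.*2).
Proof.
move=> sW; have sWp := tr_exp p sW.
rewrite trace_even//.
have -> : \sum_i qf W p.*2 (y i) =
    \sum_(a < d) \sum_i dot (y i) (W ^+ p *m delta_mx a 0) ^+ 2.
  rewrite [RHS]exchange_big /=; apply: eq_bigr => i _.
  rewrite -(addnn p) qfD// -sum_dot_delta; apply: eq_bigr => a _.
  by rewrite dotC dot_sym_mx.
by rewrite mulr_sumr; apply: ler_sum => a _.
Qed.

Lemma trace_moment_rec kap p : injective kap ->
  avg (fun w => \tr (rank1_sum kap w ^+ p.*2.+2)) <=
  p.*2.+1%:R * ((r * M) ^+ 2 * avg (fun w => \tr (rank1_sum kap w ^+ p.*2))).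
Proof.
move=> ik; apply: le_trans (trace_moment_step p ik) _.
rewrite ler_wpM2l ?ler0n//.
apply: (le_trans (y := \sum_i r ^+ 2 * avg (fun w => qf (rank1_sum kap w) p.*2 (y i)))).
  apply: ler_sum => i _; rewrite ler_wpM2r// avg_ge0// => w.
  exact/qf_ge0/tr_rank1_sum.
rewrite -mulr_sumr exprMn -[X in _ <= X]mulrA ler_wpM2l ?sqr_ge0// -avg_sum -avgZ.
by apply: le_avg => w; apply: sum_qf_le_trace; exact: tr_rank1_sum.
Qed.

(** The base case is the second moment, bounded directly by [y_r] and [r_M] with the number of
    summands in front. Starting [trace_moment_rec] from [p = 0] would bring in the trace of the
    identity, that is, the dimension. *)
Lemma trace_moment_bound kap p : injective kap -> (0 < p)%N ->
  avg (fun w => \tr (rank1_sum kap w ^+ p.*2)) <=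
  #|I|%:R * (p.*2%:R * (r * M) ^+ 2) ^+ p.
Proof.
move=> ik; case: p => // p _.
suff : avg (fun w => \tr (rank1_sum kap w ^+ p.+1.*2)) <=
   #|I|%:R * (r * M) ^+ 2 * (p.+1.*2%:R * (r * M) ^+ 2) ^+ p.
  move=> /le_trans; apply; rewrite (exprS _ p) [X in _ <= X]mulrA ler_wpM2r//.
    by rewrite exprn_ge0// mulr_ge0 ?sqr_ge0.
  by rewrite ler_wpM2l// ler_peMl ?sqr_ge0// ler1n.
elim: p => [|p IH].
  rewrite expr0 mulr1; apply: le_trans (trace_moment_step 0 ik) _.
  rewrite mul1r; apply: (le_trans (y := \sum_(i : I) (r * M) ^+ 2)); last first.
    by rewrite sumr_const mulr_natl.
  apply: ler_sum => i _; rewrite (eq_avg (k := fun=> dot (y i) (y i))); last first.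
    by move=> w; rewrite double0 qf0.
  rewrite avg_cst ?card_signs// exprMn ler_pM ?dot_ge0//.
  exact: le_trans (y_r i) r_M.
rewrite doubleS; apply: le_trans (trace_moment_rec _ ik) _.
set c := (r * M) ^+ 2; have c0 : 0 <= c by exact: sqr_ge0.
have n0 : 0 <= #|I|%:R * c by rewrite mulr_ge0.
rewrite (exprS _ p) [X in _ <= X]mulrCA -[X in _ <= X]mulrA.
apply: ler_pM => //.
- by rewrite mulr_ge0// avg_ge0// => w; exact/trace_even_ge0/tr_rank1_sum.
- by rewrite ler_nat.
rewrite ler_wpM2l//; apply: le_trans IH _.
rewrite -/c ler_wpM2l//; apply: lerXn2r; rewrite -/c ?nnegrE ?(mulr_ge0 _ c0)//.
by rewrite ler_wpM2r// ler_nat doubleS ltnW.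
Qed.

(* Markov's inequality at level [B] for the power [2 ^ h], which is large enough to absorb
   a union bound over all the sign systems in [F]. *)
Lemma rademacher_max_bound (F : finType) (kap : F -> I -> K) (h : nat)
    (Q : {ffun K -> bool} -> R) (B : R) :
  (forall f, injective (kap f)) -> (0 < h)%N ->
  (#|F| * #|I| <= 2 ^ (2 ^ h))%N -> 0 < B -> 4 * (2 ^ h)%:R * (r * M) ^+ 2 <= B ^+ 2 ->
  (forall w, exists f, exists2 v, dot v v = 1 &
     Q w <= \sum_i sgb R (w (kap f i)) * dot (y i) v ^+ 2) ->
  avg Q <= 2 * B.
Proof.
move=> ik h0 cardF B0 hB hQ.
have [p ep] : exists p, (2 ^ h = p.*2)%N.
  by exists (2 ^ h.-1)%N; rewrite -mul2n -expnS prednK.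
have p0 : (0 < p)%N by rewrite -double_gt0 -ep expn_gt0.
pose tot w := \sum_f \tr (rank1_sum (kap f) w ^+ p.*2).
have tot_ge0 w : 0 <= tot w.
  by apply: sumr_ge0 => f _; exact/trace_even_ge0/tr_rank1_sum.
have Qle w : Q w <= B + B * (tot w / B ^+ p.*2).
  have [QB|BQ] := leP (Q w) B.
    by apply: le_trans QB _; rewrite lerDl mulr_ge0 ?divr_ge0 ?exprn_ge0// ltW.
  have [f [v v1 Qf]] := hQ w.
  have Q0 : 0 <= Q w by rewrite ltW// (lt_trans B0).
  have pw : Q w ^+ p.*2 <= tot w.
    apply: (le_trans (y := \tr (rank1_sum (kap f) w ^+ p.*2))).
      rewrite -ep -(prednK h0).
      apply: le_trans (trace_pow2_ge _ (tr_rank1_sum _ _) v1).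
      by rewrite dot_rank1_sum; apply: lerXn2r; rewrite ?nnegrE// (le_trans Q0).
    rewrite /tot (bigD1 f)//= lerDl; apply: sumr_ge0 => g _.
    exact/trace_even_ge0/tr_rank1_sum.
  have : Q w <= B * (Q w ^+ p.*2 / B ^+ p.*2).
    rewrite -expr_div_n -[X in X <= _](divfK (x := B)) ?gt_eqF// mulrC ler_pM2l//.
    rewrite -{1}(expr1 (Q w / B)) ler_weXn2l ?double_gt0//.
    by rewrite ler_pdivlMr// mul1r ltW.
  move=> /le_trans; apply; rewrite -[X in X <= _]add0r lerD ?(ltW B0)//.
  by rewrite ler_pM2l// ler_wpM2r// invr_ge0 exprn_ge0// ltW.
apply: le_trans (le_avg Qle) _.
rewrite avgD avg_cst ?card_signs// avgZ mulr_natl mulr2n lerD2l.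
rewrite -[X in _ <= X]mulr1 ler_pM2l//.
rewrite (eq_avg (k := fun w => (B ^+ p.*2)^-1 * tot w)); last by move=> w; rewrite mulrC.
rewrite avgZ mulrC ler_pdivrMr ?exprn_gt0// mul1r avg_sum.
apply: (le_trans (y := \sum_(f : F) #|I|%:R * (p.*2%:R * (r * M) ^+ 2) ^+ p)).
  by apply: ler_sum => f _; exact: trace_moment_bound.
rewrite sumr_const -[X in X <= _]mulr_natl mulrA -natrM.
(* The factor 4 in the hypothesis on [B] becomes [4 ^+ p = 2 ^ p.*2], which outweighs
   [#|F| * #|I|]. *)
apply: (le_trans (y := (4 * p.*2%:R * (r * M) ^+ 2) ^+ p)).
  rewrite -mulrA [X in _ <= X]exprMn ler_wpM2r ?exprn_ge0//; first by rewrite mulr_ge0 ?sqr_ge0.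
  rewrite (_ : 4 ^+ p = (2 ^ p.*2)%:R); first by rewrite ler_nat -ep.
  by rewrite -mul2n expnM natrX.
rewrite ep in hB; rewrite -[in X in _ <= X]mul2n exprM; apply: lerXn2r => //.
  by rewrite nnegrE mulr_ge0 ?sqr_ge0// mulr_ge0.
by rewrite nnegrE sqr_ge0.
Qed.

End RademacherRankOne.

(** * Contraction for maxima of Rademacher processes *)

Section FiniteMax.
Variables (R : realFieldType) (S : finType) (s0 : S).
Implicit Types B : {ffun S -> R}.

(** The maximizer is a function of [B] alone, hence invariant under every flip that leaves [B]
    unchanged. *)
Definition amax B : S := [arg max_(s > s0) B s]%O.
Definition mx B : R := B (amax B).

Lemma mx_ge B s : B s <= mx B.
Proof. by rewrite /mx /amax; case: arg_maxP => // i _; apply. Qed.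

Lemma mx_le B c : (forall s, B s <= c) -> mx B <= c.
Proof. exact. Qed.

End FiniteMax.

Section Contraction.
Variables (R : realFieldType) (S I J : finType) (s0 : S).
Variables (psi : I -> S -> R) (phi : I -> J -> S -> R) (tau : R).
Hypothesis contr : forall i s s', exists j,
  psi i s - psi i s' <= tau + `|phi i j s - phi i j s'|.

Local Notation Om := {ffun (I * option J)%type -> bool}.

(** The coordinate [None] of row [i] carries the sign of the scalar process, the coordinates
    [Some j] carry the signs of the vector process; on a common space either kind can be flipped
    alone. *)
Definition sgN (w : Om) i : R := sgb R (w (i, None)).
Definition sgS (w : Om) i s : R := \sum_j sgb R (w (i, Some j)) * phi i j s.

(** Averaging over the scalar sign of row [i] leaves half of [base] plus an increment of [psi]. By
    [contr] one coordinate of [phi] dominates this increment, and a Rademacher sum is on average at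
    least as large in absolute value as any single one of its terms. *)
Lemma contraction_step (i : I) (B : Om -> {ffun S -> R}) :
  (forall w (D : pred (I * option J)), (forall k, D k -> k.1 = i) -> B (flip D w) = B w) ->
  avg (fun w => mx s0 [ffun s => B w s + sgN w i * psi i s]) <=
  tau / 2 + avg (fun w => mx s0 [ffun s => B w s + sgS w i s]).
Proof.
move=> BD.
pose s1 w := amax s0 [ffun s => B w s + psi i s].
pose s2 w := amax s0 [ffun s => B w s - psi i s].
pose DN : pred (I * option J) := pred1 (i, None).
pose DS : pred (I * option J) := fun k => (k.1 == i) && (k.2 != None).
have DNi k : DN k -> k.1 = i by move/eqP->.
have DSi k : DS k -> k.1 = i by case/andP => /eqP.
have s1D w (D : pred (I * option J)) : (forall k, D k -> k.1 = i) -> s1 (flip D w) = s1 w.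
  by move=> Di; rewrite /s1 BD.
have s2D w (D : pred (I * option J)) : (forall k, D k -> k.1 = i) -> s2 (flip D w) = s2 w.
  by move=> Di; rewrite /s2 BD.
pose good w j := psi i (s1 w) - psi i (s2 w) <= tau + `|phi i j (s1 w) - phi i j (s2 w)|.
have exg w : exists j, good w j by exact: contr.
(* [xchoose] depends on the predicate only, and the predicate on [w] only through [s1 w] and [s2 w];
   so [jw] is blind to flips in row [i]. *)
pose jw w := xchoose (exg w).
have jgood w : good w (jw w) by exact: xchooseP.
have jD w (D : pred (I * option J)) : (forall k, D k -> k.1 = i) -> jw (flip D w) = jw w.
  by move=> Di; apply: eq_xchoose => j; rewrite /good s1D ?s2D.
pose L w := mx s0 [ffun s => B w s + sgN w i * psi i s].
pose U w := mx s0 [ffun s => B w s + sgS w i s].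
pose base w := B w (s1 w) + B w (s2 w).
have L2 : 2 * avg L = avg (fun w => base w + (psi i (s1 w) - psi i (s2 w))).
  have LL : avg L = avg (fun w => L (flip DN w)) by rewrite avg_flip.
  rewrite mulr_natl mulr2n {2}LL -avgD; apply: eq_avg => w.
  rewrite /L BD// /sgN sgb_flip [DN _]eqxx.
  have e1 : mx s0 [ffun s => B w s + psi i s] = B w (s1 w) + psi i (s1 w).
    by rewrite /mx ffunE.
  have e2 : mx s0 [ffun s => B w s - psi i s] = B w (s2 w) - psi i (s2 w).
    by rewrite /mx ffunE.
  have E1 : [ffun s => B w s + 1 * psi i s] = [ffun s => B w s + psi i s].
    by apply/ffunP => s; rewrite !ffunE mul1r.
  have E2 : [ffun s => B w s + -1 * psi i s] = [ffun s => B w s - psi i s].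
    by apply/ffunP => s; rewrite !ffunE mulN1r.
  by case: (w (i, None)); rewrite /sgb ?opprK E1 E2 e1 e2 /base; ring.
pose df w := sgS w i (s1 w) - sgS w i (s2 w).
have dfE w : df w = \sum_j sgb R (w (i, Some j)) * (phi i j (s1 w) - phi i j (s2 w)).
  by rewrite /df /sgS -sumrB; apply: eq_bigr => j _; rewrite mulrBr.
have U2 : avg (fun w => base w + `|df w|) <= 2 * avg U.
  have UU : avg U = avg (fun w => U (flip DS w)) by rewrite avg_flip.
  rewrite mulr_natl mulr2n {2}UU -avgD; apply: le_avg => w.
  have Sf s : sgS (flip DS w) i s = - sgS w i s.
    rewrite /sgS -sumrN; apply: eq_bigr => j _.
    by rewrite sgb_flip /DS /= eqxx mulNr.
  have h1 s : B w s + sgS w i s <= U w.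
    by have := mx_ge s0 [ffun s => B w s + sgS w i s] s; rewrite ffunE.
  have h2 s : B w s - sgS w i s <= U (flip DS w).
    rewrite -Sf -{1}(BD w DS)//.
    by have := mx_ge s0 [ffun s => B (flip DS w) s + sgS (flip DS w) i s] s; rewrite ffunE.
  have := h1 (s1 w); have := h2 (s1 w); have := h1 (s2 w); have := h2 (s2 w).
  by rewrite /base /df; case: ler0P; lra.
(* Flipping every sign of row [i] but the [jw w]-th isolates that term: this replaces
   Jensen's inequality. *)
pose DJ w : pred (I * option J) :=
  fun k => (k.1 == i) && (k.2 != None) && (k.2 != Some (jw w)).
have DJi w k : DJ w k -> k.1 = i by rewrite /DJ; case/andP => /andP[/eqP].
have J2 : avg (fun w => `|phi i (jw w) (s1 w) - phi i (jw w) (s2 w)|) <= avg (fun w => `|df w|).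
  rewrite -(ler_pM2l (x := 2))// -avgZ.
  have DD : avg (fun w => `|df w|) = avg (fun w => `|df (flip (DJ w) w)|).
    by rewrite (@avg_flip R _ DJ (fun w => `|df w|)) // => w k; rewrite /DJ jD//; exact: DJi.
  rewrite [X in _ <= X](_ : _ = avg (fun w => `|df w|) + avg (fun w => `|df w|)); last by ring.
  rewrite {2}DD -avgD; apply: le_avg => w.
  have -> : 2 * `|phi i (jw w) (s1 w) - phi i (jw w) (s2 w)| = `|df w + df (flip (DJ w) w)|.
    rewrite !dfE s1D ?s2D; try exact: DJi.
    rewrite -big_split /= (bigD1 (jw w))//= big1 ?addr0 => [|j jn].
      rewrite sgb_flip (_ : DJ w _ = false); last by rewrite /DJ /= !eqxx.
      rewrite -mulrDl normrM; congr (_ * _).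
      by rewrite /sgb; case: (w _); rewrite -?opprD ?normrN -mulr2n normr_nat.
    rewrite sgb_flip (_ : DJ w _ = true); last by rewrite /DJ /= eqxx (inj_eq Some_inj).
    ring.
  exact: ler_normD.
have : avg (fun w => base w + (psi i (s1 w) - psi i (s2 w))) <=
   avg (fun w => tau + (base w + `|phi i (jw w) (s1 w) - phi i (jw w) (s2 w)|)).
  by apply: le_avg => w; have := jgood w; rewrite /good; lra.
rewrite -L2 avgD avg_cst ?card_signs// [avg (fun w => base w + _)]avgD.
by move: U2; rewrite avgD; lra.
Qed.

Lemma vector_contraction :
  avg (fun w : Om => mx s0 [ffun s => \sum_i sgN w i * psi i s]) <=
  #|I|%:R * (tau / 2) + avg (fun w : Om => mx s0 [ffun s => \sum_i sgS w i s]).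
Proof.
(* [r1] holds the rows already converted to coordinate signs, [r2] those that still carry a scalar
   sign. *)
have gen (r2 : seq I) : forall r1, uniq (r2 ++ r1) ->
  avg (fun w : Om => mx s0 [ffun s => \sum_(i <- r1) sgS w i s + \sum_(i <- r2) sgN w i * psi i s])
  <= (size r2)%:R * (tau / 2) +
  avg (fun w : Om => mx s0 [ffun s => \sum_(i <- r1) sgS w i s + \sum_(i <- r2) sgS w i s]).
  elim: r2 => [|i r2 IH] r1 /= ur.
    rewrite mul0r add0r; apply: le_avg => w.
    rewrite (_ : [ffun s => _ + \sum_(i <- [::]) sgN w i * _] =
      [ffun s => \sum_(i <- r1) sgS w i s + \sum_(i <- [::]) sgS w i s])//.
    by apply/ffunP => s; rewrite !ffunE !big_nil.
  have ur' : uniq (r2 ++ i :: r1).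
    by rewrite (uniq_catCA r2 [:: i] r1).
  have [ir1 ir2] : i \notin r1 /\ i \notin r2.
    by move: ur; rewrite mem_cat negb_or => /andP[/andP[]].
  pose B (w : Om) := [ffun s => \sum_(i <- r1) sgS w i s + \sum_(i <- r2) sgN w i * psi i s].
  have BD w (D : pred (I * option J)) : (forall k, D k -> k.1 = i) -> B (flip D w) = B w.
    move=> Di; apply/ffunP => s; rewrite !ffunE.
    have nD k : k.1 != i -> D k = false.
      by move=> ki; apply/negbTE/negP => /Di ek; rewrite ek eqxx in ki.
    congr (_ + _); apply: eq_big_seq => k kr.
      have ki : k != i by apply: contraNneq ir1 => <-.
      by apply: eq_bigr => j _; rewrite sgb_flip nD.
    have ki : k != i by apply: contraNneq ir2 => <-.
    by rewrite /sgN sgb_flip nD.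
  have E1 : avg (fun w : Om => mx s0
      [ffun s => \sum_(i <- r1) sgS w i s + \sum_(i <- (i :: r2)) sgN w i * psi i s])
   = avg (fun w : Om => mx s0 [ffun s => B w s + sgN w i * psi i s]).
    apply: eq_avg => w; congr (mx s0 _); apply/ffunP => s.
    by rewrite !ffunE big_cons; ring.
  rewrite E1; apply: le_trans (contraction_step BD) _.
  have := IH _ ur'.
  have E2 : avg (fun w : Om => mx s0
      [ffun s => \sum_(i <- i :: r1) sgS w i s + \sum_(i <- r2) sgN w i * psi i s])
   = avg (fun w : Om => mx s0 [ffun s => B w s + sgS w i s]).
    apply: eq_avg => w; congr (mx s0 _); apply/ffunP => s.
    by rewrite !ffunE big_cons; ring.
  have E3 : avg (fun w : Om => mx s0 [ffun s => \sum_(i <- i :: r1) sgS w i s + \sum_(i <- r2) sgS w i s])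
   = avg (fun w : Om => mx s0 [ffun s => \sum_(i <- r1) sgS w i s + \sum_(i <- i :: r2) sgS w i s]).
    apply: eq_avg => w; congr (mx s0 _); apply/ffunP => s.
    by rewrite !ffunE !big_cons; ring.
  rewrite E2 E3 -[(size (i :: r2))%:R]natr1; lra.
have := gen (enum I) [::]; rewrite cats0 enum_uniq -cardE => /(_ isT).
have F (f : Om -> I -> S -> R) (g : Om -> I -> S -> R) :
  avg (fun w : Om => mx s0 [ffun s => \sum_(i <- [::]) f w i s + \sum_(i <- enum I) g w i s])
  = avg (fun w : Om => mx s0 [ffun s => \sum_i g w i s]).
  apply: eq_avg => w; congr (mx s0 _); apply/ffunP => s.
  by rewrite !ffunE big_nil add0r big_enum.
by rewrite (F sgS (fun w i s => sgN w i * psi i s)) (F sgS sgS).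
Qed.

End Contraction.

(** * Nets of step functions *)

Section Steps.
Variables (R : realFieldType) (m : nat) (dlt : R).
Hypothesis dlt_gt0 : 0 < dlt.
Implicit Types (b : R) (s : {ffun 'I_m -> bool}).

Definition step (j : nat) b : R := (j%:R * dlt < b)%R%:R.

(** A step function with jumps [dlt] or [- dlt] at the grid points, so it is 1-Lipschitz only up to
    an additive [dlt]. Since the signs are free, a suitable [s] turns a combination of steps into a
    sum of absolute values. *)
Definition fgrid s b : R := dlt * \sum_(j < m) sgb R (s j) * step j b.

Lemma step_mono j b b' : b <= b' -> step j b <= step j b'.
Proof.
rewrite /step ler_nat => bb; case: ltP => // jb.
by rewrite (lt_le_trans jb bb).
Qed.

Lemma stepT (j : nat) b : j%:R * dlt < b -> step j b = 1.
Proof. by rewrite /step => ->. Qed.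

Lemma stepF (j : nat) b : b <= j%:R * dlt -> step j b = 0.
Proof. by rewrite /step ltNge => ->. Qed.

Lemma sum_step_diff k b b' : b <= b' ->
  dlt * \sum_(j < k) (step j b' - step j b) <= b' - b + dlt.
Proof.
have d0 := dlt_gt0.
move=> bb.
(* Either nothing is counted yet, or the counted grid points lie between [b] and [i * dlt], and
   there are at most [i - b / dlt] of them. The extra [dlt] in the statement pays for the last grid
   point below [b']. *)
have P i : dlt * \sum_(j < i) (step j b' - step j b) <= 0 \/
           dlt * \sum_(j < i) (step j b' - step j b) <= i%:R * dlt - b.
  elim: i => [|i]; first by left; rewrite big_ord0 mulr0.
  rewrite big_ord_recr /= mulrDr -natr1.
  set A := \sum_(j < i) _ => IH.
  have [ib|bi] := ltP (i%:R * dlt) b.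
    rewrite stepT ?(lt_le_trans ib bb)// stepT// subrr mulr0 addr0.
    by case: IH => IH; [left|right; lra].
  rewrite (stepF bi); have [ib'|b'i] := ltP (i%:R * dlt) b'.
    by right; rewrite stepT// subr0 mulr1; case: IH => IH; lra.
  by rewrite stepF// subrr mulr0 addr0; case: IH => IH; [left|right; lra].
elim: k => [|k IH]; first by rewrite big_ord0 mulr0; lra.
have [kb|bk] := ltP (k%:R * dlt) b'; last first.
  by rewrite big_ord_recr /= (stepF bk) stepF ?subrr ?addr0// (le_trans bb).
by have := P k.+1; rewrite -natr1 => -[]; lra.
Qed.

Lemma sum_step_ge k b : b <= k%:R * dlt -> b <= dlt * \sum_(j < k) step j b.
Proof.
have d0 := dlt_gt0.
move=> bk; suff : b <= dlt * \sum_(j < k) step j b \/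
                 k%:R * dlt <= dlt * \sum_(j < k) step j b.
  by case=> // /(le_trans bk).
elim: k {bk} => [|k]; first by right; rewrite big_ord0 mulr0 mul0r.
rewrite big_ord_recr /= mulrDr -natr1; set A := \sum_(j < k) _ => IH.
have [kb|bk] := ltP (k%:R * dlt) b.
  by rewrite stepT// mulr1; case: IH => IH; [left|right]; lra.
by left; rewrite stepF// mulr0; case: IH => IH; lra.
Qed.

Lemma step0 j b : b <= 0 -> step j b = 0.
Proof.
move=> b0; rewrite /step ltNge (le_trans b0)// mulr_ge0 ?ler0n//; exact: ltW.
Qed.

(** Discrete layer cake formula: a number between 0 and [m * dlt] is recovered from its steps up to
    one mesh. *)
Lemma dist_le_steps b b' : b <= m%:R * dlt -> b' <= m%:R * dlt -> 0 <= b -> 0 <= b' ->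
  `|b - b'| <= dlt + dlt * \sum_(j < m) `|step j b - step j b'|.
Proof.
have d0 := dlt_gt0.
wlog bb : b b' / b' <= b.
  move=> H h1 h2 h3 h4; have [bb|/ltW bb] := leP b' b; first exact: H.
  rewrite distrC; have := H _ _ bb h2 h1 h4 h3.
  by under eq_bigr do rewrite distrC.
move=> bm bm' b0 b0'; rewrite ger0_norm ?subr_ge0//.
rewrite (eq_bigr (fun j : 'I_m => step j b - step j b')); last first.
  by move=> j _; rewrite ger0_norm// subr_ge0 step_mono.
rewrite sumrB mulrBr.
have := sum_step_ge bm.
have := @sum_step_diff m 0 b' b0'.
rewrite (eq_bigr (fun j : 'I_m => step j b')); first lra.
by move=> j _; rewrite [step _ 0]step0 ?subr0.
Qed.

Lemma fgrid_lip s b b' : `|fgrid s b - fgrid s b'| <= `|b - b'| + dlt.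
Proof.
have d0 := dlt_gt0.
wlog bb : b b' / b' <= b.
  move=> H; have [bb|/ltW bb] := leP b' b; first exact: H.
  by rewrite distrC [`|b - b'|]distrC; exact: H.
rewrite [`|b - b'|]ger0_norm ?subr_ge0//.
apply: le_trans (sum_step_diff m bb); rewrite /fgrid -mulrBr normrM gtr0_norm//.
rewrite ler_pM2l// -sumrB; apply: le_trans (ler_norm_sum _ _ _) _.
apply: ler_sum => j _; rewrite -mulrBr normrM.
rewrite [`|step _ _ - _|]ger0_norm ?subr_ge0 ?step_mono//.
by rewrite /sgb; case: (s j); rewrite ?normrN1 ?normr1 mul1r.
Qed.

Lemma fgrid0 s b : b <= 0 -> fgrid s b = 0.
Proof.
by move=> b0; rewrite /fgrid big1 ?mulr0// => j _; rewrite step0// mulr0.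
Qed.

Lemma fgrid_le s b : 0 <= b -> `|fgrid s b| <= b + dlt.
Proof. by move=> b0; have := fgrid_lip s b 0; rewrite (@fgrid0 s 0)// !subr0 (ger0_norm b0). Qed.

(** The all-plus pattern rounds up to the grid; through it the process contains the quadratic form
    itself, up to [dlt]. *)
Lemma fgrid_plus b : b <= m%:R * dlt -> b <= fgrid [ffun=> true] b.
Proof.
move=> bm; have := sum_step_ge bm; rewrite /fgrid => /le_trans; apply.
by rewrite ler_pM2l//; apply: ler_sum => j _; rewrite ffunE mul1r.
Qed.

Lemma fgrid_minus b : fgrid [ffun=> false] b = - fgrid [ffun=> true] b.
Proof.
rewrite /fgrid -mulrN -sumrN; congr (_ * _); apply: eq_bigr => j _.
by rewrite !ffunE /sgb mulN1r mul1r.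
Qed.

End Steps.

Section Net.
Variables (R : archiRealFieldType) (m : nat) (dlt : R).
Variables (rho : R) (q L n : nat).
Hypothesis dlt_gt0 : 0 < dlt.
Hypothesis rho_gt0 : 0 < rho.
Hypothesis q_gt0 : (0 < q)%N.
Hypothesis n_gt0 : (0 < n)%N.
Hypothesis nL : (n <= 2 ^ L)%N.
Hypothesis dlt_small : dlt * (2 ^ L * q)%:R <= rho.
Implicit Types (b : R) (s : {ffun 'I_m -> bool}).

Let mesh (l : nat) : R := rho / (2 ^ l * q)%:R.

Lemma mesh_gt0 l : 0 < mesh l.
Proof. by rewrite divr_gt0// ltr0n muln_gt0 expn_gt0. Qed.

Lemma mesh_q l : q%:R * mesh l = rho / (2 ^ l)%:R.
Proof.
rewrite /mesh natrM; field.
by rewrite !pnatr_eq0 -!lt0n q_gt0 expn_gt0.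
Qed.

Lemma dlt_mesh l : (l < L)%N -> dlt <= mesh l.
Proof.
move=> lL; rewrite ler_pdivlMr ?ltr0n ?muln_gt0 ?expn_gt0//.
apply: le_trans dlt_small; rewrite ler_pM2l// ler_nat leq_mul2r.
by rewrite leq_exp2l// (ltnW lL) orbT.
Qed.

Let node (l k : nat) : R := k%:R * mesh l.

(** By [fgrid_le] the values at the nodes with [k <= q] lie within [q * mesh l + dlt] of 0. The
    shift makes the quotient nonnegative, and [dlt <= mesh l] bounds it by [2 * q + 2]. *)
Let height s (l k : nat) : R := (fgrid dlt s (node l k) + q%:R * mesh l + dlt) / mesh l.

(* The code records the values of [fgrid s], up to the mesh, at [q + 1] nodes in each of the
   dyadic shells of scale [rho / 2 ^ l]: the error is then proportional to the argument. *)
Definition code s : {ffun 'I_L * 'I_q.+1 -> 'I_(2 * q + 2).+1} :=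
  [ffun x : 'I_L * 'I_q.+1 => inord (Num.truncn (height s x.1 x.2))].

Lemma code_eq s s' (x : 'I_L * 'I_q.+1) : code s = code s' ->
  `|fgrid dlt s (node x.1 x.2) - fgrid dlt s' (node x.1 x.2)| <= mesh x.1.
Proof.
have mp := mesh_gt0 x.1; have d0 := dlt_gt0.
have hb s1 : 0 <= height s1 x.1 x.2 <= (2 * q + 2)%:R.
  have n0 : 0 <= node x.1 x.2 by rewrite mulr_ge0// ltW.
  have nq : node x.1 x.2 <= q%:R * mesh x.1.
    by rewrite ler_wpM2r ?(ltW mp)// ler_nat -ltnS.
  have := fgrid_le dlt_gt0 s1 n0; rewrite ler_norml => /andP[f1 f2].
  rewrite divr_ge0 ?(ltW mp)//=; last lra.
  rewrite ler_pdivrMr// natrD natrM mulrDl.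
  have := dlt_mesh (ltn_ord x.1); lra.
move=> /ffunP /(_ x); rewrite !ffunE => /(congr1 val) /=.
have tr s1 : (Num.truncn (height s1 x.1 x.2) < (2 * q + 2).+1)%N.
  have /andP[h0 h1] := hb s1; rewrite ltnS -(ler_nat R).
  by apply: le_trans h1; rewrite truncn_le.
rewrite !inordK//; move=> et.
have /andP[h0 h1] := truncn_itv (andP (hb s)).1.
have /andP[h0' h1'] := truncn_itv (andP (hb s')).1.
rewrite -et in h0' h1'; rewrite -!natr1 in h1 h1'.
have : `|height s x.1 x.2 - height s' x.1 x.2| <= 1.
  by rewrite ler_norml; apply/andP; split; lra.
rewrite /height -mulrBl normrM normfV (gtr0_norm mp) ler_pdivrMr// mul1r.
by congr (`|_| <= _); ring.
Qed.

Lemma dyadic_shell b : 0 < b <= rho -> rho / (2 ^ L)%:R < b ->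
  exists2 l : 'I_L, b <= rho / (2 ^ l)%:R & rho / (2 ^ l.+1)%:R < b.
Proof.
move=> /andP[b0 br] bL.
have ex : exists l, rho / (2 ^ l)%:R < b by exists L.
have := ex_minnP ex; case=> -[|l] hl lmin.
  by move: hl; rewrite expn0 divr1 ltNge br.
have lL : (l < L)%N by apply: lmin.
exists (Ordinal lL) => //=; rewrite leNgt; apply/negP => /lmin; by rewrite ltnn.
Qed.

(** In the shell of [b] the error is three meshes, two for moving to the node below [b] and one for
    the code, and a mesh is at most [2 * b / q]. Below the last shell [b <= rho / n], and both
    values are small. *)
Lemma code_close s s' b : code s = code s' -> 0 <= b <= rho ->
  `|fgrid dlt s b - fgrid dlt s' b| <= 6 * b / q%:R + 2 * rho / n%:R + 2 * dlt.
Proof.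
move=> ec /andP[b0 br]; have d0 := dlt_gt0; have r0 := rho_gt0.
have rn : 0 <= rho / n%:R by rewrite divr_ge0// ltW.
have bq : 0 <= b / q%:R by rewrite divr_ge0.
have [bs|bb] := leP b (rho / (2 ^ L)%:R).
  have bn : b <= rho / n%:R.
    apply: le_trans bs _; rewrite ler_pM2l// lef_pV2 ?posrE ?ltr0n ?expn_gt0//.
    by rewrite ler_nat.
  have := fgrid_le dlt_gt0 s b0; have := fgrid_le dlt_gt0 s' b0.
  have := ler_normB (fgrid dlt s b) (fgrid dlt s' b).
  by rewrite -!mulrA; lra.
have b_gt0 : 0 < b by apply: le_lt_trans bb; rewrite divr_ge0// ltW.
have /dyadic_shell : 0 < b <= rho by rewrite b_gt0.
case=> // l bl lb.
have mp := mesh_gt0 l.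
have bm0 : 0 <= b / mesh l by rewrite divr_ge0// ltW.
have /andP[k0 k1] := truncn_itv bm0; set k := Num.truncn _ in k0 k1.
have kq : (k < q.+1)%N.
  rewrite ltnS -(ler_nat R); apply: le_trans k0 _.
  by rewrite ler_pdivrMr// mesh_q.
have := code_eq (l, Ordinal kq) ec; rewrite /=.
have t1 : node l k <= b by rewrite /node -ler_pdivlMr.
have t2 : b <= node l k + mesh l.
  by rewrite /node -[X in _ + X]mul1r -mulrDl natr1 -ler_pdivrMr// ltW.
have mb : mesh l <= 2 * b / q%:R.
  rewrite ler_pdivlMr ?ltr0n// mulrC mesh_q.
  move: lb; rewrite expnS natrM invfM mulrCA.
  set z := rho / _; lra.
have := fgrid_lip dlt_gt0 s b (node l k); have := fgrid_lip dlt_gt0 s' b (node l k).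
rewrite [`|b - node l k|]ger0_norm ?subr_ge0//.
move: (fgrid dlt s b) (fgrid dlt s' b) (fgrid dlt s (node l k)) (fgrid dlt s' (node l k)).
move=> f f' g g' h1 h2 h3.
have -> : f - f' = (f - g) + (g - g') - (f' - g') by ring.
have := ler_normB ((f - g) + (g - g')) (f' - g'); have := ler_normD (f - g) (g - g').
by rewrite -!mulrA in mb *; lra.
Qed.

Definition net s : {ffun 'I_m -> bool} :=
  odflt s [pick s' | code s' == code s].

Lemma code_net s : code (net s) = code s.
Proof. by rewrite /net; case: pickP => //= s' /eqP. Qed.

Lemma net_code s s' : code s = code s' -> net s = net s'.
Proof.
rewrite /net => ->; case: pickP => //= /(_ s'); by rewrite eqxx.
Qed.

Lemma card_net : (#|{: {s | s \in codom net}}| <= (2 * q + 3) ^ (L * q.+1))%N.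
Proof.
pose c (x : {s | s \in codom net}) := code (val x).
have ci : injective c.
  move=> [x hx] [y hy] /= e; apply: val_inj => /=.
  have /codomP[s es] := hx; have /codomP[s' es'] := hy.
  move: e; rewrite /c /= es es' !code_net; exact: net_code.
by have := leq_card c ci; rewrite card_ffun card_prod !card_ord -addnS.
Qed.

End Net.

(** * Multiscale comparison for a fixed sample *)

Section FixedSample.
Variables (R : archiRcfType) (d : nat) (I V : finType) (v0 : V).
Variables (y : I -> 'cV[R]_d) (vv : V -> 'cV[R]_d).
Variables (m : nat) (dlt r M sL : R) (a K : nat).
Local Notation L := (2 ^ a)%N.
Local Notation n := #|I|.
Hypothesis dlt_gt0 : 0 < dlt.
Hypothesis r_gt0 : 0 < r.
Hypothesis M_gt0 : 0 < M.
Hypothesis sL_ge0 : 0 <= sL.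
Hypothesis sLE : sL ^+ 2 = L%:R.
Hypothesis n_gt0 : (0 < n)%N.
Hypothesis nL : (n <= 2 ^ L)%N.
Hypothesis nK : (n <= 16 ^ K)%N.
Hypothesis dlt_small : dlt * (2 ^ L * 16 ^ K)%:R <= r ^+ 2.
Hypothesis y_r : forall i, dot (y i) (y i) <= r ^+ 2.
Hypothesis r_M : r ^+ 2 <= M ^+ 2.
Hypothesis y_M : forall v, \sum_i dot (y i) v ^+ 2 <= M ^+ 2 * dot v v.
Hypothesis vv1 : forall v, dot (vv v) (vv v) = 1.

Local Notation Sf := {ffun 'I_m -> bool}.
Local Notation f := (@fgrid R m dlt).
Let rho := r ^+ 2.
Let b i v : R := dot (y i) (vv v) ^+ 2.
(** Agreement at level [k - 1] leaves an error [6 * b / 16 ^ k.-1 = 96 * b / 16 ^ k]; the weight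
    exceeds twice that. *)
Let lam (k : nat) : R := 384 / (16 ^ k)%:R.
Let nt (k : nat) : Sf -> Sf := @net R m dlt rho (16 ^ k) L.

Definition psiS i (s : V * Sf) : R := f s.2 (b i s.1).
Local Notation J := (unit + 'I_K.+1 * Sf)%type.
(** There is one coordinate per net point: patterns with distinct net points at level [k] differ
    there by a full weight, yet each index activates a single coordinate per level. *)
Definition phiS i (j : J) (s : V * Sf) : R :=
  match j with
  | inl _ => 2 * b i s.1
  | inr (k, t) => lam k * b i s.1 * (nt k s.2 == t)%:R
  end.

Local Notation Om := {ffun (I * option J)%type -> bool}.

Lemma lam_ge0 k : 0 <= lam k.
Proof. by rewrite divr_ge0 ?ler0n. Qed.

Lemma rho_gt0 : 0 < rho. Proof. by rewrite exprn_gt0. Qed.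

Lemma b_bound i v : 0 <= b i v <= rho.
Proof.
by rewrite sqr_ge0 /=; apply: le_trans (dot_CS _ _) _; rewrite vv1 mulr1.
Qed.

Lemma dlt_level k : (k <= K)%N -> dlt * (2 ^ L * 16 ^ k)%:R <= rho.
Proof.
move=> kK; apply: le_trans dlt_small; rewrite ler_pM2l// ler_nat leq_mul2l.
by rewrite leq_exp2l// kK orbT.
Qed.

Lemma dlt_le_rho_n : dlt <= rho / n%:R.
Proof.
rewrite ler_pdivlMr ?ltr0n//; apply: le_trans dlt_small; rewrite ler_pM2l// ler_nat.
by apply: leq_trans nL _; rewrite leq_pmulr// expn_gt0.
Qed.

Lemma level_close k s s' bb : (k <= K)%N -> nt k s = nt k s' -> 0 <= bb <= rho ->
  `|f s bb - f s' bb| <= 6 * bb / (16 ^ k)%:R + 2 * rho / n%:R + 2 * dlt.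
Proof.
move=> kK e; have q0 : (0 < 16 ^ k)%N by rewrite expn_gt0.
apply: (code_close dlt_gt0 rho_gt0 q0 n_gt0 nL (dlt_level kK)).
by rewrite -code_net -/(nt k s) e code_net.
Qed.

Lemma phiS_diff i k (kK : (k < K.+1)%N) s s' : nt k s.2 != nt k s'.2 ->
  lam k * b i s'.1 = `|phiS i (inr (Ordinal kK, nt k s'.2)) s - phiS i (inr (Ordinal kK, nt k s'.2)) s'|.
Proof.
move=> ne; rewrite /phiS /= (negbTE ne) eqxx mulr0 mulr1 sub0r normrN ger0_norm//.
by apply: mulr_ge0 (lam_ge0 k) _; have /andP[] := b_bound i s'.1.
Qed.

(* Decisive is the first level [k] whose nets separate the two patterns: agreement at level
   [k - 1] bounds the increment by a multiple of [b / 16 ^ k.-1], which the coordinate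
   [(k, nt k s')] of [phiS] detects. *)
Lemma psiS_contr i s s' : exists j,
  psiS i s - psiS i s' <= (8 * rho / n%:R + 3 * dlt) + `|phiS i j s - phiS i j s'|.
Proof.
have d0 := dlt_gt0; have rn : 0 <= rho / n%:R by rewrite divr_ge0// ltW ?rho_gt0.
have /andP[b0 br] := b_bound i s'.1.
have h0 : psiS i s - psiS i s' <= `|b i s.1 - b i s'.1| + dlt + `|f s.2 (b i s'.1) - f s'.2 (b i s'.1)|.
  have := fgrid_lip dlt_gt0 s.2 (b i s.1) (b i s'.1).
  have := ler_norm (f s.2 (b i s.1) - f s.2 (b i s'.1)).
  have := ler_norm (f s.2 (b i s'.1) - f s'.2 (b i s'.1)).
  by rewrite /psiS; lra.
have pN : `|phiS i (inl tt) s - phiS i (inl tt) s'| = 2 * `|b i s.1 - b i s'.1|.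
  by rewrite /phiS -mulrBr normrM gtr0_norm.
have nb := normr_ge0 (b i s.1 - b i s'.1).
(* [a2] is the part of the increment due to the pattern. If the change of [b] is larger, twice that
   change covers both and [inl] suffices; otherwise [2 * a2] covers both. *)
suff [a2 [h1 h2]] : exists a2, `|f s.2 (b i s'.1) - f s'.2 (b i s'.1)| <= a2 + (8 * rho / n%:R + 2 * dlt)
   /\ (a2 = 0 \/ exists j, 2 * a2 <= `|phiS i j s - phiS i j s'|).
  have [ab|ba] := leP a2 `|b i s.1 - b i s'.1|.
    by exists (inl tt); rewrite pN; lra.
  case: h2 => [a20|[j hj]]; first by exists (inl tt); rewrite pN; lra.
  by exists j; lra.
have [/existsP [k0 hk0]|] := boolP [exists k : 'I_K.+1, nt k s.2 != nt k s'.2]; last first.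
  rewrite negb_exists => /forallP /(_ ord_max) /=; rewrite negbK => /eqP e.
  (* The patterns agree at the last level, where [nK] bounds the error [6 * b / 16 ^ K] by
     [6 * rho / n], a part of the additive term. *)
  exists 0; split; last by left.
  apply: le_trans (level_close (leqnn K) e (b_bound _ _)) _.
  have : b i s'.1 / (16 ^ K)%:R <= rho / n%:R.
    by rewrite ler_pM ?invr_ge0 ?ler0n// lef_pV2 ?posrE ?ltr0n ?expn_gt0// ler_nat.
  by rewrite -(mulrA 6) -(mulrA 2) -(mulrA 8); lra.
have ex : exists k, (k < K.+1)%N && (nt k s.2 != nt k s'.2).
  by exists k0; rewrite ltn_ord.
have := ex_minnP ex; case=> -[|k] /andP[kK ne] kmin.
  exists (2 * b i s'.1); split.
    have := fgrid_le dlt_gt0 s.2 b0; have := fgrid_le dlt_gt0 s'.2 b0.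
    have := ler_normB (f s.2 (b i s'.1)) (f s'.2 (b i s'.1)).
    by rewrite -(mulrA 8); lra.
  right; exists (inr (Ordinal kK, nt 0 s'.2)).
  by rewrite -phiS_diff// /lam expn0 divr1; lra.
have e : nt k s.2 = nt k s'.2.
  apply/eqP; rewrite -[_ == _]negbK; apply/negP => nk.
  by have := kmin k; rewrite nk ltnW// ltnn => /(_ isT).
exists (6 * (b i s'.1 / (16 ^ k)%:R)); split.
  apply: le_trans (level_close _ e (b_bound _ _)) _; first exact: ltnW.
  by rewrite -(mulrA 6) -(mulrA 2) -(mulrA 8); lra.
right; exists (inr (Ordinal kK, nt k.+1 s'.2)).
rewrite -phiS_diff// /lam expnS natrM invfM.
have : 0 <= b i s'.1 / (16 ^ k)%:R by rewrite divr_ge0.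
rewrite [X in _ -> _ <= X](_ : _ = 24 * (b i s'.1 / (16 ^ k)%:R)); first lra.
have k0' : (16 ^ k)%:R != 0 :> R by rewrite pnatr_eq0 -lt0n expn_gt0.
by field.
Qed.

Let s0 : Sf := [ffun=> true].
Let Q0 (w : Om) := mx v0 [ffun v => \sum_i sgb R (w (i, Some (inl tt))) * b i v].
Let Q (k : 'I_K.+1) (w : Om) := mx (v0, s0)
  [ffun s => \sum_i sgb R (w (i, Some (inr (k, nt k s.2)))) * b i s.1].

(** At level [k] only the coordinate of the net point [nt k s.2] is active, so each level is a
    single Rademacher sum whose sign system that net point selects. *)
Lemma sgS_split w : mx (v0, s0) [ffun s => \sum_i sgS phiS w i s] <=
  2 * Q0 w + \sum_(k < K.+1) lam k * Q k w.
Proof.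
apply: mx_le => s; rewrite ffunE.
have -> : \sum_i sgS phiS w i s =
  2 * (\sum_i sgb R (w (i, Some (inl tt))) * b i s.1) +
  \sum_(k < K.+1) lam k * \sum_i sgb R (w (i, Some (inr (k, nt k s.2)))) * b i s.1.
  rewrite mulr_sumr (eq_bigr (fun k : 'I_K.+1 =>
    \sum_i lam k * (sgb R (w (i, Some (inr (k, nt k s.2)))) * b i s.1))); last first.
    by move=> k _; rewrite mulr_sumr.
  rewrite [X in _ = _ + X]exchange_big /= -big_split; apply: eq_bigr => i _ /=.
  rewrite /sgS big_sumType /= (big_pred1 tt); last by case.
  congr (_ + _); first by rewrite mulrCA.
  rewrite (eq_bigr (fun p : 'I_K.+1 * Sf =>
    sgb R (w (i, Some (inr (p.1, p.2)))) * (lam p.1 * b i s.1 * (nt p.1 s.2 == p.2)%:R))); last by case.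
  rewrite -(pair_bigA _ (fun (k : 'I_K.+1) (t : Sf) =>
    sgb R (w (i, Some (inr (k, t)))) * (lam k * b i s.1 * (nt k s.2 == t)%:R))) /=.
  apply: eq_bigr => k _; rewrite (bigD1 (nt k s.2))//= eqxx mulr1 big1 ?addr0 => [|t tn].
    by rewrite mulrCA.
  by rewrite eq_sym (negbTE tn) !mulr0.
apply: lerD.
  rewrite ler_pM2l//; have := mx_ge v0 [ffun v => \sum_i sgb R (w (i, Some (inl tt))) * b i v] s.1.
  by rewrite ffunE.
apply: ler_sum => k _; apply: (ler_wpM2l (lam_ge0 k)).
have := mx_ge (v0, s0) [ffun s => \sum_i sgb R (w (i, Some (inr (k, nt k s.2)))) * b i s.1] s.
by rewrite ffunE.
Qed.

(** At moment order [2 ^ (6 * k + a + 3) = 8 * 64 ^ k * L], [rademacher_max_bound] asks for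
    [B k ^+ 2] to be at least [32 * 64 ^ k * L * (r * M) ^+ 2]; the constant 6 gives 36. *)
Let B (k : nat) := (8 ^ k)%:R * (6 * sL * r * M).

Lemma B_gt0 k : 0 < B k.
Proof.
have sL0 : 0 < sL.
  rewrite lt_neqAle sL_ge0 andbT eq_sym; apply/eqP => s00.
  by have := sLE; rewrite s00 expr0n /= => /esym/eqP; rewrite pnatr_eq0 expn_eq0.
by rewrite mulr_gt0 ?ltr0n ?expn_gt0// !mulr_gt0.
Qed.

Lemma B_sqr k : 4 * (2 ^ (6 * k + a + 3))%:R * (r * M) ^+ 2 <= B k ^+ 2.
Proof.
have -> : (2 ^ (6 * k + a + 3))%:R = 8 * (8 ^ k)%:R ^+ 2 * sL ^+ 2 :> R.
  have -> : (2 ^ (6 * k + a + 3) = 8 * (8 ^ k) ^ 2 * 2 ^ a)%N.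
    rewrite (expnD 2 (6 * k + a)) (expnD 2 (6 * k)) (expnM 2 6)
      -[(2 ^ 6)%N]/(8 ^ 2)%N -expnM -expnM [(k * 2)%N]mulnC.
    by rewrite -[(2 ^ 3)%N]/8%N mulnC mulnA.
  by rewrite sLE !natrM natrX.
rewrite /B; set q := (8 ^ k)%:R.
have : 0 <= (q * sL * r * M) ^+ 2 by exact: sqr_ge0.
rewrite !exprMn; nra.
Qed.

(** The logarithm of the net size is of order [k * 16 ^ k * L]. Splitting [64 ^ k] as
    [4 ^ k * 16 ^ k] leaves [4 ^ k] to absorb the factor linear in [k]. *)
Lemma card_level (k : 'I_K.+1) :
  (#|{: {s | s \in codom (nt k)}}| * n <= 2 ^ (2 ^ (6 * k + a + 3)))%N.
Proof.
have q0 : (0 < 16 ^ k)%N by rewrite expn_gt0.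
have kK : (k <= K)%N by rewrite -ltnS.
have := card_net m dlt rho (16 ^ k) L.
move=> /leq_mul /(_ nL) /leq_trans; apply.
have q2 : (2 * 16 ^ k + 3 <= 2 ^ (4 * k + 3))%N.
  by rewrite (expnD 2 (4 * k)) (expnM 2 4) -[(2 ^ 4)%N]/16%N; lia.
apply: (leq_trans (n := 2 ^ ((4 * k + 3) * (L * (16 ^ k).+1)) * 2 ^ L)).
  by rewrite leq_mul2r; apply/orP; right; rewrite (expnM 2 (4 * k + 3)) leq_exp2r// muln_gt0 expn_gt0.
rewrite -expnD leq_exp2l// (expnD 2 (6 * k + a)) (expnD 2 (6 * k))
  [(2 ^ (6 * k))%N](_ : _ = 4 ^ k * 16 ^ k)%N; last first.
  by rewrite -expnMn -[(4 * 16)%N]/(2 ^ 6)%N expnM.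
have k4 : (k < 4 ^ k)%N by exact: ltn_expl.
move: (16 ^ k)%N (4 ^ k)%N q0 k4 => q p q0 k4.
have lq : (L <= q * L)%N by rewrite leq_pmull.
have lq2 : (L * q.+1 <= 2 * (q * L))%N by rewrite mulnS mul2n -addnn mulnC leq_add2r.
apply: (leq_trans (leq_add (leq_mul (leqnn _) lq2) lq)).
have -> : (p * q * 2 ^ a * 2 ^ 3 = 8 * p * (q * 2 ^ a))%N by lia.
by rewrite mulnA -mulSnr leq_mul2r; apply/orP; right; lia.
Qed.

Lemma avg_Q k : avg (Q k) <= 2 * B k.
Proof.
pose F := {s | s \in codom (nt k)}.
apply: (@rademacher_max_bound R d I _ y r M y_r r_M y_M F
  (fun t i => (i, Some (inr (k, val t)))) (6 * k + a + 3)%N _ (B k)) => //.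
- by move=> t i j [].
- by rewrite !addnS.
- exact: card_level.
- exact: B_gt0.
- exact: B_sqr.
move=> w; rewrite /Q /mx; set s := amax _ _.
exists (Sub (nt k s.2) (codom_f _ _)); exists (vv s.1) => //.
by rewrite ffunE /=.
Qed.

Lemma avg_Q0 : avg Q0 <= 2 * B 0.
Proof.
apply: (@rademacher_max_bound R d I _ y r M y_r r_M y_M unit
  (fun t i => (i, Some (inl tt))) (6 * 0 + a + 3)%N _ (B 0)) => //.
- by move=> t i j [].
- by rewrite !addnS.
- rewrite card_unit mul1n; apply: leq_trans nL _; rewrite leq_exp2l// leq_exp2l//.
  by lia.
- exact: B_gt0.
- exact: B_sqr.
move=> w; exists tt; rewrite /Q0 /mx; set s := amax _ _.
by exists (vv s) => //; rewrite ffunE.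
Qed.

Lemma sum_half_pow k : \sum_(i < k) (2 ^ i)%:R^-1 <= 2 - (2 ^ k)%:R^-1 *+ 2 :> R.
Proof.
elim: k => [|k IH]; first by rewrite big_ord0 expn0 invr1 subrr.
rewrite big_ord_recr /= expnS natrM invfM.
by move: IH; set z := (2 ^ k)%:R^-1; lra.
Qed.

(** [1540 = 4 + 1536]: the direction term contributes [2 * 2 * B 0], the levels [768 * B 0] times a
    geometric sum of at most 2. *)
Lemma fixed_sample_bound :
  avg (fun w : Om => mx (v0, s0) [ffun s => \sum_i sgN R w i * psiS i s]) <=
  6 * 1540 * sL * r * M + 11 * r ^+ 2.
Proof.
apply: le_trans (vector_contraction (v0, s0) psiS_contr) _.
have d0 := dlt_gt0.
have nn : 0 < n%:R :> R by rewrite ltr0n.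
have t1 : n%:R * ((8 * rho / n%:R + 3 * dlt) / 2) <= 11 * rho.
  have : n%:R * dlt <= rho by rewrite mulrC -ler_pdivlMr// dlt_le_rho_n.
  have -> : n%:R * ((8 * rho / n%:R + 3 * dlt) / 2) = 4 * rho + (3 / 2) * (n%:R * dlt).
    by field; rewrite gt_eqF.
  by have := rho_gt0; lra.
rewrite addrC; apply: lerD t1.
apply: le_trans (le_avg sgS_split) _.
rewrite avgD avgZ avg_sum (eq_bigr (fun k : 'I_K.+1 => lam k * avg (Q k))); last first.
  by move=> k _; rewrite avgZ.
have B00 := B_gt0 0.
have h1 : \sum_(k < K.+1) lam k * avg (Q k) <= \sum_(k < K.+1) (768 * B 0) * (2 ^ k)%:R^-1.
  apply: ler_sum => k _; apply: le_trans (ler_wpM2l (lam_ge0 k) (avg_Q k)) _.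
  rewrite /lam /B expn0 mul1r le_eqVlt; apply/orP; left; apply/eqP.
  rewrite -[16%N]/(2 * 8)%N expnMn natrM.
  have k2 : (2 ^ k)%:R != 0 :> R by rewrite pnatr_eq0 -lt0n expn_gt0.
  have k8 : (8 ^ k)%:R != 0 :> R by rewrite pnatr_eq0 -lt0n expn_gt0.
  by field; rewrite k2 k8.
rewrite -mulr_sumr in h1.
have h2 : 768 * B 0 * \sum_(k < K.+1) (2 ^ k)%:R^-1 <= 768 * B 0 * 2.
  rewrite ler_pM2l; last by rewrite mulr_gt0 ?ltr0n.
  apply: le_trans (sum_half_pow _) _.
  by rewrite gerBl mulrn_wge0// invr_ge0.
have := avg_Q0; have B0E : B 0 = 6 * sL * r * M by rewrite /B expn0 mul1r.
have : 0 < 6 * sL * r * M by rewrite -B0E.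
rewrite -B0E; have -> : 6 * 1540 * sL * r * M = 1540 * B 0 by rewrite B0E; ring.
lra.
Qed.

End FixedSample.

(** * Symmetrization and the finite process *)

Section ProductWeights.
Variables (R : rcfType) (I T : finType) (p : T -> R).
Hypothesis p_ge0 : forall t, 0 <= p t.
Hypothesis p_sum1 : \sum_t p t = 1.
Implicit Types q : {ffun I -> T}.

Definition pw q : R := \prod_i p (q i).
Definition EP (h : {ffun I -> T} -> R) : R := \sum_q pw q * h q.

Lemma pw_ge0 q : 0 <= pw q.
Proof. by apply: prodr_ge0. Qed.

Lemma EP_marginal i (F : T -> R) : EP (fun q => F (q i)) = \sum_t p t * F t.
Proof.
pose G j t := if j == i then p t * F t else p t.
have -> : EP (fun q => F (q i)) = \sum_(q : {ffun I -> T}) \prod_j G j (q j).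
  apply: eq_bigr => q _; rewrite /pw (bigD1 i)//= [in RHS](bigD1 i)//= /G eqxx mulrAC.
  by congr (_ * _); apply: eq_bigr => j /negbTE ->.
rewrite -bigA_distr_bigA (bigD1 i)//= [X in _ * X]big1 ?mulr1 => [|j ji].
  by apply: eq_bigr => t _; rewrite /G eqxx.
by rewrite (eq_bigr p) // => t _; rewrite /G (negbTE ji).
Qed.

Lemma pw_sum1 : \sum_q pw q = 1.
Proof. by rewrite -(bigA_distr_bigA (fun _ : I => p)) big1. Qed.

Lemma EP_cst c : EP (fun=> c) = c.
Proof. by rewrite /EP -mulr_suml pw_sum1 mul1r. Qed.

Lemma EPD h k : EP (fun q => h q + k q) = EP h + EP k.
Proof. by rewrite -big_split; apply: eq_bigr => q _; rewrite mulrDr. Qed.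

Lemma EPZ c h : EP (fun q => c * h q) = c * EP h.
Proof. by rewrite mulr_sumr; apply: eq_bigr => q _; rewrite mulrCA. Qed.

Lemma eq_EP h k : h =1 k -> EP h = EP k.
Proof. by move=> hk; apply: eq_bigr => q _; rewrite hk. Qed.

Lemma le_EP h k : (forall q, h q <= k q) -> EP h <= EP k.
Proof. by move=> hk; apply: ler_sum => q _; rewrite ler_wpM2l ?pw_ge0. Qed.

Lemma EP_sum (J : finType) (h : J -> {ffun I -> T} -> R) :
  EP (fun q => \sum_j h j q) = \sum_j EP (h j).
Proof.
by rewrite /EP exchange_big /=; apply: eq_bigr => q _; rewrite mulr_sumr.
Qed.

Lemma EP_avg (Om : finType) (h : {ffun I -> T} -> Om -> R) :
  EP (fun q => avg (h q)) = avg (fun w => EP (h^~ w)).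
Proof.
rewrite /avg /EP exchange_big /= mulr_suml; apply: eq_bigr => q _.
by rewrite -mulr_sumr mulrA.
Qed.

Lemma EP_sqr h : EP h ^+ 2 <= EP (fun q => h q ^+ 2).
Proof.
have : 0 <= EP (fun q => (h q - EP h) ^+ 2).
  by apply: sumr_ge0 => q _; rewrite mulr_ge0 ?pw_ge0 ?sqr_ge0.
rewrite (eq_EP (k := fun q => h q ^+ 2 + ((- 2 * EP h) * h q + EP h ^+ 2))); last first.
  by move=> q; ring.
by rewrite EPD EPD EPZ EP_cst; lra.
Qed.

(* Exchanging the two samples at the indices in [c] preserves their joint law. *)
Lemma EP_swap (c : pred I) (h : {ffun I -> T} -> {ffun I -> T} -> R) :
  EP (fun q => EP (h q)) =
  EP (fun q => EP (fun q' => h [ffun i => if c i then q i else q' i]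
                             [ffun i => if c i then q' i else q i])).
Proof.
pose sw (x : {ffun I -> T} * {ffun I -> T}) :=
  ([ffun i => if c i then x.1 i else x.2 i], [ffun i => if c i then x.2 i else x.1 i]).
have swK : involutive sw.
  move=> [q q']; rewrite /sw; congr (_, _); apply/ffunP => i; rewrite !ffunE /=;
  by case: (c i).
have E k : EP (fun q => EP (k q)) = \sum_(x : {ffun I -> T} * {ffun I -> T}) pw x.1 * pw x.2 * k x.1 x.2.
  rewrite -(pair_bigA _ (fun q q' => pw q * pw q' * k q q')) /=.
  by apply: eq_bigr => q _; rewrite mulr_sumr; apply: eq_bigr => q' _; rewrite mulrA.
rewrite !E (reindex_inj (inv_inj swK)); apply: eq_bigr => -[q q'] _ /=.
congr (_ * _); rewrite /pw -!big_split; apply: eq_bigr => i _; rewrite !ffunE /=.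
by case: (c i); rewrite // mulrC.
Qed.

Variables (S J : finType) (s0 : S) (g : T -> S -> R).
Local Notation Om := {ffun (I * option J)%type -> bool}.

(** A ghost sample [q'] replaces the mean. For each fixed [w] the exchange [EP_swap] puts the signs
    of [w] on the differences, and subadditivity of the maximum separates the two samples. *)
Lemma symmetrization :
  EP (fun q => mx s0 [ffun s => #|I|%:R * (\sum_t p t * g t s) - \sum_i g (q i) s]) <=
  2 * EP (fun q => avg (fun w : Om => mx s0 [ffun s => \sum_i sgN R w i * g (q i) s])).
Proof.
pose D (q q' : {ffun I -> T}) := mx s0 [ffun s => \sum_i (g (q' i) s - g (q i) s)].
apply: (le_trans (y := EP (fun q => EP (D q)))).
  apply: le_EP => q; apply: mx_le => s; rewrite ffunE.
  have -> : #|I|%:R * (\sum_t p t * g t s) = EP (fun q' => \sum_i g (q' i) s).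
    rewrite EP_sum [RHS](eq_bigr (fun=> \sum_t p t * g t s)); last first.
      by move=> i _; exact: (EP_marginal i (g^~ s)).
    by rewrite sumr_const mulr_natl.
  rewrite -[X in _ - X]EP_cst -[- _]mulN1r -EPZ -EPD; apply: le_EP => q'.
  have := mx_ge s0 [ffun s => \sum_i (g (q' i) s - g (q i) s)] s.
  by rewrite ffunE sumrB mulN1r.
pose U (q : {ffun I -> T}) (w : Om) := mx s0 [ffun s => \sum_i sgN R w i * g (q i) s].
have key (w : Om) : EP (fun q => EP (D q)) <=
    EP (fun q' => U q' w) + EP (fun q => U q (flip predT w)).
  rewrite (EP_swap (fun i => w (i, None))).
  rewrite -[X in X + _]EP_cst -EPD; apply: le_EP => q.
  rewrite -[X in _ + X]EP_cst -EPD; apply: le_EP => q'.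
  apply: mx_le => s; rewrite ffunE.
  have h1 := mx_ge s0 [ffun s => \sum_i sgN R w i * g (q' i) s] s.
  have h2 := mx_ge s0 [ffun s => \sum_i sgN R (flip predT w) i * g (q i) s] s.
  move: h1 h2; rewrite !ffunE => h1 h2; apply: le_trans (lerD h1 h2).
  rewrite -big_split le_eqVlt; apply/orP; left; apply/eqP; apply: eq_bigr => i _.
  rewrite !ffunE /sgN sgb_flip /=; case: (w _) => /=; rewrite /sgb; ring.
have cO : (0 < #|Om|)%N by exact: card_signs.
rewrite -[X in X <= _](avg_cst _ cO); apply: le_trans (le_avg key) _.
rewrite avgD -!EP_avg.
have -> : EP (fun q => avg (fun w => U q (flip predT w))) = EP (fun q => avg (U q)).
  by apply: eq_EP => q; exact: (@avg_flip R _ (fun=> predT) (U q)).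
by rewrite [X in _ <= X]mulr_natl mulr2n.
Qed.

End ProductWeights.

Section DiscreteBound.
Variables (R : archiRcfType) (d : nat) (I T V : finType) (v0 : V).
Variables (p : T -> R) (y : T -> 'cV[R]_d) (vv : V -> 'cV[R]_d).
Variables (m : nat) (dlt r s1 sL : R) (a K : nat).
Local Notation L := (2 ^ a)%N.
Local Notation n := #|I|.
Hypothesis p_ge0 : forall t, 0 <= p t.
Hypothesis p_sum1 : \sum_t p t = 1.
Hypothesis dlt_gt0 : 0 < dlt.
Hypothesis r_gt0 : 0 < r.
Hypothesis sL_ge0 : 0 <= sL.
Hypothesis sLE : sL ^+ 2 = L%:R.
Hypothesis n_gt0 : (0 < n)%N.
Hypothesis nL : (n <= 2 ^ L)%N.
Hypothesis nK : (n <= 16 ^ K)%N.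
Hypothesis dlt_small : dlt * (2 ^ L * 16 ^ K)%:R <= r ^+ 2.
Hypothesis dlt_m : r ^+ 2 <= m%:R * dlt.
Hypothesis y_r : forall t, dot (y t) (y t) <= r ^+ 2.
Hypothesis vv1 : forall v, dot (vv v) (vv v) = 1.
Hypothesis vv_net : forall u, dot u u = 1 -> exists v, forall x, dot x x <= r ^+ 2 ->
  dot x u ^+ 2 <= dot x (vv v) ^+ 2 + r ^+ 2 / n%:R.
Hypothesis y_s : forall v, \sum_t p t * dot (y t) (vv v) ^+ 2 <= s1.

Local Notation Sf := {ffun 'I_m -> bool}.
Local Notation f := (@fgrid R m dlt).
Let b t v : R := dot (y t) (vv v) ^+ 2.
Let g t (s : V * Sf) : R := f s.2 (b t s.1).
Let G (q : {ffun I -> T}) := mx (v0, [ffun=> true])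
  [ffun s => n%:R * (\sum_t p t * g t s) - \sum_i g (q i) s].
(** The summand [r ^+ 2] pays for passing from the net to all directions, [n] errors of
    [r ^+ 2 / n], and also ensures that [Mq q] is at least [r]. *)
Let Mq (q : {ffun I -> T}) : R := Num.sqrt (mx v0 [ffun v => \sum_i b (q i) v] + r ^+ 2).

Lemma mxb_ge0 (q : {ffun I -> T}) : 0 <= mx v0 [ffun v => \sum_i b (q i) v].
Proof.
apply: le_trans (mx_ge _ _ v0); rewrite ffunE.
by apply: sumr_ge0 => i _; exact: sqr_ge0.
Qed.

Lemma Mq_sqr q : Mq q ^+ 2 = mx v0 [ffun v => \sum_i b (q i) v] + r ^+ 2.
Proof. by rewrite sqr_sqrtr// addr_ge0 ?mxb_ge0 ?sqr_ge0. Qed.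

Lemma Mq_quadratic (q : {ffun I -> T}) u : \sum_i dot (y (q i)) u ^+ 2 <= Mq q ^+ 2 * dot u u.
Proof.
have [u0|u0] := eqVneq (dot u u) 0.
  rewrite u0 mulr0 big1// => i _; apply/eqP.
  by rewrite eq_le sqr_ge0 andbT; apply: le_trans (dot_CS _ _) _; rewrite u0 mulr0.
have up : 0 < dot u u by rewrite lt_neqAle eq_sym u0 dot_ge0.
set c := Num.sqrt (dot u u).
have cp : 0 < c by rewrite sqrtr_gt0.
have cE : c ^+ 2 = dot u u by rewrite sqr_sqrtr ?dot_ge0.
have [v hv] : exists v, forall x, dot x x <= r ^+ 2 ->
   dot x (c^-1 *: u) ^+ 2 <= dot x (vv v) ^+ 2 + r ^+ 2 / n%:R.
  apply: vv_net; rewrite dotZl dotC dotZl -cE; field; exact: lt0r_neq0.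
have -> : \sum_i dot (y (q i)) u ^+ 2 = (\sum_i dot (y (q i)) (c^-1 *: u) ^+ 2) * dot u u.
  rewrite mulr_suml; apply: eq_bigr => i _; rewrite -cE [dot _ (_ *: _)]dotC dotZl dotC.
  by field; exact: lt0r_neq0.
rewrite ler_pM2r// Mq_sqr.
apply: (le_trans (y := \sum_i (b (q i) v + r ^+ 2 / n%:R))).
  by apply: ler_sum => i _; exact: hv.
rewrite big_split /= sumr_const -[X in _ + X <= _]mulr_natr divfK; last first.
  by rewrite pnatr_eq0 -lt0n.
by rewrite lerD2r; have := mx_ge v0 [ffun v => \sum_i b (q i) v] v; rewrite ffunE.
Qed.

Lemma Mq_gt0 q : 0 < Mq q.
Proof. by rewrite sqrtr_gt0 ltr_wpDl ?mxb_ge0 ?exprn_gt0. Qed.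

Lemma b_le t v : 0 <= b t v <= r ^+ 2.
Proof. by rewrite sqr_ge0; apply: le_trans (dot_CS _ _) _; rewrite vv1 mulr1. Qed.

(** [G] measures mean minus empirical sum, so the all-minus pattern makes the empirical second
    moment appear with a plus sign. *)
Lemma quadratic_le_process (q : {ffun I -> T}) :
  Mq q ^+ 2 <= G q + (n%:R * (s1 + dlt) + r ^+ 2).
Proof.
rewrite Mq_sqr addrA lerD2r; apply: mx_le => v; rewrite ffunE.
apply: (le_trans (y := \sum_i f [ffun=> true] (b (q i) v))).
  apply: ler_sum => i _; apply: fgrid_plus => //.
  by apply: le_trans dlt_m; case/andP: (b_le (q i) v).
have := mx_ge (v0, [ffun=> true])
  [ffun s => n%:R * (\sum_t p t * g t s) - \sum_i g (q i) s] (v, [ffun=> false]).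
rewrite ffunE -/(G q) /g /=.
have -> : \sum_i f [ffun=> false] (b (q i) v) = - \sum_i f [ffun=> true] (b (q i) v).
  by rewrite -sumrN; apply: eq_bigr => i _; rewrite fgrid_minus.
have h : - (\sum_t p t * f [ffun=> false] (b t v)) <= s1 + dlt.
  apply: (le_trans (y := \sum_t (p t * b t v + p t * dlt))).
    rewrite -sumrN; apply: ler_sum => t _; rewrite -mulrN -mulrDr ler_wpM2l//.
    have /andP[b0 _] := b_le t v.
    by have := lerNnormlW (fgrid_le dlt_gt0 [ffun=> false] b0); rewrite lerNl.
  by rewrite big_split /= -mulr_suml p_sum1 mul1r lerD2r; exact: y_s.
have : n%:R * (- (\sum_t p t * f [ffun=> false] (b t v))) <= n%:R * (s1 + dlt).
  by rewrite ler_wpM2l.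
rewrite mulrN; lra.
Qed.

(* Self-bounding: the process bounds the empirical second moment, hence its own fluctuations,
   which yields a quadratic inequality for the root mean of [Mq]. *)
Lemma discrete_bound :
  EP p G <= (12 * 1540 * sL * r) ^+ 2 + 12 * 1540 * sL * r * 
    Num.sqrt (n%:R * (s1 + dlt) + 23 * r ^+ 2) + 22 * r ^+ 2.
Proof.
set A := 12 * 1540 * sL * r; set z := EP p G; set EM := EP p Mq.
have r2 : 0 < r ^+ 2 by rewrite exprn_gt0.
have A0 : 0 <= A by rewrite !mulr_ge0 ?ler0n// ltW.
have EM0 : 0 <= EM.
  by apply: sumr_ge0 => q _; rewrite mulr_ge0 ?pw_ge0// ltW ?Mq_gt0.
have zle : z <= A * EM + 22 * r ^+ 2.
  have := @symmetrization R I T p p_ge0 p_sum1 (V * Sf)%type (unit + 'I_K.+1 * Sf)%type (v0, [ffun=> true]) g.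
  rewrite -/G -/z => /le_trans; apply.
  rewrite (_ : A * EM + 22 * r ^+ 2 = 2 * EP p (fun q => 6 * 1540 * sL * r * Mq q + 11 * r ^+ 2)); last first.
    by rewrite EPD EPZ EP_cst// /A -/EM; ring.
  rewrite ler_pM2l//; apply: le_EP => // q.
  apply: (@fixed_sample_bound R d I V v0 (fun i => y (q i)) vv m dlt r (Mq q) sL a K) => //.
  - exact: Mq_gt0.
  - by rewrite Mq_sqr lerDr mxb_ge0.
  - exact: Mq_quadratic.
have EM2 : EM ^+ 2 <= z + (n%:R * (s1 + dlt) + r ^+ 2).
  apply: le_trans (EP_sqr p_ge0 p_sum1 _) _.
  apply: le_trans (le_EP p_ge0 quadratic_le_process) _.
  by rewrite EPD EP_cst.
set X := n%:R * (s1 + dlt); set Y := X + 23 * r ^+ 2.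
have EMY : EM ^+ 2 <= A * EM + Y by rewrite /Y; move: EM2; rewrite -/X; lra.
have Y0 : 0 <= Y.
  have s10 : 0 <= s1.
    apply: le_trans (y_s v0); apply: sumr_ge0 => t _; rewrite mulr_ge0 ?sqr_ge0//.
  apply: addr_ge0; first by apply: mulr_ge0; rewrite ?ler0n//; apply: addr_ge0 => //; exact: ltW dlt_gt0.
  by apply: mulr_ge0; rewrite ?ler0n// ltW.
set sY := Num.sqrt Y; have sY0 : 0 <= sY by exact: sqrtr_ge0.
have sYE : sY ^+ 2 = Y by rewrite sqr_sqrtr.
(* The positive root of [t ^+ 2 = A * t + Y] is at most [A + sY]. *)
have EMle : EM <= A + sY.
  rewrite leNgt; apply/negP => lt1; nra.
have := ler_wpM2l A0 EMle; rewrite -/Y -/sY; lra.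
Qed.

End DiscreteBound.

(** * Quantile coupling of symmetric laws *)

Section Quantile.
Context {R : realType} (nu : probability (measurableTypeR R) R) (B : R).
Hypothesis B_ge0 : 0 <= B.
Hypothesis nu_B : nu [set x | B < `|x|] = 0%E.
Implicit Types (u x : R).

Definition dist_fun x : R := fine (nu `]-oo, x]%classic).
Local Notation F := dist_fun.

Lemma dist_funE x : (F x)%:E = nu `]-oo, x]%classic.
Proof. by rewrite fineK// fin_num_measure. Qed.

Lemma dist_fun_mono x x' : x <= x' -> F x <= F x'.
Proof.
move=> xx'; rewrite -lee_fin !dist_funE; apply: le_measure; rewrite ?inE//.
exact: subset_itvl.
Qed.

Lemma dist_fun_ge x : B <= x -> F x = 1.
Proof.
move=> Bx; apply/eqP; rewrite -eqe dist_funE eq_le probability_le1//=.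
have -> : (1 = nu setT)%E by rewrite probability_setT.
rewrite -(@setUv _ `]-oo, x]%classic) measureU//; [|exact: measurableC|by rewrite setICr].
rewrite -[leRHS]adde0 leeD2l// -nu_B le_measure ?inE//; first exact: measurableC.
  rewrite (_ : [set x | B < `|x|] = (fun x => `|x|) @^-1` `]B, +oo[); last first.
    by apply/seteqP; split => z /=; rewrite in_itv/= andbT.
  by rewrite -[X in measurable X]setTI; exact: normr_measurable.
by move=> z /=; rewrite in_itv/= => /negP; rewrite -ltNge => xz;
  rewrite (le_lt_trans Bx)// (lt_le_trans xz)// ler_norm.
Qed.

Lemma dist_fun_lt x : x < - B -> F x = 0.
Proof.
move=> xB; apply/eqP; rewrite -eqe dist_funE -measure_le0 -[leRHS]nu_B le_measure ?inE//.
  rewrite (_ : [set x | B < `|x|] = (fun x => `|x|) @^-1` `]B, +oo[); last first.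
    by apply/seteqP; split => z /=; rewrite in_itv/= andbT.
  by rewrite -[X in measurable X]setTI; exact: normr_measurable.
move=> z /=; rewrite in_itv/= => zx; rewrite ltrNr in xB.
by apply: (lt_le_trans xB); rewrite -normrN; apply: (le_trans (y := - z)); rewrite ?lerN2 ?ler_norm.
Qed.

(** The identity as a random variable: its [cdf] is the distribution function of [nu], which gives
    access to right continuity. *)
Let idR : measurableTypeR R -> R := idfun.
#[local] HB.instance Definition _ :=
  @isMeasurableFun.Build _ _ _ _ idR (@measurable_id _ _ setT).

Lemma dist_fun_rcont x u : (forall x', x < x' -> u <= F x') -> u <= F x.
Proof.
move=> H; have := @cdf_right_continuous _ _ _ nu (idR : {RV nu >-> R}) x.
move=> cF; rewrite -lee_fin dist_funE.
have -> : nu `]-oo, x]%classic = cdf (idR : {RV nu >-> R}) x by [].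
rewrite -(cvg_lim _ cF)//; apply: lime_ge.
  by apply/cvg_ex; exists (cdf (idR : {RV nu >-> R}) x).
near=> x'; have -> : cdf (idR : {RV nu >-> R}) x' = (F x')%:E by rewrite dist_funE.
by rewrite lee_fin; apply: H; near: x'; exact: nbhs_right_gt.
Unshelve. all: by end_near. Qed.

(* Restricting to [[-B, B]] and admitting [B] keeps the set nonempty and bounded for every real [u]. *)
Definition quantile u : R := inf [set x | - B <= x /\ (x = B \/ u <= F x)].

Let NB_B : - B <= B.
Proof. by rewrite (le_trans _ B_ge0)// oppr_le0. Qed.

Let qset u := [set x | - B <= x /\ (x = B \/ u <= F x)].

Let qset_inf u : has_inf (qset u).
Proof.
split; last by exists (- B) => x [].
by exists B; split; [|left].
Qed.

Lemma quantile_itv u : - B <= quantile u <= B.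
Proof.
apply/andP; split.
  by apply: lb_le_inf; [exact: (qset_inf u).1|move=> x []].
by apply: ge_inf; [exact: (qset_inf u).2|split; [|left]].
Qed.

Lemma quantile_mono : {homo quantile : u u' / u <= u'}.
Proof.
move=> u u' uu'; apply: lb_le_inf; first exact: (qset_inf u').1.
move=> x [Bx H]; apply: ge_inf; first exact: (qset_inf u).2.
by split => //; case: H => [->|h]; [left|right; exact: le_trans h].
Qed.

(** Right continuity makes the infimum attained. The bounds on [u] settle the outer ranges: [F] is 0
    below [- B] and 1 from [B] on. *)
Lemma quantile_le u x : 0 < u <= 1 -> (quantile u <= x) = (u <= F x).
Proof.
move=> /andP[u0 u1].
have /andP[q1 q2] := quantile_itv u.
have [Bx|xB] := leP B x.
  by rewrite (le_trans q2)// dist_fun_ge.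
have [xB'|Bx'] := ltP x (- B).
  by rewrite dist_fun_lt// [RHS]leNgt u0 leNgt (lt_le_trans xB').
apply/idP/idP => [qx|ux]; last first.
  by apply: ge_inf; [exact: (qset_inf u).2|split => //; right].
apply: dist_fun_rcont => x' xx'.
have [z [Bz H] zx'] : exists2 z, qset u z & z < x'.
  by apply: inf_lt; [exact: (qset_inf u).1|exact: le_lt_trans xx'].
have uz : u <= F z by case: H => [->|//]; rewrite dist_fun_ge.
by apply: le_trans uz _; apply: dist_fun_mono; exact: ltW.
Qed.

Lemma measurable_quantile : measurable_fun setT (quantile : measurableTypeR R -> measurableTypeR R).
Proof. by apply: nondecreasing_measurable => //; exact: quantile_mono. Qed.

Local Notation U := (uniform_prob (@ltr01 R)).

Lemma uniform_gt c : 0 <= c <= 1 -> U [set u | c < u] = (1 - c)%:E.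
Proof.
move=> /andP[c0 c1]; rewrite /uniform_prob integral_uniform_pdf.
rewrite (_ : _ `&` _ = `]c, 1]%classic); last first.
  apply/seteqP; split => u /=; rewrite !in_itv/=; first by move=> [-> /andP[_ ->]].
  by move=> /andP[cu ->]; rewrite cu (le_trans c0 (ltW cu)).
rewrite (eq_integral (cst 1%E)); last first.
  move=> u; rewrite inE/= in_itv/= => /andP[cu u1].
  by rewrite /uniform_pdf (le_trans c0 (ltW cu)) u1 subr0 invr1.
by rewrite integral_cst//= mul1e lebesgue_measure_itv/= lte_fin; case: ltP => // c1';
  rewrite (@le_anti _ _ c 1) ?subrr// c1 c1'.
Qed.

Lemma uniform_unit : U `]0, 1]%classic = 1%E.
Proof.
rewrite /uniform_prob integral_uniform_pdf.
rewrite setIidl; last by move=> u /=; rewrite !in_itv/= => /andP[/ltW -> ->].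
rewrite (eq_integral (cst 1%E)); last first.
  move=> u; rewrite inE/= in_itv/= => /andP[cu u1].
  by rewrite /uniform_pdf (ltW cu) u1 subr0 invr1.
by rewrite integral_cst//= mul1e lebesgue_measure_itv/= lte_fin ltr01 oppr0 adde0.
Qed.

Lemma uniform_compl : U (~` `]0, 1]%classic) = 0%E.
Proof.
by rewrite probability_setC// [X in (_ - X)%E](_ : _ = 1%E) ?subee//; exact: uniform_unit.
Qed.

Lemma uniform_ae : {ae U, forall u, 0 < u <= 1}.
Proof.
exists (~` `]0, 1]%classic); split.
- by apply: measurableC.
- exact: uniform_compl.
- by move=> u /= nu01; rewrite in_itv.
Qed.

(** Reduces equalities of probabilities to []0, 1]], the range where [quantile_le] is available. *)
Lemma uniform_ae_eq (A A' : set (measurableTypeR R)) : measurable A -> measurable A' ->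
  (forall u, 0 < u <= 1 -> A u <-> A' u) -> U A = U A'.
Proof.
move=> mA mA' H.
have E (D : set (measurableTypeR R)) : measurable D -> U D = U (D `&` `]0, 1]%classic).
  move=> mD; rewrite -[in LHS](@setIT _ D) -(@setUv _ `]0, 1]%classic) setIUr measureU//; last 3 first.
  - exact: measurableI.
  - by apply: measurableI => //; exact: measurableC.
  - by rewrite setIACA setICr setI0.
  rewrite [X in (_ + X)%E](_ : _ = 0%E) ?adde0//.
  apply: (@subset_measure0 _ _ _ U _ (~` `]0, 1]%classic)) => //.
  - by apply: measurableI => //; exact: measurableC.
  - exact: measurableC.
  - exact: uniform_compl.
rewrite (E A)// (E A')//; congr (U _); apply/seteqP; split => u /= [h];
by rewrite in_itv/= => hu; split => //; apply/(H u hu).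
Qed.

Lemma nu_gt x : nu `]x, +oo[%classic = (1 - F x)%:E.
Proof.
by rewrite EFinB dist_funE -(@setCitvl _ _ (BRight x)) probability_setC.
Qed.

Lemma quantile_law (A : set (measurableTypeR R)) : measurable A ->
  U (quantile @^-1` A) = nu A.
Proof.
move=> mA.
pose Qm : {mfun (measurableTypeR R) >-> (measurableTypeR R)} :=
  HB.pack_for {mfun (measurableTypeR R) >-> (measurableTypeR R)} (quantile : measurableTypeR R -> measurableTypeR R)
   (isMeasurableFun.Build _ _ _ _ _ measurable_quantile).
rewrite -[LHS]/(distribution U Qm A).
pose m1 : {measure set (measurableTypeR R) -> \bar R} := distribution U Qm.
rewrite -[LHS]/(m1 A).
refine (@measure_unique _ R (measurableTypeR R) (@RGenOInfty.G R)
  (fun k : nat => `](- k%:R), +oo[%classic) _ _ _ _ m1 nu _ _ A mA) => //.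
- exact: RGenOInfty.measurableE.
- move=> _ _ [x ->] [x' ->]; exists (Num.max x x').
  by apply/seteqP; split => u /=; rewrite !in_itv/= !andbT gt_max => /andP.
- by move=> k; exists (- k%:R).
- rewrite -subTset => x _; exists (Num.truncn `|x|).+1 => //=.
  rewrite in_itv/= andbT ltrNl (le_lt_trans (ler_norm _))// normrN.
  by have /andP[] := truncn_itv (normr_ge0 x).
- move=> _ [x ->].
  have F01 : 0 <= F x <= 1.
    by rewrite fine_ge0//= -lee_fin dist_funE probability_le1.
  transitivity ((1 - F x)%:E); last by symmetry; exact: nu_gt.
  rewrite -uniform_gt//; apply: uniform_ae_eq.
  + rewrite -[X in measurable X]setTI; exact: measurable_quantile.
  + have -> : [set u : R | F x < u] = `]F x, +oo[%classic.
      by apply/seteqP; split => u; rewrite /= in_itv/= andbT.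
    exact: measurable_itv.
  + move=> u u01 /=; rewrite in_itv/= andbT ltNge quantile_le//.
    by rewrite -ltNge.
- by move=> k; apply: le_lt_trans (ltry 1%R); exact: probability_le1.
Qed.

End Quantile.

Section SymmetricDifference.
Context d (T : measurableType d) (R : realType) (P : probability T R).

Definition symdiff (A A' : set T) := (A `\` A') `|` (A' `\` A).

Lemma measurable_symdiff A A' : measurable A -> measurable A' -> measurable (symdiff A A').
Proof. by move=> mA mA'; apply: measurableU; exact: measurableD. Qed.

Lemma symdiff_nested A A' : measurable A -> measurable A' -> (A `<=` A' \/ A' `<=` A) ->
  fine (P (symdiff A A')) = `|fine (P A) - fine (P A')|.
Proof.
move=> mA mA'; wlog AA' : A A' mA mA' / A `<=` A'.
  move=> H [AA'|AA']; first by apply: H => //; left.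
  by rewrite distrC -(H A' A)//; [rewrite /symdiff setUC|left].
move=> _; have -> : symdiff A A' = A' `\` A.
  by rewrite /symdiff (_ : A `\` A' = set0) ?set0U// setD_eq0.
rewrite measureD//; last by rewrite (le_lt_trans (probability_le1 _ _))// ltry.
rewrite setIidr// fineB ?fin_num_measure// distrC ger0_norm// subr_ge0.
by rewrite fine_le ?fin_num_measure// le_measure ?inE.
Qed.

Lemma integral_step_sum (I : finType) (D : I -> set T) (a : R) : 0 <= a ->
  (forall i, measurable (D i)) ->
  (\int[P]_x (a + \sum_i a * \1_(D i) x)%:E = (a + \sum_i a * fine (P (D i)))%:E)%E.
Proof.
move=> a0 mD.
have mf i : measurable_fun setT (fun x => (a * \1_(D i) x)%:E).
  by apply/measurable_EFinP; apply: measurable_funM => //; exact: measurable_indic.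
under eq_integral do rewrite EFinD.
rewrite ge0_integralD//=; last 2 first.
- by move=> x _; rewrite lee_fin sumr_ge0// => i _; rewrite mulr_ge0.
- under eq_fun do rewrite -sumEFin; exact: emeasurable_sum.
rewrite integral_cst// [X in (_ * X)%E](_ : _ = 1%E) ?mule1; last exact: probability_setT.
rewrite EFinD; congr (_ + _)%E.
under eq_integral do rewrite -sumEFin.
rewrite ge0_integral_sum//=; last by move=> i x _; rewrite lee_fin mulr_ge0.
rewrite -sumEFin; apply: eq_bigr => i _.
under eq_integral do rewrite EFinM.
have mi : measurable_fun setT (fun x => (\1_(D i) x : R)%:E).
  by apply/measurable_EFinP; exact: measurable_indic.
rewrite (ge0_integralZl P measurableT mi)//.
by rewrite integral_indic// setIT EFinM fineK// fin_num_measure.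
Qed.

End SymmetricDifference.

Section QuantileCoupling.
Context {R : realType}.
Local Notation RT := (measurableTypeR R).

Definition symmetric_law (nu : probability RT R) :=
  forall x : R, nu [set y | y < - x] = nu [set y | x < y].

Section One.
Variables (nu : probability RT R) (B : R).
Hypothesis B_ge0 : 0 <= B.
Hypothesis nu_B : nu [set x | B < `|x|] = 0%E.
Hypothesis sym : symmetric_law nu.

Lemma measurable_ltr (x : R) : measurable ([set y | x < y] : set RT).
Proof.
rewrite (_ : [set y | x < y] = `]x, +oo[%classic); first exact: measurable_itv.
by apply/seteqP; split => u; rewrite /= in_itv/= andbT.
Qed.

Lemma measurable_ltl (x : R) : measurable ([set y | y < x] : set RT).
Proof.
rewrite (_ : [set y | y < x] = `]-oo, x[%classic); first exact: measurable_itv.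
by apply/seteqP; split => u; rewrite /= in_itv/=.
Qed.

Lemma prob_gt x : nu [set y | x < y] = (1 - dist_fun nu x)%:E.
Proof.
rewrite (_ : [set y | x < y] = `]x, +oo[%classic); first exact: nu_gt.
by apply/seteqP; split => u; rewrite /= in_itv/= andbT.
Qed.

Lemma nu_lt_le (x x' : R) : x < x' -> ((dist_fun nu x)%:E <= nu [set y | y < x']%R)%E.
Proof.
move=> xx'; rewrite dist_funE le_measure ?inE//; first exact: measurable_ltl.
by move=> y /=; rewrite in_itv/= => /le_lt_trans; apply.
Qed.

(** The sign change at 1/2 is common to all symmetric laws, so two such quantile functions never
    have opposite signs on []0, 1]]. *)
Lemma quantile_sign u : 0 < u <= 1 ->
  (u <= 1 / 2 -> quantile nu B u <= 0) /\ (1 / 2 < u -> 0 <= quantile nu B u).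
Proof.
move=> u01; split => hu.
  rewrite quantile_le//.
  have : (nu [set y : RT | (0 < y)%R] <= nu (`]-oo, 0%R]%classic : set RT))%E.
    rewrite -sym oppr0 le_measure ?inE//; first exact: measurable_ltl.
    by move=> y /=; rewrite in_itv/= => /ltW.
  by rewrite prob_gt -dist_funE lee_fin; lra.
rewrite leNgt; apply/negP; set q := quantile nu B u => q0.
have : u <= dist_fun nu q by rewrite -(@quantile_le _ nu B).
(* [sym] compares open rays; the point halfway between [q] and 0 leaves room to pass from a closed
   ray to an open one. *)
have q2 : q < - (- q / 2) by lra.
have := nu_lt_le q2; rewrite sym prob_gt lee_fin.
have : dist_fun nu q <= dist_fun nu (- q / 2) by apply: dist_fun_mono; lra.
by lra.
Qed.

Lemma nu_sqr_gt (c : R) : 0 <= c ->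
  fine (nu [set y | c < y ^+ 2]) = 2 * fine (nu [set y | Num.sqrt c < y]).
Proof.
move=> c0; have sc : Num.sqrt c ^+ 2 = c by rewrite sqr_sqrtr.
have s0 := sqrtr_ge0 c.
have -> : [set y | c < y ^+ 2] = [set y | Num.sqrt c < y] `|` [set y | y < - Num.sqrt c].
  apply/seteqP; split => y /=.
    rewrite -{1}sc => h; have [y0|y0] := leP 0 y.
      by left; rewrite -(ltr_pXn2r (n := 2)) ?nnegrE.
    right; rewrite ltrNr -(ltr_pXn2r (n := 2)) ?nnegrE ?sqrrN//.
    by rewrite oppr_ge0 ltW.
  move=> h; rewrite -sc; case: h => h.
    by rewrite ltr_pXn2r ?nnegrE// ltW// (le_lt_trans s0).
  rewrite ltrNr in h; rewrite -(sqrrN y) ltr_pXn2r ?nnegrE//.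
  by rewrite ltW// (le_lt_trans s0).
set A := [set y | Num.sqrt c < y]; set A' := [set y | y < - Num.sqrt c].
have -> : nu (A `|` A') = (nu A + nu A')%E.
  apply: measureU; [exact: measurable_ltr|exact: measurable_ltl|].
  by apply/seteqP; split => y //= -[h1 h2]; rewrite /A /A' /= in h1 h2; lra.
have -> : nu A' = nu A by exact: sym.
rewrite fineD ?fin_num_measure//; try exact: measurable_ltr.
by rewrite mulr_natl mulr2n.
Qed.

End One.
Variables (nu1 nu2 : probability RT R) (B : R).
Hypothesis B_ge0 : 0 <= B.
Hypothesis nu1_B : nu1 [set x | B < `|x|] = 0%E.
Hypothesis nu2_B : nu2 [set x | B < `|x|] = 0%E.
Hypothesis sym1 : symmetric_law nu1.
Hypothesis sym2 : symmetric_law nu2.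
Variables (m : nat) (dlt : R).
Hypothesis dlt_gt0 : 0 < dlt.
Hypothesis B_m : B ^+ 2 <= m%:R * dlt.

Let Q1 := quantile nu1 B.
Let Q2 := quantile nu2 B.
Local Notation U := (uniform_prob (@ltr01 R)).
Let c (j : nat) : R := Num.sqrt (j%:R * dlt).

Let jd_ge0 j : 0 <= j%:R * dlt.
Proof. by rewrite mulr_ge0 ?ler0n// ltW. Qed.

Let up (Q : R -> R) (j : nat) : set RT := [set u | c j < Q u].
Let down (Q : R -> R) (j : nat) : set RT := [set u | Q u < - c j].

Let measurable_up (nu : probability RT R) j : measurable (up (quantile nu B) j).
Proof.
by have := measurable_quantile nu B_ge0 measurableT (measurable_ltr (c j)); rewrite setTI.
Qed.

Let measurable_down (nu : probability RT R) j : measurable (down (quantile nu B) j).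
Proof.
by have := measurable_quantile nu B_ge0 measurableT (measurable_ltl (- c j)); rewrite setTI.
Qed.

Let nested (D D' : set RT) : (forall u u' : R, u <= u' -> D u -> D u') ->
  (forall u u' : R, u <= u' -> D' u -> D' u') -> D `<=` D' \/ D' `<=` D.
Proof.
move=> mD mD'; have [|/existsNP[u /not_implyP[Du nDu]]] := pselect (D `<=` D'); first by left.
right=> u' Du'; have [uu'|/ltW u'u] := leP u u'; first exact: mD Du.
by exfalso; apply: nDu; exact: mD' Du'.
Qed.

Let nested_down (D D' : set RT) : (forall u u' : R, u <= u' -> D u' -> D u) ->
  (forall u u' : R, u <= u' -> D' u' -> D' u) -> D `<=` D' \/ D' `<=` D.
Proof.
move=> mD mD'; have [|/existsNP[u /not_implyP[Du nDu]]] := pselect (D `<=` D'); first by left.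
right=> u' Du'; have [u'u|/ltW uu'] := leP u' u; first exact: mD Du.
by exfalso; apply: nDu; exact: mD' Du'.
Qed.

Let diff_set (k : 'I_m * bool) : set RT :=
  if k.2 then symdiff (up Q1 k.1) (up Q2 k.1) else symdiff (down Q1 k.1) (down Q2 k.1).

Let diff_set_prob k : fine (U (diff_set k)) =
  `|fine (nu1 [set y | c k.1 < y]) - fine (nu2 [set y | c k.1 < y])|.
Proof.
have law1 (A : set RT) : measurable A -> U (Q1 @^-1` A) = nu1 A by exact: quantile_law.
have law2 (A : set RT) : measurable A -> U (Q2 @^-1` A) = nu2 A by exact: quantile_law.
rewrite /diff_set; case: k.2.
  rewrite symdiff_nested; [|exact: measurable_up|exact: measurable_up|]; last first.
    by apply: nested => u u' uu' h; rewrite /up /= (lt_le_trans h)// /Q1 /Q2 (quantile_mono _ B_ge0).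
  by congr (`|fine _ - fine _|); [apply: law1|apply: law2]; exact: measurable_ltr.
rewrite symdiff_nested; [|exact: measurable_down|exact: measurable_down|]; last first.
  by apply: nested_down => u u' uu' h; rewrite /down /= (le_lt_trans _ h)// /Q1 /Q2 (quantile_mono _ B_ge0).
rewrite -(sym1 (c k.1)) -(sym2 (c k.1)).
by congr (`|fine _ - fine _|); [apply: law1|apply: law2]; exact: measurable_ltl.
Qed.

Let sqr_dist (q q' : R) : 0 <= q * q' -> (q - q') ^+ 2 <= `|q ^+ 2 - q' ^+ 2|.
Proof.
move=> qq; have [h|h] := leP (q' ^+ 2) (q ^+ 2).
  rewrite ger0_norm ?subr_ge0//; nra.
rewrite ltr0_norm ?subr_lt0//; nra.
Qed.

Let step_sqrE j (q : R) :
  step dlt j (q ^+ 2) = (c j < q)%R%:R + (q < - c j)%R%:R :> R.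
Proof.
have c0 : 0 <= c j by exact: sqrtr_ge0.
have -> : step dlt j (q ^+ 2) = (c j < `|q|)%R%:R :> R.
  rewrite /step -[X in (X < _)%R](sqr_sqrtr (jd_ge0 j)) -(real_normK (num_real q)).
  by rewrite ltr_pXn2r ?nnegrE.
have [q0|q0] := leP 0 q; [rewrite ger0_norm//|rewrite ltr0_norm//].
  rewrite [(q < _)%R](_ : _ = false) ?addr0//.
  by apply/negbTE; rewrite -leNgt (le_trans _ q0)// oppr_le0.
rewrite [(c j < q)%R](_ : _ = false) ?add0r; first by rewrite ltrNr.
by apply/negbTE; rewrite -leNgt (le_trans (ltW q0)).
Qed.

Let step_sqr j (q q' : R) :
  `|step dlt j (q ^+ 2) - step dlt j (q' ^+ 2)| <=
  `|(c j < q)%R%:R - (c j < q')%R%:R| + `|(q < - c j)%R%:R - (q' < - c j)%R%:R| :> R.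
Proof.
rewrite !step_sqrE opprD addrACA; exact: ler_normD.
Qed.

Let measurable_diff_set k : measurable (diff_set k).
Proof.
case: k => j []; rewrite /diff_set /=; apply: measurable_symdiff;
by [exact: measurable_up|exact: measurable_down].
Qed.

Let indic_symdiff (D D' : set RT) u :
  `|(u \in D)%:R - (u \in D')%:R| = \1_(symdiff D D') u :> R.
Proof.
rewrite indicE /symdiff in_setU !in_setD.
by case: (u \in D); case: (u \in D'); rewrite ?subrr ?subr0 ?sub0r ?normr0 ?normrN1 ?normr1.
Qed.

(** Level sets of monotone functions are nested, so each symmetric difference has probability equal
    to a difference of tails. By symmetry the upper and lower rays contribute equally and together
    give the tail of the square. *)
Lemma quantile_cost :
  (\int[U]_u ((Q1 u - Q2 u) ^+ 2)%:E <= (dlt + \sum_(j < m) dlt *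
   `|fine (nu1 [set y | (j%:R * dlt < y ^+ 2)%R]) - fine (nu2 [set y | (j%:R * dlt < y ^+ 2)%R])|)%:E)%E.
Proof.
apply: (@le_trans _ _ (\int[U]_u (dlt + \sum_(k : 'I_m * bool) dlt * \1_(diff_set k) u)%:E)%E); last first.
  rewrite integral_step_sum; last 2 first.
  - exact: ltW.
  - exact: measurable_diff_set.
  rewrite lee_fin lerD2l.
  rewrite -(pair_bigA _ (fun j b => dlt * fine (U (diff_set (j, b))))) /=.
  apply: ler_sum => j _; rewrite big_bool !diff_set_prob /= -mulrDr ler_pM2l//.
  rewrite !nu_sqr_gt// -mulrBr normrM gtr0_norm//; lra.
have mQ (nu : probability RT R) : measurable_fun setT (quantile nu B : RT -> R).
  exact: measurable_quantile.
apply: ae_ge0_le_integral => //.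
- by move=> u _; rewrite lee_fin sqr_ge0.
- by apply/measurable_EFinP; apply: measurable_funX; apply: measurable_funB; exact: mQ.
- move=> u _; rewrite lee_fin addr_ge0 ?(ltW dlt_gt0)// sumr_ge0// => k _.
  by rewrite mulr_ge0// ltW.
- apply/measurable_EFinP; apply: measurable_funD => //.
  apply: measurable_sum => k; apply: measurable_funM => //.
have [N [mN N0 subN]] := @uniform_ae R.
exists N; split => //; apply: subset_trans subN => u /= nle u01; apply: nle => _.
rewrite lee_fin.
have [n1 p1] := quantile_sign B_ge0 nu1_B sym1 u01.
have [n2 p2] := quantile_sign B_ge0 nu2_B sym2 u01.
have q12 : 0 <= Q1 u * Q2 u.
  have [h|h] := leP u (1 / 2); first by rewrite mulr_le0 ?n1 ?n2.
  by rewrite mulr_ge0 ?p1 ?p2.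
have qm (nu : probability RT R) : quantile nu B u ^+ 2 <= m%:R * dlt.
  apply: le_trans B_m; rewrite -(real_normK (num_real (quantile nu B u))) ler_pXn2r ?nnegrE//.
  by rewrite ler_norml quantile_itv.
apply: le_trans (sqr_dist q12) _.
apply: le_trans (dist_le_steps dlt_gt0 (qm _) (qm _) (sqr_ge0 _) (sqr_ge0 _)) _.
rewrite lerD2l mulr_sumr -(pair_bigA _ (fun j b => dlt * \1_(diff_set (j, b)) u)) /=.
apply: ler_sum => j _; rewrite big_bool /= -mulrDr ler_pM2l//.
apply: le_trans (step_sqr _ _ _) _.
rewrite /diff_set /= -!indic_symdiff.
rewrite !mem_setE /up /down /=.
by [].
Qed.

End QuantileCoupling.

(** * The symmetrized empirical law on the line *)

Section EmpiricalLaw.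
Context {R : realType}.
Local Notation RT := (measurableTypeR R).
Variables (n : nat) (a : 'I_n.+1 -> R).

Let pair_mass (k : nat) : {measure set RT -> \bar R} :=
  measure_add (dirac (a (inord k) : RT)) (dirac (- a (inord k) : RT)).

(** Normalizing a sum of Dirac masses yields a bundled probability, to which the quantile results
    apply; [sym_empirical] is a bare set function. *)
Definition sym_law : probability RT R :=
  mnormalize (msum pair_mass n.+1) (dirac (0 : RT)).

Lemma sym_lawE (A : set RT) : sym_law A =
  (((2 * n.+1)%:R)^-1%:E * \sum_(i < n.+1) (\d_(a i : RT) A + \d_((- a i)%R : RT) A))%E.
Proof.
have mE (D : set RT) : msum pair_mass n.+1 D = (\sum_(i < n.+1) (\d_(a i : RT) D + \d_((- a i)%R : RT) D))%E.
  rewrite /msum; apply: eq_bigr => i _.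
  rewrite (_ : pair_mass i D = (\d_(a (inord i) : RT) D + \d_((- a (inord i))%R : RT) D)%E).
    by rewrite inord_val.
  exact: measure_addE.
have mT : msum pair_mass n.+1 setT = ((2 * n.+1)%:R)%:E.
  rewrite mE (eq_bigr (fun=> 2%:E)); last by move=> i _; rewrite !diracT.
  by rewrite sumEFin sumr_const card_ord natrM mulr_natr.
rewrite /sym_law /= /mnormalize /= mT /=.
rewrite orbF eqe pnatr_eq0 /= mE muleC.
by [].
Qed.

Lemma sym_law_fine (A : set RT) : fine (sym_law A) =
  ((2 * n.+1)%:R)^-1 * \sum_(i < n.+1) ((a i \in A)%:R + (- a i \in A)%:R).
Proof.
by rewrite sym_lawE; under eq_bigr do rewrite !diracE -EFinD; rewrite sumEFin -EFinM.
Qed.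

Lemma symmetric_sym_law : symmetric_law sym_law.
Proof.
move=> x; rewrite !sym_lawE; congr (_ * _)%E; apply: eq_bigr => i _.
rewrite addeC !diracE; congr (_%:R%:E + _%:R%:E)%E; congr nat_of_bool;
by apply/idP/idP; rewrite !inE/= ?ltrN2 // ltrNr.
Qed.

Lemma sym_law_bounded (B : R) : (forall i, `|a i| <= B) -> sym_law [set x | B < `|x|] = 0%E.
Proof.
move=> aB; rewrite sym_lawE big1 ?mule0// => i _.
rewrite !diracE !memNset ?adde0//= ?normrN => h;
by have := aB i; rewrite leNgt h.
Qed.

Lemma sym_law_sqr_gt (c : R) : fine (sym_law [set y | c < y ^+ 2]) =
  (n.+1%:R)^-1 * \sum_(i < n.+1) (c < a i ^+ 2)%R%:R.
Proof.
rewrite sym_law_fine natrM invfM -mulrA mulrCA; congr (_ * _).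
rewrite (eq_bigr (fun i => 2 * (c < a i ^+ 2)%R%:R)); last first.
  move=> i _; rewrite (_ : (a i \in _) = (c < a i ^+ 2)%R); last by apply/idP/idP; rewrite inE.
  rewrite (_ : (- a i \in _) = (c < a i ^+ 2)%R); last by apply/idP/idP; rewrite inE/= sqrrN.
  by rewrite mulr_natl mulr2n.
by rewrite -mulr_sumr mulKf.
Qed.

End EmpiricalLaw.

Section W2Bound.
Local Notation R := Rdefinitions.R.

(** The coupling is the image of the uniform law under the pair of quantile functions. [p1] and [p2]
    need to agree with [nu1] and [nu2] on measurable sets only, which is all that [coupling]
    tests. *)
Lemma W2_le (nu1 nu2 : set RR -> \bar RR) (p1 p2 : probability RR R) (B : R) (m : nat) (dlt : R) :
  (forall A, measurable A -> p1 A = nu1 A) -> (forall A, measurable A -> p2 A = nu2 A) ->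
  0 <= B -> p1 [set x | B < `|x|] = 0%E -> p2 [set x | B < `|x|] = 0%E ->
  symmetric_law p1 -> symmetric_law p2 -> 0 < dlt -> B ^+ 2 <= m%:R * dlt ->
  (W2 nu1 nu2 <= (Num.sqrt (dlt + \sum_(j < m) dlt *
   `|fine (p1 [set y | (j%:R * dlt < y ^+ 2)%R]) - fine (p2 [set y | (j%:R * dlt < y ^+ 2)%R])|))%:E)%E.
Proof.
move=> e1 e2 B0 b1 b2 s1 s2 d0 Bm.
set cost := dlt + _.
have c0 : 0 <= cost.
  by rewrite addr_ge0 ?(ltW d0)// sumr_ge0// => j _; rewrite mulr_ge0// ltW.
pose Q1 := quantile p1 B; pose Q2 := quantile p2 B.
pose z (u : RR) : (RR * RR)%type := (Q1 u, Q2 u).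
have mz : measurable_fun setT z.
  by apply: measurable_fun_pair; apply: measurable_quantile.
pose Z : {mfun RR >-> (RR * RR)%type} :=
  HB.pack_for {mfun RR >-> (RR * RR)%type} z (isMeasurableFun.Build _ _ _ _ _ mz).
pose g : probability (RR * RR)%type RR := distribution (uniform_prob (@ltr01 R)) Z.
have -> : (Num.sqrt cost)%:E = sqrte cost%:E by [].
rewrite /W2 lee_sqrt ?lee_fin//.
apply: (@le_trans _ _ (\int[g]_z ((z.1 - z.2) ^+ 2)%:E)%E).
  apply: ereal_inf_lbound; exists g; split => //; split => A mA.
    rewrite -e1// -(quantile_law B0 b1 mA).
    by rewrite /g /distribution /pushforward /=; congr (uniform_prob _ _); apply/seteqP; split => u //= [].
  rewrite -e2// -(quantile_law B0 b2 mA).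
  by rewrite /g /distribution /pushforward /=; congr (uniform_prob _ _); apply/seteqP; split => u //= [].
rewrite /g ge0_integral_distribution//=; last 2 first.
- apply/measurable_EFinP; apply: measurable_funX; apply: measurable_funB.
    exact: measurable_fst.
  exact: measurable_snd.
- by move=> x; rewrite lee_fin sqr_ge0.
exact: quantile_cost.
Qed.

End W2Bound.

(** * Discretization of the sphere and of the law *)

Section SphereNet.
Variables (R : archiRcfType) (d : nat) (N : nat).
Hypothesis N_gt0 : (0 < N)%N.
Implicit Types u v x : 'cV[R]_d.+1.

Definition cell u : {ffun 'I_d.+1 -> 'I_(2 * N).+1} :=
  [ffun i => inord (Num.truncn ((u i 0 + 1) * N%:R))].

(** Cells without unit vectors receive a basis vector, so every representative is a unit vector. *)
Definition cell_rep (c : {ffun 'I_d.+1 -> 'I_(2 * N).+1}) : 'cV[R]_d.+1 :=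
  if pselect (exists u, dot u u = 1 /\ cell u = c) is left h then projT1 (cid h)
  else delta_mx 0 0.

Lemma cell_rep_unit c : dot (cell_rep c) (cell_rep c) = 1.
Proof.
rewrite /cell_rep; case: pselect => [h|_]; first by case: cid => u [].
by rewrite dot_delta mxE !eqxx.
Qed.

Lemma cell_repK u : dot u u = 1 -> cell (cell_rep (cell u)) = cell u.
Proof.
move=> u1; rewrite /cell_rep; case: pselect => [h|[]]; first by case: cid => v [].
by exists u.
Qed.

Lemma unit_coord u i : dot u u = 1 -> -1 <= u i 0 <= 1.
Proof.
move=> u1; rewrite -ler_norml -(ler_pXn2r (n := 2)) ?nnegrE// real_normK ?num_real// expr1n -u1.
by rewrite /dot (bigD1 i)//= -expr2 lerDl sumr_ge0// => j _; rewrite -expr2 sqr_ge0.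
Qed.

Lemma cell_close u v : dot u u = 1 -> dot v v = 1 -> cell u = cell v ->
  dot (u - v) (u - v) <= d.+1%:R / N%:R.
Proof.
move=> u1 v1 /ffunP cuv.
have N0 : 0 < N%:R :> R by rewrite ltr0n.
have coord i : `|u i 0 - v i 0| <= N%:R^-1.
  have := cuv i; rewrite !ffunE => /(congr1 val) /=.
  have tb (w : 'cV[R]_d.+1) : dot w w = 1 -> 0 <= (w i 0 + 1) * N%:R <= (2 * N)%:R.
    move=> ww; have /andP[w1 w2] := unit_coord i ww.
    have w0 : 0 <= w i 0 + 1 by lra.
    rewrite mulr_ge0 ?(ltW N0)//= natrM ler_wpM2r ?(ltW N0)//; lra.
  have tr (w : 'cV[R]_d.+1) : dot w w = 1 -> (Num.truncn ((w i 0 + 1) * N%:R)%R < (2 * N).+1)%N.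
    move=> w1; have /andP[h0 h1] := tb w w1; rewrite ltnS -(ler_nat R).
    by apply: le_trans h1; rewrite truncn_le.
  rewrite !inordK ?tr// => et.
  have /andP[h0 h1] := truncn_itv (andP (tb u u1)).1.
  have /andP[h0' h1'] := truncn_itv (andP (tb v v1)).1.
  rewrite -et in h0' h1'; rewrite -!natr1 in h1 h1'.
  rewrite -[N%:R^-1]mul1r ler_pdivlMr// -[X in _ * X](gtr0_norm N0) -normrM mulrBl.
  by rewrite ler_norml; apply/andP; split; lra.
apply: (le_trans (y := \sum_(i < d.+1) N%:R^-1)); last first.
  by rewrite sumr_const card_ord -[X in X <= _]mulr_natl.
apply: ler_sum => i _; rewrite !mxE -expr2 -real_normK ?num_real//.
have Ni : N%:R^-1 <= 1 :> R by rewrite invf_le1 ?ler1n.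
apply: le_trans (coord i); rewrite expr2 ler_piMl//.
by apply: le_trans (coord i) Ni.
Qed.

Lemma sqr_dot_dist x u v (c eps : R) : dot u u = 1 -> dot v v = 1 -> dot x x <= c -> 0 <= eps ->
  dot (u - v) (u - v) <= eps ^+ 2 -> `|dot x u ^+ 2 - dot x v ^+ 2| <= 2 * c * eps.
Proof.
move=> u1 v1 xc e0 uv.
have c0 : 0 <= c by apply: le_trans xc; exact: dot_ge0.
have uv4 : dot (u + v) (u + v) <= 2 ^+ 2.
  have E1 : dot (u + v) (u + v) + dot (u - v) (u - v) = 2 ^+ 2.
    by rewrite [dot (u - v) _]dotBl !dotBr dotDl !dotDr u1 v1 (dotC v u); ring.
  by rewrite -E1 lerDl dot_ge0.
rewrite -(ler_pXn2r (n := 2)) ?nnegrE ?mulr_ge0// real_normK ?num_real//.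
have -> : dot x u ^+ 2 - dot x v ^+ 2 = dot x (u - v) * dot x (u + v).
  by rewrite dotBr dotDr; ring.
have -> : (2 * c * eps) ^+ 2 = (c * eps ^+ 2) * (c * 2 ^+ 2) by ring.
rewrite exprMn ler_pM ?sqr_ge0//.
- by apply: le_trans (dot_CS _ _) _; rewrite ler_pM ?dot_ge0.
- by apply: le_trans (dot_CS _ _) _; rewrite ler_pM ?dot_ge0.
Qed.

End SphereNet.

Section NonMeasurable.
Import HBNNSimple.
Context d (T : measurableType d) (R : realType) (P : {measure set T -> \bar R}).

(* The integrand of the theorem need not be measurable: its integral is a supremum
   over the simple functions below it, hence monotone without measurability. *)
Lemma ge0_le_integral_nonmeas (f g : T -> \bar R) :
  (forall x, 0 <= f x)%E -> (forall x, f x <= g x)%E ->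
  (\int[P]_x f x <= \int[P]_x g x)%E.
Proof.
move=> f0 fg; rewrite ge0_integralTE// ge0_integralTE; last first.
  by move=> x; apply: le_trans (fg x).
apply: ge_ereal_sup => _ [h hf <-]; apply: ereal_sup_ubound; exists h => // x.
exact: le_trans (fg x).
Qed.

End NonMeasurable.

(** * Expectations of functions bounded on a set of full measure *)

Section Expectation.
Context d (T : measurableType d) (R : realType) (mu : probability T R) (D : set T).
Hypothesis mD : measurable D.
Hypothesis muD : mu D = 1%E.
Implicit Types f g : T -> R.

Definition Ex f : R := (\int[mu]_(x in D) f x)%R.

Definition bdd_meas f := measurable_fun setT f /\ exists c, forall x, D x -> `|f x| <= c.

Lemma bdd_meas_integrable f : bdd_meas f -> mu.-integrable D (EFin \o f).
Proof.
move=> [mf [c fc]].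
have muDy : (mu D < +oo)%E by rewrite muD ltry.
apply: (measurable_bounded_integrable mD muDy); first exact: measurable_funTS.
by exists c; split; [exact: num_real|move=> x cx y Dy; apply: le_trans (fc y Dy) _; exact: ltW].
Qed.

Lemma bdd_meas_cst c : bdd_meas (fun=> c).
Proof. by split; [exact: measurable_cst|exists `|c|]. Qed.

Lemma bdd_measD f g : bdd_meas f -> bdd_meas g -> bdd_meas (fun x => f x + g x).
Proof.
move=> [mf [c fc]] [mg [c' gc]]; split; first exact: measurable_funD.
by exists (c + c') => x Dx; apply: le_trans (ler_normD _ _) _; rewrite lerD ?fc ?gc.
Qed.

Lemma bdd_measZ k f : bdd_meas f -> bdd_meas (fun x => k * f x).
Proof.
move=> [mf [c fc]]; split; first exact: measurable_funM.
by exists (`|k| * c) => x Dx; rewrite normrM ler_wpM2l ?fc.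
Qed.

Lemma bdd_meas_sum (I : finType) (f : I -> T -> R) : (forall i, bdd_meas (f i)) ->
  bdd_meas (fun x => \sum_i f i x).
Proof.
move=> bf; split; first by apply: measurable_sum => i; case: (bf i).
have /choice[c hc] : forall i, exists c, forall x, D x -> `|f i x| <= c by move=> i; case: (bf i).
exists (\sum_i c i) => x Dx; apply: le_trans (ler_norm_sum _ _ _) _.
by apply: ler_sum => i _; exact: hc.
Qed.

Lemma bdd_meas_bool (b : T -> bool) : measurable [set x | b x] ->
  bdd_meas (fun x => (b x)%:R).
Proof.
move=> mb; split; last by exists 1 => x _; case: (b x); rewrite ?normr1 ?normr0.
rewrite (_ : (fun x => _) = \1_[set x | b x]); first exact: measurable_indic.
apply/funext => x; rewrite indicE; congr (_ %:R); congr nat_of_bool.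
by apply/idP/idP; rewrite inE.
Qed.

Lemma Ex_cst c : Ex (fun=> c) = c.
Proof. by rewrite /Ex Rintegral_cst// [X in fine X](_ : _ = 1%E)// mulr1. Qed.

Lemma ExD f g : bdd_meas f -> bdd_meas g -> Ex (fun x => f x + g x) = Ex f + Ex g.
Proof. by move=> bf bg; rewrite /Ex RintegralD//; exact: bdd_meas_integrable. Qed.

Lemma ExZ k f : bdd_meas f -> Ex (fun x => k * f x) = k * Ex f.
Proof. by move=> bf; rewrite /Ex RintegralZl//; exact: bdd_meas_integrable. Qed.

Lemma Ex_sum (I : finType) (f : I -> T -> R) : (forall i, bdd_meas (f i)) ->
  Ex (fun x => \sum_i f i x) = \sum_i Ex (f i).
Proof.
move=> bf; rewrite /Ex /Rintegral; under eq_integral do rewrite -sumEFin.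
rewrite integral_sum//; last by move=> i; exact: bdd_meas_integrable.
rewrite (eq_bigr (fun i => (Ex (f i))%:E)) ?sumEFin// => i _.
by rewrite /Ex /Rintegral fineK//; apply: integrable_fin_num => //; exact: bdd_meas_integrable.
Qed.

Lemma le_Ex f g : bdd_meas f -> bdd_meas g -> (forall x, D x -> f x <= g x) -> Ex f <= Ex g.
Proof. by move=> bf bg fg; apply: le_Rintegral => //; exact: bdd_meas_integrable. Qed.

Lemma eq_Ex f g : (forall x, D x -> f x = g x) -> Ex f = Ex g.
Proof. by move=> fg; apply: eq_Rintegral => x; rewrite inE => /fg. Qed.

Lemma mu_setID (A : set T) : measurable A -> mu (D `&` A) = mu A.
Proof.
move=> mA; rewrite -[in RHS](@setIT _ A) -(@setUv _ D) setIUr measureU//; last 3 first.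
- exact: measurableI.
- by apply: measurableI => //; exact: measurableC.
- by rewrite setIACA setICr setI0.
rewrite setIC [X in (_ + X)%E](_ : _ = 0%E) ?adde0//.
apply: (@subset_measure0 _ _ _ mu _ (~` D)) => //.
- by apply: measurableI => //; exact: measurableC.
- exact: measurableC.
- by have := probability_setC mu mD; rewrite muD subee.
Qed.

Lemma Ex_bool (b : T -> bool) : measurable [set x | b x] ->
  Ex (fun x => (b x)%:R) = fine (mu [set x | b x]).
Proof.
move=> mb; rewrite /Ex /Rintegral.
rewrite (eq_integral (fun x => (\1_[set x | b x] x)%:E)); last first.
  move=> x _; rewrite indicE; congr (_ %:R%:E); congr nat_of_bool.
  by apply/idP/idP; rewrite inE.
by rewrite integral_indic// setIC; congr fine; exact: mu_setID.
Qed.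

Variables (K : finType) (kap : T -> K).
Hypothesis mkap : forall k, measurable [set x | kap x == k].

Lemma bdd_meas_kap (F : K -> R) : bdd_meas (fun x => F (kap x)).
Proof.
have -> : (fun x => F (kap x)) = (fun x => \sum_k F k * (kap x == k)%:R).
  apply/funext => x; rewrite (bigD1 (kap x))//= eqxx mulr1 big1 ?addr0// => k.
  by rewrite eq_sym => /negbTE ->; rewrite mulr0.
by apply: bdd_meas_sum => k; apply: bdd_measZ; apply: bdd_meas_bool.
Qed.

Lemma Ex_kap (F : K -> R) :
  \sum_k fine (mu [set x | kap x == k]) * F k = Ex (fun x => F (kap x)).
Proof.
have -> : Ex (fun x => F (kap x)) = Ex (fun x => \sum_k F k * (kap x == k)%:R).
  apply: eq_Ex => x _; rewrite (bigD1 (kap x))//= eqxx mulr1 big1 ?addr0// => k.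
  by rewrite eq_sym => /negbTE ->; rewrite mulr0.
rewrite Ex_sum => [|k]; last by apply: bdd_measZ; apply: bdd_meas_bool.
apply: eq_bigr => k _; rewrite ExZ; last exact: bdd_meas_bool.
by rewrite Ex_bool// mulrC.
Qed.

End Expectation.

Section TupleVectors.
Context {R : realType} {d : nat}.
Local Notation RT := (measurableTypeR R).
Implicit Types (x v : d.+1.-tuple RT) (u : 'cV[R]_d.+1).

Definition toC x : 'cV[R]_d.+1 := \col_i (tnth x i : R).
Definition fromC u : d.+1.-tuple RT := [tuple (u i 0 : RT) | i < d.+1].

Lemma fromCK u : toC (fromC u) = u.
Proof. by apply/colP => i; rewrite mxE tnth_mktuple. Qed.

Lemma measurable_coord (i : 'I_d.+1) :
  measurable_fun setT (fun x : d.+1.-tuple RT => (tnth x i : R)).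
Proof. exact: (measurable_tnth i). Qed.

Lemma measurable_dotC u : measurable_fun setT (fun x : d.+1.-tuple RT => dot (toC x) u).
Proof.
apply: measurable_sum => i; under eq_fun do rewrite mxE.
by apply: measurable_funM => //; exact: measurable_coord.
Qed.

Lemma measurable_sqnorm : measurable_fun setT (fun x : d.+1.-tuple RT => dot (toC x) (toC x)).
Proof.
apply: measurable_sum => i; under eq_fun do rewrite mxE.
by apply: measurable_funM; exact: measurable_coord.
Qed.

Variables (mu : probability (d.+1.-tuple RT) R) (r : R).
Hypothesis r_gt0 : 0 < r.

Definition ballD (r : R) : set (d.+1.-tuple RT) := [set x | dot (toC x) (toC x) <= r ^+ 2].
Local Notation D := (ballD r).
Hypothesis mu_ballD_compl : mu (~` D) = 0%E.

Lemma measurable_preimage_itv (f : d.+1.-tuple RT -> R) (j : interval R) :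
  measurable_fun setT f -> measurable (f @^-1` [set` j]).
Proof. by move=> mf; rewrite -[X in measurable X]setTI; exact: mf. Qed.

Lemma measurable_sqr_dot_gt u (c : R) :
  measurable [set x : d.+1.-tuple RT | c < dot (toC x) u ^+ 2].
Proof.
rewrite (_ : [set x | _] = (fun x => dot (toC x) u ^+ 2) @^-1` `]c, +oo[%classic).
  by apply: measurable_preimage_itv; apply: measurable_funX; exact: measurable_dotC.
by apply/seteqP; split => x /=; rewrite in_itv/= andbT.
Qed.

Lemma measurable_ballD : measurable D.
Proof.
rewrite (_ : D = (fun x => dot (toC x) (toC x)) @^-1` `]-oo, (r ^+ 2)]).
  exact: measurable_preimage_itv measurable_sqnorm.
by apply/seteqP; split => x; rewrite /ballD /= in_itv.
Qed.

Lemma mu_ballD : mu D = 1%E.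
Proof.
by have := probability_setC mu (measurableC measurable_ballD);
  rewrite setCK mu_ballD_compl sube0.
Qed.

Lemma integral_ballD (f : d.+1.-tuple RT -> \bar R) : measurable_fun setT f ->
  (\int[mu]_x f x = \int[mu]_(x in D) f x)%E.
Proof.
move=> mf; rewrite [LHS]integralE [RHS]integralE.
have H (g : d.+1.-tuple RT -> \bar R) : measurable_fun setT g -> (forall x, 0 <= g x)%E ->
  (\int[mu]_x g x = \int[mu]_(x in D) g x)%E.
  move=> mg g0; rewrite (@ge0_negligible_integral _ _ _ mu setT (~` D))//.
  - by rewrite setTD setCK.
  - by apply: measurableC; exact: measurable_ballD.
by rewrite !H//; [exact: measurable_funeneg|exact: measurable_funepos].
Qed.

Local Notation EX := (Ex mu D).
Local Notation bm := (bdd_meas D).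

Lemma coord_le x i : D x -> `|tnth x i : R| <= r.
Proof.
rewrite /ballD /= => Dx; have r0 := ltW r_gt0.
rewrite -(ler_pXn2r (n := 2)) ?nnegrE// real_normK ?num_real//; apply: le_trans Dx.
rewrite /dot (bigD1 i)//= mxE -expr2 lerDl.
by apply: sumr_ge0 => j _; rewrite -expr2 sqr_ge0.
Qed.

Lemma bm_coord2 i j : bm (fun x => (tnth x i : R) * (tnth x j : R)).
Proof.
split; first by apply: measurable_funM; exact: measurable_coord.
by exists (r * r) => x Dx; rewrite normrM ler_pM ?coord_le.
Qed.

Definition mom2 : 'M[R]_d.+1 :=
  \matrix_(i, j) Rintegral mu setT (fun x : d.+1.-tuple RT => (tnth x i : R) * (tnth x j : R)).

Lemma mom2E i j : mom2 i j = EX (fun x => (tnth x i : R) * (tnth x j : R)).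
Proof.
rewrite mxE /Ex /Rintegral integral_ballD//.
by apply/measurable_EFinP; case: (bm_coord2 i j).
Qed.

Lemma bm_sqr u : bm (fun x => dot (toC x) u ^+ 2).
Proof.
split; first by apply: measurable_funX; exact: measurable_dotC.
exists (r ^+ 2 * dot u u) => x Dx; rewrite ger0_norm ?sqr_ge0//.
by apply: le_trans (dot_CS _ _) _; rewrite ler_wpM2r ?dot_ge0.
Qed.

Lemma quadratic_second_moment u :
  dot u (mom2 *m u) = EX (fun x => dot (toC x) u ^+ 2).
Proof.
have -> : EX (fun x => dot (toC x) u ^+ 2) =
  EX (fun x => \sum_i \sum_j (u i 0 * u j 0) * ((tnth x i : R) * (tnth x j : R))).
  apply: eq_Ex => x _; rewrite expr2 /dot big_distrlr /=; apply: eq_bigr => i _.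
  by apply: eq_bigr => j _; rewrite !mxE; ring.
have bz i j : bm (fun x => (u i 0 * u j 0) * ((tnth x i : R) * (tnth x j : R))).
  by apply: bdd_measZ; exact: bm_coord2.
rewrite Ex_sum; [|exact: measurable_ballD|exact: mu_ballD|by move=> i; exact: bdd_meas_sum].
apply: eq_bigr => i _.
rewrite Ex_sum; [|exact: measurable_ballD|exact: mu_ballD|by []].
rewrite mxE mulr_sumr; apply: eq_bigr => j _.
rewrite ExZ; [|exact: measurable_ballD|exact: mu_ballD|exact: bm_coord2].
by rewrite mom2E mulrA mulrAC.
Qed.

Lemma Ex_sqr_le u : dot u u = 1 ->
  EX (fun x => dot (toC x) u ^+ 2) <= Num.sqrt (dot (mom2 *m u) (mom2 *m u)).
Proof.
move=> u1; rewrite -quadratic_second_moment.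
apply: le_trans (ler_norm _) _; rewrite -sqrtr_sqr ler_sqrt ?dot_ge0//.
by apply: le_trans (dot_CS _ _) _; rewrite u1 mul1r.
Qed.

End TupleVectors.

(** * Reduction of the expectation to the finite process *)

Section Discretization.
Context {R : realType} {d : nat}.
Local Notation RT := (measurableTypeR R).
Local Notation vec := (d.+1.-tuple RT).
Variables (mu : probability vec R) (r S : R) (n' a : nat).
Local Notation n := n'.+1.
Local Notation L := (2 ^ a)%N.
Hypothesis r_gt0 : 0 < r.
Hypothesis mu_compl : mu (~` (ballD r)) = 0%E.
Hypothesis nL : (n <= 2 ^ L)%N.
Hypothesis S_ub : forall u : 'cV[R]_d.+1, dot u u = 1 ->
  Ex mu (ballD r) (fun x => dot (toC x) u ^+ 2) <= S.

Local Notation D := (ballD r).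
Local Notation EX := (Ex mu D).
(** With this [N] unit vectors in a common cell are within [1 / (2 * n)], which changes squared
    inner products on the ball by at most [r ^+ 2 / n]. The value of [m] below makes [dlt] fine
    enough for [L] levels. *)
Let N := (d.+1 * (2 * n) ^ 2)%N.
Let m := (2 ^ L * 16 ^ L)%N.
Let dlt : R := r ^+ 2 / m%:R.
Let V := {ffun 'I_d.+1 -> 'I_(2 * N).+1}.
Let vv : V -> 'cV[R]_d.+1 := @cell_rep R d N.
Let v0 : V := [ffun=> ord0].
Let T := {ffun V * 'I_m -> bool}.

Let mD : measurable D := @measurable_ballD R d r.
Let muD : mu D = 1%E := mu_ballD mu_compl.

Let r2_gt0 : 0 < r ^+ 2. Proof. by rewrite exprn_gt0. Qed.
Let m_gt0 : (0 < m)%N. Proof. by rewrite muln_gt0 !expn_gt0. Qed.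
Let mR_gt0 : 0 < m%:R :> R. Proof. by rewrite ltr0n. Qed.
Let dlt_gt0 : 0 < dlt. Proof. by rewrite divr_gt0. Qed.
Let m_dlt : m%:R * dlt = r ^+ 2. Proof. by rewrite mulrC divfK// gt_eqF. Qed.
Let N_gt0 : (0 < N)%N. Proof. by rewrite muln_gt0 /= expn_gt0. Qed.
Let vv1 v : dot (vv v) (vv v) = 1. Proof. exact: cell_rep_unit. Qed.
Let n_gt0 : 0 < n%:R :> R. Proof. by rewrite ltr0n. Qed.

Lemma net_close (u : 'cV[R]_d.+1) : dot u u = 1 -> exists v, forall x, dot x x <= r ^+ 2 ->
  `|dot x u ^+ 2 - dot x (vv v) ^+ 2| <= r ^+ 2 / n%:R.
Proof.
move=> u1; exists (cell N u) => x xr.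
have -> : r ^+ 2 / n%:R = 2 * r ^+ 2 * (2 * n%:R)^-1 by rewrite invfM; field; rewrite gt_eqF.
apply: (sqr_dot_dist u1 (vv1 _) xr); first by rewrite invr_ge0 mulr_ge0 ?ler0n.
have ec : cell N u = cell N (vv (cell N u)) by rewrite /vv cell_repK.
apply: le_trans (cell_close N_gt0 u1 (vv1 _) ec) _.
rewrite /N natrM natrX natrM invfM mulrA divff ?pnatr_eq0// mul1r.
by rewrite exprVn.
Qed.

Let b (v : V) (x : vec) : R := dot (toC x) (vv v) ^+ 2.

(** The cell records every step of every slice in the net, so it determines all values
    [fgrid dlt s (b v x)] exactly. *)
Definition kap (x : vec) : T := [ffun k : V * 'I_m => (k.2%:R * dlt < b k.1 x)%R].

Lemma measurable_kap (k : T) : measurable [set x | kap x == k].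
Proof.
have -> : [set x | kap x == k] = \big[setI/setT]_(i : V * 'I_m)
    [set x | (i.2%:R * dlt < b i.1 x)%R == k i].
  apply/seteqP; split => x /=.
    move=> /eqP kx; rewrite -bigcap_seq => i _ /=.
    by rewrite -kx ffunE.
  rewrite -bigcap_seq => H; apply/eqP/ffunP => i; rewrite ffunE.
  by apply/eqP; apply: H; rewrite /= mem_index_enum.
apply: bigsetI_measurable => i _; case: (k i).
  rewrite (_ : [set x | _] = [set x | i.2%:R * dlt < dot (toC x) (vv i.1) ^+ 2]).
    exact: measurable_sqr_dot_gt.
  by apply/seteqP; split => x /=; rewrite eqb_id.
rewrite (_ : [set x | _] = ~` [set x | i.2%:R * dlt < dot (toC x) (vv i.1) ^+ 2]).
  by apply: measurableC; exact: measurable_sqr_dot_gt.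
by apply/seteqP; split => x /=; rewrite eqbF_neg => /negP.
Qed.

(** Cells that miss the ball get 0, so that every representative obeys the norm bound. *)
Definition rep (k : T) : 'cV[R]_d.+1 :=
  if pselect (exists x, D x /\ kap x = k) is left h then toC (projT1 (cid h)) else 0.

Lemma rep_ball k : dot (rep k) (rep k) <= r ^+ 2.
Proof.
rewrite /rep; case: pselect => [h|_]; first by case: cid => x [].
by rewrite /dot big1 ?sqr_ge0// => i _; rewrite mxE mul0r.
Qed.

Lemma rep_step x v (j : 'I_m) : D x ->
  step dlt j (dot (rep (kap x)) (vv v) ^+ 2) = step dlt j (b v x).
Proof.
move=> Dx; rewrite /step /rep; case: pselect => [h|[]]; last by exists x.
case: cid => x' [Dx' /= e]; congr (_%:R); congr nat_of_bool.
by move/ffunP: e => /(_ (v, j)); rewrite !ffunE /=.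
Qed.

Lemma rep_fgrid x v (s : {ffun 'I_m -> bool}) : D x ->
  fgrid dlt s (dot (rep (kap x)) (vv v) ^+ 2) = fgrid dlt s (b v x).
Proof. by move=> Dx; congr (_ * _); apply: eq_bigr => j _; rewrite rep_step. Qed.

Lemma rep_close x v : D x -> dot (rep (kap x)) (vv v) ^+ 2 <= b v x + dlt.
Proof.
move=> Dx.
have bnd y : dot y y <= r ^+ 2 -> dot y (vv v) ^+ 2 <= m%:R * dlt.
  by rewrite m_dlt => yr; apply: le_trans (dot_CS _ _) _; rewrite vv1 mulr1.
have := dist_le_steps dlt_gt0 (bnd _ (rep_ball (kap x))) (bnd _ Dx) (sqr_ge0 _) (sqr_ge0 _).
rewrite big1 ?mulr0 ?addr0 => [|j _]; last by rewrite rep_step// subrr normr0.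
by rewrite ler_norml => /andP[_]; rewrite lerBlDr addrC.
Qed.

Definition pk (k : T) : R := fine (mu [set x | kap x == k]).

Lemma pk_ge0 k : 0 <= pk k.
Proof. exact: fine_ge0. Qed.

Lemma pk_sum (F : T -> R) : \sum_k pk k * F k = EX (fun x => F (kap x)).
Proof. exact: (Ex_kap mD muD measurable_kap). Qed.

Lemma pk_sum1 : \sum_k pk k = 1.
Proof.
rewrite -[RHS](Ex_cst mD muD) -(pk_sum (fun=> 1)).
by apply: eq_bigr => k _; rewrite mulr1.
Qed.

Let GG (q : {ffun 'I_n -> T}) : R := mx (v0, [ffun=> true])
  [ffun s : V * {ffun 'I_m -> bool} =>
    #|'I_n|%:R * (\sum_t pk t * fgrid dlt s.2 (dot (rep t) (vv s.1) ^+ 2)) -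
    \sum_i fgrid dlt s.2 (dot (rep (q i)) (vv s.1) ^+ 2)].

Lemma EP_process (sL : R) : 0 <= sL -> sL ^+ 2 = L%:R ->
  EP pk GG <= (12 * 1540 * sL * r) ^+ 2 + 12 * 1540 * sL * r *
    Num.sqrt (n%:R * (S + 2 * dlt) + 23 * r ^+ 2) + 22 * r ^+ 2.
Proof.
move=> sL0 sLE.
have dm : dlt * (2 ^ L * 16 ^ L)%:R <= r ^+ 2 by rewrite mulrC -/m m_dlt.
have nK : (#|'I_n| <= 16 ^ L)%N.
  by rewrite card_ord (leq_trans nL)// leq_exp2r// expn_gt0.
have nL' : (#|'I_n| <= 2 ^ L)%N by rewrite card_ord.
have nn : (0 < #|'I_n|)%N by rewrite card_ord.
have md : r ^+ 2 <= m%:R * dlt by rewrite m_dlt.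
have net u : dot u u = 1 -> exists v, forall x, dot x x <= r ^+ 2 ->
    dot x u ^+ 2 <= dot x (vv v) ^+ 2 + r ^+ 2 / #|'I_n|%:R.
  move=> /net_close[v hv]; exists v => x /hv; rewrite card_ord ler_norml => /andP[_].
  by rewrite lerBlDl.
have ys v : \sum_t pk t * dot (rep t) (vv v) ^+ 2 <= S + dlt.
  rewrite (pk_sum (fun t => dot (rep t) (vv v) ^+ 2)).
  apply: (@le_trans _ _ (EX (fun x => b v x + dlt))).
    apply: (le_Ex mD muD) => [| |x]; last exact: rep_close.
      exact: (bdd_meas_kap D measurable_kap (fun t => dot (rep t) (vv v) ^+ 2)).
    by apply: bdd_measD; [exact: bm_sqr|exact: bdd_meas_cst].
  rewrite (ExD mD muD); [|exact: bm_sqr|exact: bdd_meas_cst].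
  by rewrite (Ex_cst mD muD) lerD2r; exact: S_ub.
have := @discrete_bound R d.+1 'I_n T V v0 pk rep vv m dlt r (S + dlt) sL a L
  pk_ge0 pk_sum1 dlt_gt0 r_gt0 sL0 sLE nn nL' nK dm md rep_ball vv1 net ys.
rewrite [X in Num.sqrt (X%:R * _ + _)]card_ord.
by rewrite (_ : S + 2 * dlt = S + dlt + dlt); last by ring.
Qed.

(** Duality: the pattern that takes the sign of each tail difference turns the sum of absolute
    values into one value of the process. Replacing [u] by a net direction costs [r ^+ 2 / n + dlt]
    in the mean and again in the sample. *)
Lemma pathwise_bound (xs : 'I_n -> vec) (u : 'cV[R]_d.+1) : (forall i, D (xs i)) ->
  dot u u = 1 ->
  dlt + \sum_(j < m) dlt * `|EX (fun x => step dlt j (dot (toC x) u ^+ 2)) -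
     n%:R^-1 * \sum_i step dlt j (dot (toC (xs i)) u ^+ 2)| <=
  3 * dlt + 2 * r ^+ 2 / n%:R + n%:R^-1 * GG [ffun i => kap (xs i)].
Proof.
move=> Dxs u1.
pose t (j : 'I_m) := EX (fun x => step dlt j (dot (toC x) u ^+ 2)) -
     n%:R^-1 * \sum_i step dlt j (dot (toC (xs i)) u ^+ 2).
pose s : {ffun 'I_m -> bool} := [ffun j => 0 <= t j].
have bstep w j : bdd_meas D (fun x : vec => step dlt j (dot (toC x) w ^+ 2)).
  by apply: bdd_meas_bool; exact: measurable_sqr_dot_gt.
have bfg w : bdd_meas D (fun x : vec => fgrid dlt s (dot (toC x) w ^+ 2)).
  by apply: bdd_measZ; apply: bdd_meas_sum => j; apply: bdd_measZ.
have Efg w : EX (fun x => fgrid dlt s (dot (toC x) w ^+ 2)) =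
   dlt * \sum_(j < m) sgb R (s j) * EX (fun x => step dlt j (dot (toC x) w ^+ 2)).
  rewrite /fgrid (ExZ mD muD); last by apply: bdd_meas_sum => j; exact: bdd_measZ.
  rewrite (Ex_sum mD muD); last by move=> j; exact: bdd_measZ.
  by congr (_ * _); apply: eq_bigr => j _; rewrite (ExZ mD muD).
have E1 : \sum_(j < m) dlt * `|t j| = EX (fun x => fgrid dlt s (dot (toC x) u ^+ 2)) -
    n%:R^-1 * \sum_i fgrid dlt s (dot (toC (xs i)) u ^+ 2).
  have -> : \sum_i fgrid dlt s (dot (toC (xs i)) u ^+ 2) =
      dlt * \sum_(j < m) sgb R (s j) * \sum_i step dlt j (dot (toC (xs i)) u ^+ 2).
    rewrite /fgrid -mulr_sumr exchange_big /=; congr (_ * _).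
    by apply: eq_bigr => j _; rewrite mulr_sumr.
  rewrite Efg -mulr_sumr [_^-1 * (_ * _)]mulrCA -mulrBr; congr (_ * _).
  rewrite mulr_sumr -sumrB; apply: eq_bigr => j _.
  rewrite [_^-1 * (_ * _)]mulrCA -mulrBr -/(t j) /s ffunE.
  by case: leP => ht; rewrite /sgb ?mul1r ?mulN1r; [rewrite ger0_norm|rewrite ltr0_norm].
rewrite E1.
have [v hv] := net_close u1.
have h1 : EX (fun x => fgrid dlt s (dot (toC x) u ^+ 2)) <=
    EX (fun x => fgrid dlt s (b v x)) + (r ^+ 2 / n%:R + dlt).
  rewrite -[X in _ + X](Ex_cst mD muD) -(ExD mD muD); [|exact: bfg|exact: bdd_meas_cst].
  apply: (le_Ex mD muD) => [| |x Dx]; first exact: bfg.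
    by apply: bdd_measD; [exact: bfg|exact: bdd_meas_cst].
  have := fgrid_lip dlt_gt0 s (dot (toC x) u ^+ 2) (b v x).
  rewrite ler_norml => /andP[_ h]; have hx := hv _ Dx.
  rewrite -lerBlDl; apply: le_trans h _; by rewrite lerD2r.
have h2 i : fgrid dlt s (b v (xs i)) <= fgrid dlt s (dot (toC (xs i)) u ^+ 2) + (r ^+ 2 / n%:R + dlt).
  have := fgrid_lip dlt_gt0 s (dot (toC (xs i)) u ^+ 2) (b v (xs i)).
  rewrite ler_norml => /andP[h _]; have hx := hv _ (Dxs i).
  have lin (x y z e f : R) : - (z + e) <= x - y -> z <= f -> y <= x + (f + e) by lra.
  exact: lin h hx.
have h2s : n%:R^-1 * \sum_i fgrid dlt s (b v (xs i)) <=
   n%:R^-1 * (\sum_i fgrid dlt s (dot (toC (xs i)) u ^+ 2)) + (r ^+ 2 / n%:R + dlt).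
  rewrite -[X in _ + X](mulKf (lt0r_neq0 n_gt0)) -mulrDr ler_pM2l ?invr_gt0//.
  apply: le_trans (ler_sum _ (fun i _ => h2 i)) _.
  by rewrite big_split /= sumr_const card_ord mulr_natl.
have h3 := mx_ge (v0, [ffun=> true]) [ffun s : V * {ffun 'I_m -> bool} =>
    #|'I_n|%:R * (\sum_t pk t * fgrid dlt s.2 (dot (rep t) (vv s.1) ^+ 2)) -
    \sum_i fgrid dlt s.2 (dot (rep ([ffun i => kap (xs i)] i)) (vv s.1) ^+ 2)] (v, s).
rewrite ffunE /= -/(GG _) (pk_sum (fun t => fgrid dlt s (dot (rep t) (vv v) ^+ 2))) in h3.
rewrite (_ : EX (fun x => fgrid dlt s (dot (rep (kap x)) (vv v) ^+ 2)) =
  EX (fun x => fgrid dlt s (b v x))) in h3; last by apply: eq_Ex => x Dx; exact: rep_fgrid.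
rewrite (eq_bigr (fun i => fgrid dlt s (b v (xs i)))) in h3; last first.
  by move=> i _; rewrite ffunE rep_fgrid.
have h4 : EX (fun x => fgrid dlt s (b v x)) - n%:R^-1 * \sum_i fgrid dlt s (b v (xs i)) <=
   n%:R^-1 * GG [ffun i => kap (xs i)].
  rewrite -(ler_pM2l n_gt0) mulrBr !mulVKf ?lt0r_neq0//.
  by move: h3; rewrite card_ord.
rewrite -mulrA.
move: h1 h2s h4.
set e1 := EX _; set e2 := EX _; set e3 := _ * \sum_i _; set e4 := _ * \sum_i _; set e5 := _ * GG _.
set rn := r ^+ 2 / _.
by move=> h1 h2s h4; lra.
Qed.

Context {dO : measure_display} {Om : measurableType dO} (P : probability Om R).
Variables (X : 'I_n -> Om -> vec) (f : Om -> \bar R).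
Hypothesis mX : forall i, measurable_fun setT (X i).
Hypothesis X_iid : forall A : 'I_n -> set vec, (forall i, measurable (A i)) ->
  P (\bigcap_(i in [set: 'I_n]) (X i @^-1` A i)) = (\prod_(i < n) mu (A i))%E.
Hypothesis f_ge0 : forall w, (0 <= f w)%E.
Hypothesis f_le : forall w (k : nat) (e c : R), (forall i, D (X i w)) -> 0 < e -> r ^+ 2 <= k%:R * e ->
  (forall u : 'cV[R]_d.+1, dot u u = 1 ->
     e + \sum_(j < k) e * `|EX (fun x => step e j (dot (toC x) u ^+ 2)) -
        n%:R^-1 * \sum_i step e j (dot (toC (X i w)) u ^+ 2)| <= c) ->
  (f w <= c%:E)%E.

Let kapX (w : Om) : {ffun 'I_n -> T} := [ffun i => kap (X i w)].

Let preX (A : set vec) i : measurable A -> measurable (X i @^-1` A).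
Proof. by move=> mA; rewrite -[X in measurable X]setTI; exact: mX. Qed.

Lemma kapX_cell q : [set w | kapX w == q] =
  \bigcap_(i in [set: 'I_n]) (X i @^-1` [set x | kap x == q i]).
Proof.
apply/seteqP; split => w /=; first by move=> /eqP <- i _ /=; rewrite ffunE.
by move=> H; apply/eqP/ffunP => i; rewrite ffunE; apply/eqP; exact: H.
Qed.

Lemma measurable_kapX q : measurable [set w | kapX w == q].
Proof.
rewrite kapX_cell; apply: fin_bigcap_measurable => // i _.
by apply: preX; exact: measurable_kap.
Qed.

Lemma prob_kapX q : fine (P [set w | kapX w == q]) = pw pk q.
Proof.
rewrite kapX_cell X_iid; last by move=> i; exact: measurable_kap.
rewrite (eq_bigr (fun i => (pk (q i))%:E)); last first.
  by move=> i _; rewrite /pk fineK// fin_num_measure//; exact: measurable_kap.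
by rewrite /pw -(big_morph EFin EFinM erefl).
Qed.

Lemma integral_kapX (h : {ffun 'I_n -> T} -> R) :
  (\int[P]_w (h (kapX w))%:E = (EP pk h)%:E)%E.
Proof.
have PT : P setT = 1%E by exact: probability_setT.
have bh := bdd_meas_kap setT measurable_kapX h.
rewrite -[LHS]fineK; last first.
  by apply: integrable_fin_num => //; exact: bdd_meas_integrable bh.
congr EFin; rewrite -[LHS]/(Ex P setT (fun w => h (kapX w))).
rewrite -(Ex_kap measurableT PT measurable_kapX h); apply: eq_bigr => q _.
by rewrite prob_kapX.
Qed.

Lemma good_event : P (~` (\bigcap_(i in [set: 'I_n]) (X i @^-1` D))) = 0%E.
Proof.
rewrite (@probability_setC _ _ _ P); last by apply: fin_bigcap_measurable => // i _; exact: preX.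
by rewrite X_iid// big1 ?subee// => i _; exact: muD.
Qed.

Lemma expected_le_process : (\int[P]_w f w <=
  (3 * dlt + 2 * r ^+ 2 / n%:R + n%:R^-1 * EP pk GG)%:E)%E.
Proof.
pose h (q : {ffun 'I_n -> T}) := 3 * dlt + 2 * r ^+ 2 / n%:R + n%:R^-1 * GG q.
have EPh : EP pk h = 3 * dlt + 2 * r ^+ 2 / n%:R + n%:R^-1 * EP pk GG.
  rewrite /h (EPD pk (fun=> 3 * dlt + 2 * r ^+ 2 / n%:R) (fun q => n%:R^-1 * GG q)).
  by rewrite EPZ EP_cst//; exact: pk_sum1.
rewrite -EPh -integral_kapX.
pose A : set Om := \bigcap_(i in [set: 'I_n]) (X i @^-1` D).
have mA : measurable A by apply: fin_bigcap_measurable => // i _; exact: preX.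
have fh w : A w -> (f w <= (h (kapX w))%:E)%E.
  move=> Aw; apply: (f_le (k := m) (e := dlt)) => //; first by move=> i; exact: Aw.
    by rewrite m_dlt.
  by move=> u u1; apply: pathwise_bound => // i; exact: Aw.
(* A measurable majorant of [f] on the whole space: it is [+oo] off the almost sure event, a null
   set that does not affect the integral. *)
pose g w := ((h (kapX w))%:E + +oo * (\1_(~` A) w)%:E)%E.
have fg w : (f w <= g w)%E.
  rewrite /g indicE in_setC; have [wA|wA] := boolP (w \in A).
    by rewrite mule0 adde0; apply: fh; rewrite inE in wA.
  by rewrite mule1 addey// leey.
have mh : measurable_fun setT (fun w => (h (kapX w))%:E).
  by apply/measurable_EFinP; case: (bdd_meas_kap setT measurable_kapX h).
have mg : measurable_fun setT g.
  apply: emeasurable_funD => //; apply: emeasurable_funM => //.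
  by apply/measurable_EFinP; apply: measurable_indic; exact: measurableC.
apply: le_trans (ge0_le_integral_nonmeas P f_ge0 fg) _.
have g0 w : (0 <= g w)%E by apply: le_trans (f_ge0 w) (fg w).
rewrite (@ge0_negligible_integral _ _ _ P setT (~` A))//; last 2 first.
- exact: measurableC.
- exact: good_event.
rewrite setTD setCK (eq_integral (fun w => (h (kapX w))%:E)); last first.
  by move=> w wA; rewrite /g indicE in_setC wA mule0 adde0.
rewrite [leRHS](@negligible_integral _ _ _ P setT (~` A))//.
- by rewrite setTD setCK.
- exact: measurableC.
- apply: (bdd_meas_integrable measurableT) (bdd_meas_kap setT measurable_kapX h).
  exact: probability_setT.
- exact: good_event.
Qed.

(** [27 = 3 + 2 + 22] collects the multiples of [r ^+ 2]; the term [5 * c0] comes from bounding the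
    root of [y ^+ 2 + 25 * r ^+ 2] by [y + 5 * r]. The factor [L%:R >= 1] absorbs lower powers. *)
Lemma expected_bound (c0 : R) : 0 <= S -> c0 = 12 * 1540 ->
  (\int[P]_w f w <= (n%:R^-1 * ((c0 ^+ 2 + 5 * c0 + 27) * (L%:R * r ^+ 2) +
     c0 * Num.sqrt L%:R * r * Num.sqrt (n%:R * S)))%:E)%E.
Proof.
move=> S0 c0E; apply: le_trans expected_le_process _; rewrite lee_fin.
have c00 : 0 <= c0 by rewrite c0E mulr_ge0 ?ler0n.
have r0 := r_gt0; have r20 := r2_gt0.
have L1 : 1 <= L%:R :> R by rewrite ler1n expn_gt0.
set sL := Num.sqrt L%:R.
have sLE : sL ^+ 2 = L%:R by rewrite sqr_sqrtr ?ler0n.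
have sL0 : 0 <= sL by exact: sqrtr_ge0.
have sL1 : 1 <= sL by rewrite -(ler_pXn2r (n := 2)) ?nnegrE// sLE expr1n.
have := EP_process sL0 sLE; rewrite -c0E.
set z := EP pk GG => hz.
have nd : n%:R * dlt <= r ^+ 2.
  rewrite /dlt mulrC mulrAC ler_pdivrMr// ler_pM2l// ler_nat.
  by apply: leq_trans nL _; rewrite leq_pmulr// expn_gt0.
set y := Num.sqrt (n%:R * S).
have y0 : 0 <= y by exact: sqrtr_ge0.
have nS0 : 0 <= n%:R * S by rewrite mulr_ge0 ?ler0n.
have yE : y ^+ 2 = n%:R * S by rewrite sqr_sqrtr.
have sq : Num.sqrt (n%:R * (S + 2 * dlt) + 23 * r ^+ 2) <= y + 5 * r.
  have y5 : 0 <= y + 5 * r by rewrite addr_ge0// mulr_ge0 ?ler0n// ltW.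
  rewrite -[leRHS](ger0_norm y5) -sqrtr_sqr ler_sqrt ?sqr_ge0//.
  have -> : n%:R * (S + 2 * dlt) = n%:R * S + 2 * (n%:R * dlt) by ring.
  rewrite -yE; set nd' := n%:R * dlt in nd *.
  have yr : 0 <= y * r by rewrite mulr_ge0// ltW.
  have -> : (y + 5 * r) ^+ 2 = y ^+ 2 + 10 * (y * r) + 25 * r ^+ 2 by ring.
  lra.
have -> : 3 * dlt + 2 * r ^+ 2 / n%:R + n%:R^-1 * z = n%:R^-1 * (3 * (n%:R * dlt) + 2 * r ^+ 2 + z).
  by field; rewrite gt_eqF.
rewrite ler_pM2l ?invr_gt0//.
have cs0 : 0 <= c0 * sL * r by rewrite !mulr_ge0// ltW.
have h1 := ler_wpM2l cs0 sq.
have h2 : c0 * (sL * r ^+ 2) <= c0 * (sL ^+ 2 * r ^+ 2).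
  by rewrite ler_wpM2l// ler_wpM2r ?(ltW r20)// expr2 ler_peMl.
have h3 : r ^+ 2 <= sL ^+ 2 * r ^+ 2 by rewrite ler_peMl ?(ltW r20)// sLE.
move: hz h1 h2 h3; rewrite -sLE.
have -> : (c0 * sL * r) ^+ 2 = c0 ^+ 2 * (sL ^+ 2 * r ^+ 2) by ring.
have -> : c0 * sL * r * (y + 5 * r) = c0 * sL * r * y + 5 * (c0 * (sL * r ^+ 2)) by ring.
have -> : (c0 ^+ 2 + 5 * c0 + 27) * (sL ^+ 2 * r ^+ 2) =
  c0 ^+ 2 * (sL ^+ 2 * r ^+ 2) + 5 * (c0 * (sL ^+ 2 * r ^+ 2)) + 27 * (sL ^+ 2 * r ^+ 2) by ring.
set k := Num.sqrt (n%:R * (S + 2 * dlt) + _); set nd' := n%:R * dlt in nd *.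
set t1 := sL ^+ 2 * r ^+ 2; set t2 := sL * r ^+ 2; set t3 := c0 * sL * r.
set t4 := c0 * t1; set t5 := c0 * t2; set t6 := c0 ^+ 2 * t1; set t7 := t3 * y; set t8 := t3 * k.
set t9 := r ^+ 2 in nd *.
by clearbody t1 t2 t4 t5 t6 t7 t8 t9 nd'; lra.
Qed.

End Discretization.

(** * Slices *)

Section MaxSliced.
Local Notation R := Rdefinitions.R.
Variable d : nat.
Local Notation vec := (d.+1.-tuple RR).
Implicit Types (x v : vec) (u : 'cV[R]_d.+1).

Lemma dotvE x v : dotv x v = dot (toC x : 'cV[R]_d.+1) (toC v).
Proof. by apply: eq_bigr => i _; rewrite !mxE. Qed.

Lemma norm2_unit v : norm2 v = 1 -> dot (toC v : 'cV[R]_d.+1) (toC v) = 1.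
Proof.
rewrite /norm2 dotvE => h.
by rewrite -[LHS](@sqr_sqrtr R) ?dot_ge0// h expr1n.
Qed.

Lemma toC_neg x : toC (negv x) = - (toC x : 'cV[R]_d.+1).
Proof. by apply/colP => i; rewrite !mxE tnth_map. Qed.

Lemma norm2cE u : norm2c u = Num.sqrt (dot u u).
Proof. by congr Num.sqrt; apply: eq_bigr => i _; rewrite expr2. Qed.

Lemma opnorm_ub (M : 'M[R]_d.+1) u : dot u u = 1 -> norm2c (M *m u) <= opnorm M.
Proof.
move=> u1; apply: ub_le_sup; last by exists u => //=; rewrite norm2cE u1 sqrtr1.
(* The Frobenius norm: [sup] dominates its set only once the set is known to be bounded. *)
exists (Num.sqrt (\sum_i dot (row i M)^T (row i M)^T)) => _ [v /= v1 <-].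
have {}v1 : dot v v = 1.
  move: v1; rewrite norm2cE => v1.
  by rewrite -[LHS](@sqr_sqrtr R) ?dot_ge0// v1 expr1n.
rewrite norm2cE ler_sqrt; last by apply: sumr_ge0 => i _; exact: dot_ge0.
apply: ler_sum => i _; have -> : (M *m v) i 0 = dot (row i M)^T v.
  by rewrite mxE; apply: eq_bigr => j _; rewrite !mxE.
by rewrite -expr2; apply: le_trans (dot_CS _ _) _; rewrite v1 mulr1.
Qed.

Lemma opnorm_ge0 (M : 'M[R]_d.+1) : 0 <= opnorm M.
Proof.
have e1 : dot (delta_mx 0 0 : 'cV[R]_d.+1) (delta_mx 0 0) = 1.
  by rewrite dot_delta mxE !eqxx.
by apply: le_trans (opnorm_ub _ e1); rewrite norm2cE sqrtr_ge0.
Qed.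

Variables (mu : probability vec R) (r : R).
Hypothesis r_gt0 : 0 < r.

Lemma ball_compl : supported_in_ball mu r -> mu (~` (ballD r)) = 0%E.
Proof.
move=> supp; rewrite -supp; congr (mu _); apply/seteqP.
have P x : (ballD r x) <-> ~ (r < norm2 x).
  rewrite /ballD /norm2 dotvE /=; have r0 := ltW r_gt0.
  have E : (dot (toC x : 'cV[R]_d.+1) (toC x) <= r ^+ 2) =
      ~~ (r < Num.sqrt (dot (toC x : 'cV[R]_d.+1) (toC x))).
    by rewrite -leNgt -{2}(ger0_norm r0) -sqrtr_sqr ler_sqrt// exprn_ge0.
  by rewrite E; split => /negP.
split => x /=; first by move=> h; apply: contrapT => /P.
by move=> h /P.
Qed.

Hypothesis compl : mu (~` (ballD r)) = 0%E.

Lemma second_moment_le u : dot u u = 1 ->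
  Ex mu (ballD r) (fun x => dot (toC x) u ^+ 2) <= opnorm (second_moment mu).
Proof.
move=> u1; apply: le_trans (opnorm_ub (second_moment mu) u1).
by rewrite norm2cE; exact: (Ex_sqr_le r_gt0 compl).
Qed.

Hypothesis sym : symmetric_measure mu.

Lemma negvK : involutive (@negv d.+1).
Proof. by move=> x; apply: eq_from_tnth => i; rewrite !tnth_map opprK. Qed.

Section Slice.
Variables (n' : nat) (xs : 'I_n'.+1 -> vec) (v : vec).
Local Notation n := n'.+1.
Hypothesis v1 : norm2 v = 1.
Hypothesis Dxs : forall i, ballD r (xs i).
Let u : 'cV[R]_d.+1 := toC v.
Let u1 : dot u u = 1. Proof. exact: norm2_unit. Qed.

Lemma measurable_slice : measurable_fun setT (fun x : vec => dotv x v : RR).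
Proof.
rewrite (_ : (fun x => _) = (fun x => dot (toC x : 'cV[R]_d.+1) u)).
  exact: measurable_dotC.
by apply/funext => x; rewrite dotvE.
Qed.

Let sl : {mfun vec >-> RR} :=
  HB.pack_for {mfun vec >-> RR} (fun x : vec => dotv x v : RR)
    (isMeasurableFun.Build _ _ _ _ _ measurable_slice).

Definition slice_law : probability RR R := distribution mu sl.
Definition slice_emp : probability RR R := sym_law (fun i => dot (toC (xs i) : 'cV[R]_d.+1) u).

Lemma slice_lawE (A : set RR) : slice_law A = mu [set x | A (dot (toC x : 'cV[R]_d.+1) u)].
Proof.
rewrite /slice_law /distribution /pushforward; congr (mu _).
by apply/seteqP; split => x /=; rewrite dotvE.
Qed.

Lemma slice_empE (A : set RR) : measurable A ->
  slice_emp A = pushforward (sym_empirical xs) (fun x => dotv x v) A.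
Proof.
move=> mA; rewrite /slice_emp sym_lawE /pushforward /sym_empirical.
congr (_ * _)%E; apply: eq_bigr => i _; rewrite !diracE.
have E : dotv (negv (xs i)) v = - dot (toC (xs i) : 'cV[R]_d.+1) u.
  by rewrite dotvE toC_neg -scaleN1r dotZl mulN1r.
congr (_%:R%:E + _%:R%:E)%E; congr nat_of_bool; apply/idP/idP;
by rewrite !inE /preimage /= ?E ?dotvE.
Qed.

Lemma slice_bound (x : vec) : ballD r x -> `|dot (toC x : 'cV[R]_d.+1) u| <= r.
Proof.
move=> Dx; have r0 := ltW r_gt0.
rewrite -(ler_pXn2r (n := 2)) ?nnegrE// real_normK ?num_real//.
by apply: le_trans (dot_CS _ _) _; rewrite u1 mulr1.
Qed.

Lemma measurable_slice_set (A : set RR) : measurable A ->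
  measurable [set x : vec | A (dot (toC x : 'cV[R]_d.+1) u)].
Proof.
move=> mA; have := measurable_dotC u measurableT mA; rewrite setTI.
by [].
Qed.

Lemma slice_law_bounded : slice_law [set y | r < `|y|] = 0%E.
Proof.
rewrite slice_lawE; apply: (@subset_measure0 _ _ _ mu _ (~` (ballD r))) => //.
- apply: (measurable_slice_set (A := [set y | r < `|y|])).
  rewrite (_ : [set y | _] = (fun y : R => `|y|) @^-1` `]r, +oo[%classic).
    by rewrite -[X in measurable X]setTI; exact: normr_measurable.
  by apply/seteqP; split => y /=; rewrite in_itv/= andbT.
- by apply: measurableC; exact: measurable_ballD.
- by move=> x /= h Dx; have := slice_bound Dx; rewrite leNgt h.
Qed.

Lemma slice_law_sym : symmetric_law slice_law.
Proof.
move=> c; rewrite !slice_lawE /= sym; last exact: (measurable_slice_set (measurable_ltl (- c))).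
congr (mu _); apply/seteqP; split => x /=.
  by move=> [y h <-]; rewrite toC_neg -scaleN1r dotZl mulN1r ltrNr.
by move=> h; exists (negv x); rewrite ?negvK//= toC_neg -scaleN1r dotZl mulN1r ltrN2.
Qed.

Lemma slice_law_step j e : fine (slice_law [set y | j%:R * e < y ^+ 2]) =
  Ex mu (ballD r) (fun x => step e j (dot (toC x : 'cV[R]_d.+1) u ^+ 2)).
Proof.
rewrite slice_lawE /= /step.
rewrite (@Ex_bool _ _ _ mu _ (measurable_ballD r) (mu_ballD compl)
  (fun x => (j%:R * e < dot (toC x : 'cV[R]_d.+1) u ^+ 2)%R))//.
exact: measurable_sqr_dot_gt.
Qed.

Lemma W2_slice_le (k : nat) (e c : R) : 0 < e -> r ^+ 2 <= k%:R * e ->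
  e + \sum_(j < k) e * `|Ex mu (ballD r) (fun x => step e j (dot (toC x) u ^+ 2)) -
        n%:R^-1 * \sum_i step e j (dot (toC (xs i)) u ^+ 2)| <= c ->
  (W2 (pushforward mu (fun x => dotv x v)) (pushforward (sym_empirical xs) (fun x => dotv x v))
     <= (Num.sqrt c)%:E)%E.
Proof.
move=> e0 ke hc.
have eb : slice_emp [set y | r < `|y|] = 0%E.
  by apply: sym_law_bounded => i; exact: slice_bound.
apply: (@le_trans _ _ _ _ _ (@W2_le _ _ slice_law slice_emp r k e _ _ _ _ _ _ _ _ _)) => //.
- by move=> A mA; rewrite -slice_empE.
- exact: ltW.
- exact: slice_law_bounded.
- exact: slice_law_sym.
- exact: symmetric_sym_law.
rewrite lee_fin ler_wsqrtr//; apply: le_trans hc.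
rewrite lerD2l; apply: ler_sum => j _.
by rewrite slice_law_step sym_law_sqr_gt.
Qed.

End Slice.
End MaxSliced.

(** The binary logarithm of [n] is rounded up to an integer and then to a power of two; as [n >= 2],
    each rounding costs at most a factor 2. *)
Lemma log_scale (R : realType) (n : nat) : (1 < n)%N ->
  exists2 a, (n <= 2 ^ (2 ^ a))%N & (2 ^ a)%:R <= 4 / ln 2 * ln n%:R :> R.
Proof.
move=> n1; have n0 : (0 < n)%N by exact: ltnW.
pose l := up_log 2 n; pose a := up_log 2 l.
have nl : (n <= 2 ^ l)%N by exact: up_logP.
have l0 : (0 < l)%N by rewrite lt0n; apply/eqP => l0; move: nl; rewrite l0 leqNgt n1.
have la : (l <= 2 ^ a)%N by exact: up_logP.
have al : (2 ^ a <= 2 * l)%N.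
  have [l1|l1] := leqP l 1.
    by rewrite /a (_ : l = 1%N)//; apply/eqP; rewrite eqn_leq l1.
  have := @up_log_bounds 2 l isT l1; rewrite -/a => /andP[lo _].
  have a0 : (0 < a)%N by rewrite up_log_gt0.
  by rewrite -(prednK a0) expnS leq_mul2l /= ltnW.
exists a; first by apply: leq_trans nl _; rewrite leq_exp2l.
have ln2 : 0 < ln 2 :> R by rewrite ln_gt0// ltr1n.
have lo : (2 ^ l.-1 < n)%N by have /andP[] := @up_log_bounds 2 n isT n1.
have h1 : (l.-1)%:R * ln 2 <= ln n%:R :> R.
  rewrite mulr_natl -lnXn ?ltr0n//.
  rewrite ler_ln ?posrE ?exprn_gt0 ?ltr0n//.
  by rewrite -natrX ler_nat ltnW.
have h2 : ln 2 <= ln n%:R :> R by rewrite ler_ln ?posrE ?ltr0n// ler_nat.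
have h3 : l%:R * ln 2 <= 2 * ln n%:R :> R.
  by rewrite -(prednK l0) -natr1 mulrDl mul1r; lra.
apply: (@le_trans _ _ (2 * l%:R)); first by rewrite -natrM ler_nat.
rewrite mulrAC ler_pdivlMr//; lra.
Qed.

(** * The bound for a given radius and the degenerate case *)

Section Main.
Local Notation R := Rdefinitions.R.
Variables (d : nat) (mu : probability (d.+1.-tuple RR) R) (n' a : nat).
Local Notation n := n'.+1.
Local Notation L := (2 ^ a)%N.
Local Notation vec := (d.+1.-tuple RR).
Hypothesis nL : (n <= 2 ^ L)%N.
Hypothesis sym : symmetric_measure mu.
Context {dT : measure_display} {T : measurableType dT} (P : probability T R).
Variable X : 'I_n -> T -> vec.
Hypothesis iid : iid_with_law P X mu.
Local Notation s := (opnorm (second_moment mu)).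
Let W w := W21 mu (sym_empirical (fun i => X i w)).

(** The sphere in dimension [d.+1] is nonempty, so the supremum is not that of the empty set, which
    is [-oo]. *)
Lemma W21_ge0 w : (0 <= W w)%E.
Proof.
have e1 : dot (delta_mx 0 0 : 'cV[R]_d.+1) (delta_mx 0 0) = 1.
  by rewrite dot_delta mxE !eqxx.
apply: (@le_trans _ _ (W2 (pushforward mu (fun x => dotv x (fromC (delta_mx 0 0))))
  (pushforward (sym_empirical (fun i => X i w)) (fun x => dotv x (fromC (delta_mx 0 0)))))).
  exact: sqrte_ge0.
apply: ereal_sup_ubound; exists (fromC (delta_mx 0 0)) => //=.
by rewrite /norm2 dotvE fromCK e1 sqrtr1.
Qed.

Lemma W21_sqr_bound (r c0 : R) : 0 < r -> mu (~` (ballD r)) = 0%E -> c0 = 12 * 1540 ->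
  (\int[P]_w (W w * W w) <= (n%:R^-1 * ((c0 ^+ 2 + 5 * c0 + 27) * (L%:R * r ^+ 2) +
     c0 * Num.sqrt L%:R * r * Num.sqrt (n%:R * s)))%:E)%E.
Proof.
move=> r0 compl c0E; case: iid => mX iidX.
apply: (@expected_bound R d mu r s n' a r0 compl nL _ _ _ P X) => //.
- exact: second_moment_le.
- by move=> w; rewrite mule_ge0 ?W21_ge0.
- move=> w k e c Dw e0 ke hc.
  have c_ge0 : 0 <= c.
    have e1 : dot (delta_mx 0 0 : 'cV[R]_d.+1) (delta_mx 0 0) = 1.
      by rewrite dot_delta mxE !eqxx.
    apply: le_trans (hc _ e1); rewrite addr_ge0 ?(ltW e0)// sumr_ge0// => j _.
    by rewrite mulr_ge0// ltW.
  have Wc : (W w <= (Num.sqrt c)%:E)%E.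
    apply: ge_ereal_sup => _ [v /= v1 <-].
    by apply: (W2_slice_le r0 compl sym v1 Dw e0 ke); exact: hc (norm2_unit v1).
  have -> : c%:E = ((Num.sqrt c)%:E * (Num.sqrt c)%:E)%E.
    by rewrite -EFinM -expr2 sqr_sqrtr.
  by apply: lee_pmul => //; exact: W21_ge0.
- exact: opnorm_ge0.
Qed.

(* If the second moment vanishes, then [mu] is supported in every ball, and the bound for the
   radius [t] tends to [0] with [t]. *)
Lemma degenerate_compl (r t : R) : 0 < r -> mu (~` (ballD r)) = 0%E -> s = 0 -> 0 < t ->
  mu (~` (ballD t)) = 0%E.
Proof.
move=> r0 compl s0 t0.
have mD := @measurable_ballD R d r; have muD := mu_ballD compl.
have mc : measurable (~` (ballD t) : set vec) by apply: measurableC; exact: measurable_ballD.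
pose b (x : vec) : bool := ~~ (dot (toC x : 'cV[R]_d.+1) (toC x) <= t ^+ 2).
have bE : [set x : vec | b x] = ~` (ballD t) by apply/seteqP; split => x /= /negP.
have h : t ^+ 2 * Ex mu (ballD r) (fun x => (b x)%:R) <= 0.
  rewrite -(ExZ mD muD); last by apply: bdd_meas_bool; rewrite bE.
  apply: (@le_trans _ _ (Ex mu (ballD r) (fun x => \sum_i dot (toC x : 'cV[R]_d.+1) (delta_mx i 0) ^+ 2))).
    apply: (le_Ex mD muD) => [| |x Dx].
    - by apply: bdd_measZ; apply: bdd_meas_bool; rewrite bE.
    - by apply: bdd_meas_sum => i; exact: bm_sqr.
    under eq_bigr do rewrite dotC.
    rewrite sum_dot_delta /b.
    have [ht|ht] := leP (dot (toC x : 'cV[R]_d.+1) (toC x)) (t ^+ 2).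
      by rewrite mulr0 dot_ge0.
    by rewrite mulr1 ltW.
  rewrite (Ex_sum mD muD); last by move=> i; exact: bm_sqr.
  apply: sumr_le0 => i _; rewrite -s0; apply: second_moment_le => //.
  by rewrite dot_delta mxE !eqxx.
rewrite -bE; apply/eqP; rewrite eq_le measure_ge0 andbT.
rewrite -[X in (X <= _)%E]fineK; last by rewrite fin_num_measure// bE.
rewrite lee_fin -(Ex_bool mD muD); last by rewrite bE.
by move: h; rewrite pmulr_rle0// exprn_gt0.
Qed.

End Main.

(** With [A = r ^+ 2 * l / n] one has [s * q = A] and [s * Num.sqrt q = Num.sqrt (s * A)]; these
    match the two terms on the left after [L] is replaced by [c * l]. *)
Lemma bound_rearrange (R : realType) (c0 c L l r s n q : R) : 0 <= c0 -> 0 <= c -> 0 <= L ->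
  0 <= l -> 0 < r -> 0 < s -> 0 < n -> L <= c * l ->
  q = r ^+ 2 * l / (n * s) ->
  n^-1 * ((c0 ^+ 2 + 5 * c0 + 27) * (L * r ^+ 2) + c0 * Num.sqrt L * r * Num.sqrt (n * s)) <=
  ((c0 ^+ 2 + 5 * c0 + 27) * c + c0 * Num.sqrt c + 1) * s * (q + Num.sqrt q).
Proof.
move=> c00 c1 L0 l0 r0 s0 n0 Ll qE.
set K := c0 ^+ 2 + 5 * c0 + 27.
have K0 : 0 <= K by rewrite !addr_ge0 ?sqr_ge0// mulr_ge0.
pose A := r ^+ 2 * l / n.
have A0 : 0 <= A by rewrite divr_ge0 ?mulr_ge0 ?sqr_ge0// ltW.
have sq : s * q = A by rewrite qE /A; field; rewrite !gt_eqF.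
have q0 : 0 <= q by rewrite -(pmulr_rge0 _ s0) sq.
have ssq : s * Num.sqrt q = Num.sqrt (s * A).
  rewrite -{1}(ger0_norm (ltW s0)) -sqrtr_sqr -sqrtrM ?sqr_ge0//.
  by rewrite -sq; congr Num.sqrt; ring.
have h1 : n^-1 * (K * (L * r ^+ 2)) <= K * c * A.
  have -> : K * c * A = n^-1 * (K * (c * l * r ^+ 2)) by rewrite /A; field; rewrite gt_eqF.
  rewrite ler_pM2l ?invr_gt0// ler_wpM2l// ler_wpM2r//.
  exact: sqr_ge0.
have h2 : n^-1 * (c0 * Num.sqrt L * r * Num.sqrt (n * s)) <= c0 * Num.sqrt c * Num.sqrt (s * A).
  have -> : n^-1 * (c0 * Num.sqrt L * r * Num.sqrt (n * s)) =
      c0 * (n^-1 * Num.sqrt L * r * Num.sqrt (n * s)) by ring.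
  rewrite -[leRHS]mulrA ler_wpM2l//.
  have lhs0 : 0 <= n^-1 * Num.sqrt L * r * Num.sqrt (n * s).
    by rewrite !mulr_ge0 ?sqrtr_ge0 ?invr_ge0// ltW.
  rewrite -(ger0_norm lhs0) -sqrtr_sqr -sqrtrM// ler_sqrt; last first.
    exact: mulr_ge0 c1 (mulr_ge0 (ltW s0) A0).
  rewrite !exprMn !sqr_sqrtr ?mulr_ge0 ?(ltW n0) ?(ltW s0)//.
  have -> : c * (s * A) = n^-1 ^+ 2 * (c * l) * r ^+ 2 * (n * s).
    by rewrite /A; field; rewrite gt_eqF.
  rewrite ler_wpM2r ?mulr_ge0 ?(ltW n0) ?(ltW s0)// ler_wpM2r ?sqr_ge0//.
  by rewrite ler_wpM2l// sqr_ge0.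
have sA0 : 0 <= Num.sqrt (s * A) by exact: sqrtr_ge0.
have sc0 : 0 <= Num.sqrt c by exact: sqrtr_ge0.
have -> : (K * c + c0 * Num.sqrt c + 1) * s * (q + Num.sqrt q) =
  (K * c + c0 * Num.sqrt c + 1) * (A + Num.sqrt (s * A)) by rewrite -ssq -[in RHS]sq; ring.
clearbody K A.
rewrite mulrDr; move: h1 h2; set x := n^-1 * _; set y := n^-1 * _; move=> h1 h2.
have p1 : 0 <= K * c * Num.sqrt (s * A) by rewrite !mulr_ge0.
have p2 : 0 <= c0 * Num.sqrt c * A by rewrite !mulr_ge0.
have -> : (K * c + c0 * Num.sqrt c + 1) * (A + Num.sqrt (s * A)) =
  K * c * A + K * c * Num.sqrt (s * A) + c0 * Num.sqrt c * A +
  c0 * Num.sqrt c * Num.sqrt (s * A) + A + Num.sqrt (s * A) by ring.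
move: h1 h2 p1 p2; set e1 := K * c * A; set e2 := K * c * _; set e3 := c0 * _ * A.
set e4 := c0 * _ * _; set e5 := Num.sqrt (s * A) in sA0 *.
by move=> h1 h2 p1 p2; clearbody x y e1 e2 e3 e4 e5; lra.
Qed.

Theorem theorem1p7 :
  exists C : RR, 1 <= C /\
  forall (d : nat) (r : RR) (mu : probability (d.-tuple RR) RR) (n : nat)
         (dT : measure_display) (T : measurableType dT) (P : probability T RR)
         (X : 'I_n -> T -> d.-tuple RR),
    (0 < d)%N -> 0 < r ->
    symmetric_measure mu -> supported_in_ball mu r ->
    (2 <= n)%N -> iid_with_law P X mu ->
    let s := opnorm (second_moment mu) in
    let q := r ^+ 2 * ln (n%:R : RR) / (n%:R * s) in
    (\int[P]_w (W21 mu (sym_empirical (fun i => X i w)) * W21 mu (sym_empirical (fun i => X i w)))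
      <= (C * s * (q + Num.sqrt q))%:E)%E.
Proof.
pose c0 : RR := 12 * 1540; pose c : RR := 4 / ln 2.
have c00 : 0 <= c0 by rewrite mulr_ge0 ?ler0n.
have ln2 : 0 < ln 2 :> RR by rewrite ln_gt0// ltr1n.
have c_ge0 : 0 <= c by rewrite divr_ge0 ?ler0n// ltW.
pose K1 : RR := c0 ^+ 2 + 5 * c0 + 27.
have K0 : 0 <= K1.
  by apply: addr_ge0; [apply: addr_ge0; [exact: sqr_ge0|exact: mulr_ge0 (ler0n _ _) c00]|exact: ler0n].
(* [c0] is the constant of [discrete_bound] and [c] that of [log_scale]; the summand 1 secures
   [1 <= C]. *)
exists (K1 * c + c0 * Num.sqrt c + 1); split.
  by rewrite lerDr addr_ge0// mulr_ge0// sqrtr_ge0.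
move=> d r mu n dT T P X d0 r0 sym supp n2 iid.
case: d d0 mu X sym supp iid => // d _ mu X sym supp iid.
case: n n2 X iid => // n' n2 X iid.
cbv zeta; set s := opnorm _; set q := _ / (_ * s).
have [a nL aln] := log_scale RR n2.
have compl := ball_compl r0 supp.
have s_ge0 : 0 <= s by exact: opnorm_ge0.
have lnn : 0 <= ln (n'.+1%:R : RR) by rewrite ln_ge0// ler1n.
have [s0|s_neq0] := eqVneq s 0; last first.
  apply: le_trans (W21_sqr_bound nL sym iid r0 compl (erefl c0)) _; rewrite lee_fin.
  apply: (bound_rearrange (l := ln (n'.+1%:R : RR)) c00 c_ge0 _ lnn r0 _ _ aln (erefl _)).
  - exact: ler0n.
  - by rewrite lt_neqAle eq_sym s_neq0.
  - by rewrite ltr0n.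
(* The factor [s] makes the right side 0, whatever the value of [q], so the integral has to lie
   below every [e > 0]. *)
rewrite [in leRHS]s0 mulr0 mul0r; apply/lee_addgt0Pr => e e0; rewrite add0e.
pose k : RR := n'.+1%:R^-1 * (K1 * (2 ^ a)%:R).
have k0 : 0 <= k by rewrite !mulr_ge0 ?invr_ge0 ?ler0n.
(* The bound for radius [t] is [k * t ^+ 2], which this choice keeps below [e]; [k + 1] makes the
   denominator positive. *)
pose t := Num.sqrt (e / (k + 1)).
have k1 : 0 < k + 1 by rewrite ltr_wpDl.
have t0 : 0 < t by rewrite sqrtr_gt0 divr_gt0.
have tE : t ^+ 2 = e / (k + 1) by rewrite sqr_sqrtr// divr_ge0// ltW.
have complt := degenerate_compl r0 compl s0 t0.
apply: le_trans (W21_sqr_bound nL sym iid t0 complt (erefl c0)) _; rewrite lee_fin.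
rewrite -/s s0 mulr0 sqrtr0 mulr0 addr0 -/K1 tE.
have -> : n'.+1%:R^-1 * (K1 * ((2 ^ a)%:R * (e / (k + 1)))) = e * k / (k + 1) :> RR.
  by rewrite /k; ring.
rewrite ler_pdivrMr// ler_pM2l// lerDl.
exact: ler01.
Qed.
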